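(* Let $n\in\{2,3\}$ and let $S\in (L^2(\mathbb R^n))^n$ have compact support $\Omega$. Let $u_p^\infty(\hat x,\omega)$ and $u_s^\infty(\hat x,\omega)$, $\hat x\in\mathbb S^{n-1}$, $\omega\in(0,+\infty)$, be the compressional and shear far field patterns of $S$, and define $$\mathcal I_f(z):=\frac{1}{(2\pi)^n}\int_{\mathbb S^{n-1}}\int_0^{+\infty}\left[u_p^{\infty}(\hat x,\omega)+u_s^{\infty}\Big(\hat x,\frac{k_p}{k_s}\omega\Big)\right]e^{ik_p\hat x\cdot z}\,\frac{\omega^{n-1}}{(\lambda+2\mu)^{n/2}}\,d\omega\, ds_{\hat x},\quad z\in\mathbb R^n.$$ Then $\mathcal I_f=S$.
   Context: The Lamé constants $\lambda,\mu$ are real with $\mu>0$ and $2\mu+\lambda>0$. For circular frequency $\omega>0$, $k_p:=\omega/\sqrt{\lambda+2\mu}$ and $k_s:=\omega/\sqrt{\mu}$ (so $k_p/k_s=\sqrt{\mu/(\lambda+2\mu)}$ is independent of $\omega$). $\mathbb S^{n-1}$ is the unit sphere in $\mathbb R^n$, $ds_{\hat x}$ its surface measure, and $a\cdot b=\sum_j a_jb_j$. For $\hat x=(\hat x_1,\hat x_2)^T\in\mathbb S^1$, $\hat x^\perp=(-\hat x_2,\hat x_1)^T$. Far field patterns: for $n=2,3$, $$u_p^\infty(\hat x,\omega)=\hat x\int_\Omega e^{-ik_p\hat x\cdot y}\,S(y)\cdot\hat x\,dy;$$ for $n=2$, $$u_s^\infty(\hat x,\omega)=\hat x^\perp\int_\Omega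 e^{-ik_s\hat x\cdot y}\,S(y)\cdot\hat x^\perp\,dy;$$ for $n=3$, $$u_s^\infty(\hat x,\omega)=\int_\Omega e^{-ik_s\hat x\cdot y}\,\hat x\times(S(y)\times\hat x)\,dy.$$ In $u_s^\infty(\hat x,\frac{k_p}{k_s}\omega)$ the shear pattern is evaluated at frequency $\frac{k_p}{k_s}\omega$, i.e. with $k_s$ replaced by $\frac{k_p}{k_s}\omega/\sqrt\mu$. The integral defining $\mathcal I_f$ is understood in the inverse Fourier–Plancherel sense: it is the limit in $(L^2(\mathbb R^n))^n$ as $R\to+\infty$ of the integrals with $\int_0^{+\infty}d\omega$ replaced by $\int_0^{R}d\omega$; equality is in $(L^2(\mathbb R^n))^n$. *)

(* Defs.v *)
From HB Require Import structures.
From mathcomp Require Import all_boot all_order all_algebra.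
From mathcomp Require Import all_classical all_reals all_analysis.
From mathcomp.real_closed Require Import complex.

Set Implicit Arguments.
Unset Strict Implicit.
Unset Printing Implicit Defensive.

Import Order.TTheory GRing.Theory Num.Theory.
Import numFieldNormedType.Exports.

Local Open Scope classical_set_scope.
Local Open Scope ring_scope.
Local Open Scope complex_scope.

Section measurable_rV.
Context {R : realType} (n : nat).

Let coord (i : 'I_n) (x : 'rV[R]_n) : measurableTypeR R := x 0 i.

Let rV_set0 : g_sigma_preimage coord set0.
Proof. exact: sigma_algebra0. Qed.

Let rV_setC A : g_sigma_preimage coord A -> g_sigma_preimage coord (~` A).
Proof. exact: sigma_algebraC. Qed.

Let rV_bigcup (F : (set 'rV[R]_n)^nat) :
  (forall i, g_sigma_preimage coord (F i)) ->
  g_sigma_preimage coord (\bigcup_i (F i)).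
Proof. exact: sigma_algebra_bigcup. Qed.

(* The sigma-algebra generated by the coordinates, i.e. the Borel one. *)
HB.instance Definition _ := @isMeasurable.Build default_measure_display
  'rV[R]_n (g_sigma_preimage coord) rV_set0 rV_setC rV_bigcup.

End measurable_rV.

Lemma measurable_coord (R : realType) n (i : 'I_n) :
  measurable_fun [set: 'rV[R]_n]
    (fun x : 'rV[R]_n => x 0 i : measurableTypeR R).
Proof.
move=> _ A mA; apply: sub_sigma_algebra.
case: n i => [[] []//|n i].
rewrite -bigcup_mkord_ord; exists i; first exact: ltn_ord.
by exists A => //; rewrite inord_val.
Qed.

Lemma measurable_fun_rV d (T : measurableType d) (R : realType) n
    (f : T -> 'rV[R]_n) :
  (forall i, measurable_fun [set: T] (fun t => f t 0 i : measurableTypeR R)) ->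
  measurable_fun [set: T] f.
Proof.
move=> mf _ A mA; rewrite setTI.
suff : g_sigma_preimage
    (fun i t => f t 0 i : measurableTypeR R) `<=` measurable.
  apply; rewrite (g_sigma_preimage_comp
    (fun i (x : 'rV[R]_n) => x 0 i : measurableTypeR R) f).
  by exists A => //; rewrite setTI.
apply: smallest_sub; first exact: sigma_algebra_measurable.
case: n => [|n] in f mf A mA *; first by rewrite big_ord0.
rewrite -bigcup_mkord_ord; apply: bigcup_sub => i _.
by move=> B [C mC <-]; exact: mf.
Qed.

Section lebesgue_measure_rV.
Context {R : realType}.

Definition rV_cons n (p : measurableTypeR R * 'rV[R]_n) : 'rV[R]_(1 + n) :=
  row_mx (p.1%:M : 'rV[R]_1) p.2.

Definition rV_uncons n (v : 'rV[R]_(1 + n)) : measurableTypeR R * 'rV[R]_n :=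
  (lsubmx v 0 0, rsubmx v).

Lemma rV_consK n : cancel (@rV_cons n) (@rV_uncons n).
Proof.
by move=> [a v]; rewrite /rV_uncons row_mxKl row_mxKr mxE eqxx mulr1n.
Qed.

Lemma rV_unconsK n : cancel (@rV_uncons n) (@rV_cons n).
Proof.
move=> v; rewrite /rV_cons /= (_ : (lsubmx v 0 0)%:M = lsubmx v).
  exact: hsubmxK.
by rewrite -mx11_scalar.
Qed.

Lemma measurable_rV_cons n : measurable_fun setT (@rV_cons n).
Proof.
apply: measurable_fun_rV => i; rewrite /rV_cons.
have [j ->|j ->] := @split_ordP 1 n i.
  rewrite (_ : (fun _ => _) = fst); first exact: measurable_fst.
  by apply/funext => -[a v]; rewrite (row_mxEl _ _ 0 j) mxE (ord1 j) eqxx mulr1n.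
rewrite (_ : (fun _ => _) = (fun v : 'rV[R]_n => v 0 j) \o snd).
  exact: measurableT_comp (measurable_coord j) measurable_snd.
by apply/funext => -[a v]; rewrite (row_mxEr _ _ 0 j).
Qed.

Lemma measurable_rV_uncons n : measurable_fun setT (@rV_uncons n).
Proof.
apply/measurable_fun_pairP; split.
  rewrite (_ : _ \o _ = fun v : 'rV[R]_(1 + n) => v 0 (lshift n 0)).
    exact: measurable_coord.
  by apply/funext => v /=; rewrite mxE.
apply: measurable_fun_rV => i /=.
rewrite (_ : (fun _ => _) = fun v : 'rV[R]_(1 + n) => v 0 (rshift 1 i)).
  exact: measurable_coord.
by apply/funext => v /=; rewrite mxE.
Qed.

Section step.
Variables (n : nat) (m : {sigma_finite_measure set 'rV[R]_n -> \bar R}).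

Definition lebesgue_rV_step : set 'rV[R]_n.+1 -> \bar R :=
  pushforward (lebesgue_measure \x m)%E (@rV_cons n).

Let step0 : lebesgue_rV_step set0 = 0%E.
Proof. by rewrite /lebesgue_rV_step /pushforward preimage_set0 measure0. Qed.

Let step_ge0 A : (0 <= lebesgue_rV_step A)%E.
Proof. exact: (measure_ge0 (lebesgue_measure \x m)%E). Qed.

Let step_sigma_additive : semi_sigma_additive lebesgue_rV_step.
Proof.
pose mf := @measurable_rV_cons n.
move=> F mF tF mUF; rewrite /lebesgue_rV_step /pushforward preimage_bigcup.
apply: measure_semi_sigma_additive.
- by move=> k; rewrite -[X in measurable X]setTI; exact: mf.
- apply/trivIsetP => /= i j _ _ ij; rewrite -preimage_setI.
  by move/trivIsetP : tF => /(_ _ _ _ _ ij) ->//; rewrite preimage_set0.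
- by rewrite -preimage_bigcup -[X in measurable X]setTI; exact: mf.
Qed.

HB.instance Definition _ := isMeasure.Build _ _ _ lebesgue_rV_step
  step0 step_ge0 step_sigma_additive.

Let step_sigma_finite : sigma_finite setT lebesgue_rV_step.
Proof.
have /sigma_finiteP[F [TF ndF Foo]] := sigma_finiteT (@lebesgue_measure R).
have /sigma_finiteP[G [TG ndG Goo]] := sigma_finiteT m.
exists (fun k => @rV_uncons n @^-1` (F k `*` G k)).
  rewrite predeqE => v; split => // _.
  have [i _ Fi] : (\bigcup_k F k) (rV_uncons v).1 by rewrite -TF.
  have [j _ Gj] : (\bigcup_k G k) (rV_uncons v).2 by rewrite -TG.
  exists (maxn i j) => //; split.
    by move: Fi; exact/subsetPset/ndF/leq_maxl.
  by move: Gj; exact/subsetPset/ndG/leq_maxr.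
move=> k; have [mFk Fkoo] := Foo k; have [mGk Gkoo] := Goo k; split.
  rewrite -[X in measurable X]setTI.
  by apply: measurable_rV_uncons => //; exact: measurableX.
rewrite /lebesgue_rV_step /pushforward -comp_preimage.
rewrite (_ : _ \o _ = id); last by rewrite funeqE => p /=; rewrite rV_consK.
by rewrite preimage_id product_measure1E// lte_mul_pinfty// ge0_fin_numE.
Qed.

HB.instance Definition _ := Measure_isSigmaFinite.Build _ _ _ lebesgue_rV_step
  step_sigma_finite.

End step.

(* The n-fold product of the Lebesgue measure on R, transported to row vectors
   along R * R^n -> R^(1 + n). *)
Fixpoint lebesgue_rV n : {sigma_finite_measure set 'rV[R]_n -> \bar R} :=
  if n is n'.+1 then lebesgue_rV_step (lebesgue_rV n') else \d_(0 : 'rV[R]_0).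

End lebesgue_measure_rV.

Section vector_fields.
Context {R : realType}.
Local Notation C := R[i].

(* The bilinear product, without conjugation. *)
Definition dot (K : comNzRingType) n (a b : 'rV[K]_n) : K :=
  \sum_(j < n) a 0 j * b 0 j.

Definition cross (K : comNzRingType) (a b : 'rV[K]_3) : 'rV[K]_3 :=
  \row_j [:: a 0 1 * b 0 2%R - a 0 2%R * b 0 1;
             a 0 2%R * b 0 0 - a 0 0 * b 0 2%R;
             a 0 0 * b 0 1 - a 0 1 * b 0 0]`_j.

Definition perp (K : comNzRingType) (a : 'rV[K]_2) : 'rV[K]_2 :=
  \row_j [:: - a 0 1; a 0 0]`_j.

Definition toC n (x : 'rV[R]_n) : 'rV[C]_n := map_mx (real_complex R) x.

Definition expi (t : R) : C := cos t +i* sin t.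

Definition vnorm n (v : 'rV[C]_n) : R :=
  Num.sqrt (\sum_(j < n) (complex.Re (v 0 j) ^+ 2 + complex.Im (v 0 j) ^+ 2)).

Definition cintegral d (T : measurableType d) (m : {measure set T -> \bar R})
    (D : set T) (f : T -> C) : C :=
  (\int[m]_(x in D) complex.Re (f x)) +i* (\int[m]_(x in D) complex.Im (f x)).

Definition vintegral d (T : measurableType d) (m : {measure set T -> \bar R})
    n (D : set T) (F : T -> 'rV[C]_n) : 'rV[C]_n :=
  \row_j cintegral m D (fun x => F x 0 j).

(* (L^2(R^n))^n, with complex-valued components. *)
Definition in_L2 n (F : 'rV[R]_n -> 'rV[C]_n) : Prop :=
  forall j : 'I_n,
    (fun x => complex.Re (F x 0 j)) \in Lfun (lebesgue_rV n) 2%:E /\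
    (fun x => complex.Im (F x 0 j)) \in Lfun (lebesgue_rV n) 2%:E.

(* [G] is the limit in (L^2(R^n))^n of [F r] as r -> +oo. *)
Definition L2_lim n (F : R -> 'rV[R]_n -> 'rV[C]_n) (G : 'rV[R]_n -> 'rV[C]_n)
    : Prop :=
  [/\ forall r, 0 < r -> in_L2 (F r), in_L2 G &
      'N[lebesgue_rV n]_(2%:E)[(fun x => (vnorm (F r x - G x))%:E)]%E
        @[r --> +oo%R] --> (0 : \bar R)%E].

(* The support of a class of functions modulo equality almost everywhere. *)
Definition ess_supp n (F : 'rV[R]_n -> 'rV[C]_n) : set 'rV[R]_n :=
  [set x | forall U, nbhs x U ->
     ~ (lebesgue_rV n).-negligible (U `&` [set y | F y != 0])].

End vector_fields.

Section sphere.
Context {R : realType}.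
Local Notation C := R[i].
Local Notation leb := (@lebesgue_measure R).

Definition circle_pt (t : R) : 'rV[R]_2 := \row_j [:: cos t; sin t]`_j.

Definition sphere_pt (theta phi : R) : 'rV[R]_3 :=
  \row_j [:: sin theta * cos phi; sin theta * sin phi; cos theta]`_j.

(* Arc length on S^1, and the area element sin(theta) dtheta dphi on S^2;
   other dimensions are irrelevant. *)
Definition sphere_integral n :
    ('rV[R]_n -> 'rV[C]_n) -> 'rV[C]_n :=
  match n with
  | 2 => fun F => vintegral leb `[0, 2 * pi] (fun t => F (circle_pt t))
  | 3 => fun F => vintegral leb `[0, 2 * pi] (fun phi =>
           vintegral leb `[0, pi] (fun theta =>
             (sin theta)%:C *: F (sphere_pt theta phi)))
  | _ => fun=> 0
  end.

End sphere.

Section far_field.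
Context {R : realType}.
Local Notation C := R[i].
Implicit Types lambda mu omega : R.

Definition kp lambda mu omega : R := omega / Num.sqrt (lambda + 2 * mu).
Definition ks mu omega : R := omega / Num.sqrt mu.

Definition up_inf n lambda mu (Omega : set 'rV[R]_n) (S : 'rV[R]_n -> 'rV[C]_n)
    (x : 'rV[R]_n) omega : 'rV[C]_n :=
  cintegral (lebesgue_rV n) Omega (fun y =>
    expi (- (kp lambda mu omega * dot x y)) * dot (S y) (toC x)) *: toC x.

Definition us_inf2 mu (Omega : set 'rV[R]_2) (S : 'rV[R]_2 -> 'rV[C]_2)
    (x : 'rV[R]_2) omega : 'rV[C]_2 :=
  cintegral (lebesgue_rV 2) Omega (fun y =>
    expi (- (ks mu omega * dot x y)) * dot (S y) (toC (perp x)))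
    *: toC (perp x).

Definition us_inf3 mu (Omega : set 'rV[R]_3) (S : 'rV[R]_3 -> 'rV[C]_3)
    (x : 'rV[R]_3) omega : 'rV[C]_3 :=
  vintegral (lebesgue_rV 3) Omega (fun y =>
    expi (- (ks mu omega * dot x y)) *: cross (toC x) (cross (S y) (toC x))).

(* The shear pattern is only defined for n = 2 and n = 3. *)
Definition us_inf n mu : set 'rV[R]_n -> ('rV[R]_n -> 'rV[C]_n) ->
    'rV[R]_n -> R -> 'rV[C]_n :=
  match n with
  | 2 => us_inf2 mu
  | 3 => us_inf3 mu
  | _ => fun _ _ _ _ => 0
  end.

(* The integral defining I_f, with omega restricted to ]0, r[. *)
Definition If_trunc n lambda mu (Omega : set 'rV[R]_n)
    (S : 'rV[R]_n -> 'rV[C]_n) (r : R) (z : 'rV[R]_n) : 'rV[C]_n :=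
  (((2 * pi) ^+ n)^-1)%:C *: sphere_integral (fun x =>
    vintegral (@lebesgue_measure R) `]0, r[ (fun omega =>
      (expi (kp lambda mu omega * dot x z)
        * (omega ^+ n.-1 / (lambda + 2 * mu) `^ (n%:R / 2))%:C)
      *: (up_inf lambda mu Omega S x omega
          + us_inf mu Omega S x
              (kp lambda mu omega / ks mu omega * omega)))).

End far_field.

(* Main.v *)
(* On the sphere of directions x, the field u_p carries the component along x of
   the Fourier transform of S at k_p x, and u_s, taken at the frequency for which
   k_s becomes k_p, carries the orthogonal component: they add up to the Fourier
   transform itself. With xi = k_p x, polar coordinates turn the truncated integral
   into (2 pi)^-n times the integral over |xi| < k_p r of exp(i xi.z) times the
   Fourier transform of S, so the claim is Fourier inversion in L^2; S is also in
   L^1, since it vanishes almost everywhere off its bounded support.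

   For f in L^1 and L^2 put f^(xi) = int exp(-i xi.y) f(y) dy. The weight
   w = exp(-eps (|xi_1| + ... + |xi_n|)) has (2 pi)^n times a product P of Poisson
   kernels as Fourier transform, so Fubini gives
     int w |f^|^2 = (2 pi)^n (|f|^2 - 1/2 int int |f(x) - f(y)|^2 P(x - y) dx dy).
   The double integral tends to 0 with eps: this is checked on intervals, then
   extended to measurable sets by a monotone class argument, to product spaces, and
   to L^2 by density. Letting eps tend to 0 yields Plancherel's identity. Applied
   to f^ restricted to a ball D it gives, for the partial inverse transform T f,
     |T f - f|^2 = |f|^2 - (2 pi)^-n int_D |f^|^2,
   which tends to 0 as D grows. *)

From HB Require Import structures.
Require Import Defs.
From mathcomp Require Import all_boot all_order all_algebra.
From mathcomp Require Import all_classical all_reals all_analysis.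
From mathcomp.real_closed Require Import complex.
From mathcomp Require finmap.
From mathcomp Require Import measurable_realfun ring lra.
Import Order.TTheory GRing.Theory Num.Theory.
Import numFieldNormedType.Exports.
Local Open Scope classical_set_scope.
Local Open Scope ring_scope.

Set Implicit Arguments.
Unset Strict Implicit.
Unset Printing Implicit Defensive.

(** * Change of variables and polar coordinates *)

(** The weight is there because |f^|^2 is not known beforehand to be integrable: without it the
    integrals leading to Plancherel's identity could not be exchanged. The l1 norm in the exponent
    makes it a product over the coordinates, so that its transform and the limit of the double
    integral follow from one variable by induction on n; in one variable the transform has an
    elementary antiderivative. Writing the defect with |f(x) - f(y)|^2 has two gains. It is
    nonnegative, so one inequality follows at once from Fatou's lemma. It also behaves like a
    squared seminorm, at most 4 |f|^2 for real f, so that the functions on which it tends to 0 are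
    stable under sums and limits in L^2. The error formula comes from expanding |T f - f|^2.
    Plancherel's identity for the conjugate of f^ on D gives |T f|^2 = (2 pi)^-n int_D |f^|^2, and
    Fubini gives minus twice that quantity for the cross term. Functions are split into real and
    imaginary parts throughout, and the phase, the weight and the kernel stay abstract until the
    argument is complete. *)

Lemma measurable_EFin d (T : measurableType d) (R : realType) (D : set T)
    (f : T -> R) :
  measurable_fun D f -> measurable_fun D (fun x => (f x)%:E).
Proof. by move=> mf; exact/measurable_EFinP. Qed.

Section density.
Local Open Scope ereal_scope.
Context d {T : measurableType d} {R : realType} (mu : {measure set T -> \bar R}).
Variable p : T -> R.
Hypothesis p_ge0 : forall x, (0 <= p x)%R.
Hypothesis mp : measurable_fun setT p.

(** The two proofs about [p] are parameters so that the measure structure can be inferred from the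
    term [density_of p_ge0 mp] itself. *)
Definition density_of (_ : forall x, (0 <= p x)%R)
  (_ : measurable_fun setT p) (A : set T) : \bar R :=
  \int[mu]_(x in A) (p x)%:E.

Local Notation density_measure := (density_of p_ge0 mp).

Let density0 : density_measure set0 = 0.
Proof. by rewrite /density_of integral_set0. Qed.

Let density_ge0 A : 0 <= density_measure A.
Proof. by apply: integral_ge0 => x _; rewrite lee_fin. Qed.

Let density_additive : semi_sigma_additive density_measure.
Proof.
move=> F mF tF mUF; rewrite /density_of ge0_integral_bigcup//.
- apply: is_cvg_ereal_nneg_natsum_cond => n _ _.
  by apply: integral_ge0 => x _; rewrite lee_fin.
- by apply/measurable_EFinP; exact: measurable_funS mp.
- by move=> x _; rewrite lee_fin.
Qed.

HB.instance Definition _ := isMeasure.Build _ _ _ density_measure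
  density0 density_ge0 density_additive.

Import HBNNSimple.

(** Monotone convergence along the simple approximations of [h] reduces this to indicators, where it
    is the definition of the density. *)
Lemma ge0_integral_density (h : T -> \bar R) : measurable_fun setT h ->
  (forall x, 0 <= h x) ->
  \int[density_measure]_x h x = \int[mu]_x (h x * (p x)%:E).
Proof.
move=> mh h0; pose h_ := nnsfun_approx measurableT mh.
have pE (x : T) : 0 <= (p x)%:E by rewrite lee_fin.
have mpE : measurable_fun [set: T] (EFin \o p) by exact/measurable_EFinP.
transitivity (limn (fun n => \int[density_measure]_x (h_ n x)%:E)).
  rewrite -monotone_convergence//.
  - by apply: eq_integral => y _; apply/esym/cvg_lim => //; exact: cvg_nnsfun_approx.
  - by move=> n; exact/measurable_EFinP/measurable_funP.
  - by move=> n y _; rewrite lee_fin.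
  - by move=> y _ m n mn; rewrite lee_fin; exact/lefP/nd_nnsfun_approx.
rewrite [X in limn X](_ : _ = fun n => \int[mu]_x ((h_ n x)%:E * (p x)%:E)).
  rewrite -monotone_convergence//.
  - apply: eq_integral => x _; apply/cvg_lim => //.
    by apply: cvgeZr => //; exact: cvg_nnsfun_approx.
  - by move=> n; apply: emeasurable_funM => //; exact/measurable_EFinP.
  - by move=> n x _; rewrite mule_ge0// lee_fin.
  - move=> x _ m n mn; rewrite lee_wpmul2r// lee_fin.
    exact/lefP/nd_nnsfun_approx.
apply/funext => n.
under [in LHS]eq_integral do rewrite fimfunE -fsumEFin//.
rewrite ge0_integral_fsum//; last 2 first.
- by move=> y; exact/measurable_EFinP/measurable_funM.
- by move=> y x _; rewrite nnfun_muleindic_ge0.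
under [in RHS]eq_integral.
  move=> x _; rewrite fimfunE -fsumEFin// ge0_mule_fsuml; last first.
    by move=> y; rewrite nnfun_muleindic_ge0.
  over.
rewrite ge0_integral_fsum//; last 2 first.
- move=> y; apply: emeasurable_funM => //.
  exact/measurable_EFinP/measurable_funM.
- by move=> y x _; rewrite mule_ge0// nnfun_muleindic_ge0.
apply: eq_fsbigr => r _.
rewrite integralZl_indic_nnsfun//= integral_indic// setIT.
(* A negative [r] is not a value of the simple function, so its fibre is empty and both terms
   vanish. *)
have [r0|r0] := ltP r 0%R.
  rewrite preimage_nnfun0// measure0 mule0.
  by rewrite integral0_eq// => x _; rewrite indic0 mulr0 mul0e.
under [in RHS]eq_integral do rewrite EFinM -muleA.
rewrite ge0_integralZl//; last 2 first.
- apply: emeasurable_funM => //.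
  exact/measurable_EFinP/measurable_indic.
- by move=> x _; rewrite mule_ge0// lee_fin.
congr (_ * _); rewrite /= /density_of integral_mkcond.
apply: eq_integral => x _; rewrite patchE indicE.
by case: ifPn => ?; rewrite ?mul1e ?mul0e.
Qed.

End density.

(* The change of variables [y = F x] with Jacobian [p]; only intervals have to
   be tested. *)
Lemma ge0_change_of_variables (R : realType) (D : set R) (F p : R -> R) :
  measurable D -> measurable_fun setT F -> measurable_fun setT p ->
  (forall x, 0 <= p x) ->
  (forall a b, a <= b -> (\int[lebesgue_measure]_(x in D `&` F @^-1` `]a, b])
      (p x)%:E = (b - a)%:E)%E) ->
  forall h : R -> \bar R, measurable_fun setT h -> (forall x, (0 <= h x)%E) ->
  (\int[lebesgue_measure]_x h x =
   \int[lebesgue_measure]_(x in D) (h (F x) * (p x)%:E))%E.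
Proof.
move=> mD mF mp p0 FE h mh h0.
have p'0 x : 0 <= (p \_ D) x by rewrite patchE; case: ifP.
have mp' : measurable_fun setT (p \_ D).
  by apply/(measurable_restrictT _ _).1 => //; exact: measurable_funS mp.
pose dm : {measure set (measurableTypeR R) -> \bar R} :=
  density_of lebesgue_measure p'0 mp'.
pose F' : R -> measurableTypeR R := F.
have mF' : measurable_fun setT F' by [].
pose m' : {measure set (measurableTypeR R) -> \bar R} := pushforward dm F'.
pose m : {measure set (measurableTypeR R) -> \bar R} := m' mF'.
have h'0 (x : R) : (0 <= h (F x))%E by [].
(* [m] is the image under [F] of the density [p] on [D]. It gives every half-open interval its
   length, hence it is Lebesgue measure. *)
transitivity (\int[m]_x h x)%E.
  apply: eq_measure_integral => A mA _.
  apply: lebesgue_measure_unique mA => /= _ [[a b] /= ab <-].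
  rewrite lebesgue_measure_itv/= lte_fin.
  have E c e : (c <= e)%R -> m `]c, e]%classic = (e - c)%:E.
    move=> ce; rewrite -(FE _ _ ce) /m /m' /= /pushforward /dm /= /density_of.
    under eq_integral do rewrite patchE.
    rewrite integral_mkcond [RHS]integral_mkcond; apply: eq_integral => x _.
    rewrite !patchE in_setI.
    by case: (x \in D); case: (x \in _).
  case: ltP => [/ltW ab'|ba].
    by rewrite -EFinB E.
  by rewrite set_itv_ge ?measure0// bnd_simp -leNgt.
rewrite ge0_integral_pushforward//= preimage_setT.
rewrite ge0_integral_density//=; last exact: measurableT_comp.
rewrite [RHS]integral_mkcond; apply: eq_integral => x _.
by rewrite !patchE; case: ifPn => // _; rewrite mule0.
Qed.

(** Inversion is not continuous at 0. The product x (x^2)^(-1) uses a real power of a nonnegative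
    number only, and at 0 it agrees with the convention that the inverse is 0. *)
Lemma measurable_invr (R : realType) : measurable_fun [set: R] (@GRing.inv R).
Proof.
rewrite (_ : GRing.inv = fun x : R => x * (x ^+ 2) `^ (-1)).
  apply: measurable_funM => //.
  have mg : measurable_fun [set: R] (fun x : R => x ^+ 2) by exact: measurable_funX.
  exact: (measurableT_comp (measurable_powR (-1)) mg).
apply/funext => x; have [->|x0] := eqVneq x 0; first by rewrite invr0 mul0r.
by rewrite powR_inv1 ?sqr_ge0// expr2 invfM mulrA divff// mul1r.
Qed.

Lemma measurable_sin (R : realType) : measurable_fun [set: R] (@sin R).
Proof. by apply: continuous_measurable_fun; exact: continuous_sin. Qed.

Lemma measurable_cos (R : realType) : measurable_fun [set: R] (@cos R).
Proof. by apply: continuous_measurable_fun; exact: continuous_cos. Qed.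

Section substitutions.
Context {R : realType}.
Local Notation leb := (@lebesgue_measure R).
Implicit Type h : R -> \bar R.

Lemma ge0_integral_affine h (c t : R) : c != 0 ->
  measurable_fun setT h -> (forall x, (0 <= h x)%E) ->
  (\int[leb]_x h x = \int[leb]_x (h (c * x + t)%R * `|c|%:E))%E.
Proof.
move=> c0 mh h0; apply: (@ge0_change_of_variables _ setT) => //.
  by apply: measurable_funD => //; exact: measurable_funM.
move=> a b ab; rewrite setTI integral_cst//=; last first.
  rewrite -[X in measurable X]setTI.
  have : measurable_fun setT (fun x : R => c * x + t).
    by apply: measurable_funD => //; exact: measurable_funM.
  by move=> /(_ measurableT); apply.
(* The preimage of []a, b]] is an interval of length (b - a) / |c|, closed on the left instead of
   the right when [c] is negative. *)
have [cn|cp] := ltP c 0.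
  rewrite (_ : _ @^-1` _ = `[(b - t) / c, (a - t) / c[%classic); last first.
    apply/seteqP; split=> x /=; rewrite !in_itv/= ler_ndivrMr// ltr_ndivlMr//;
      rewrite ![x * c]mulrC => /andP[? ?]; apply/andP; split; lra.
  rewrite lebesgue_measure_itv/= lte_fin ltr_ndivrMr// divfK//.
  rewrite ltr0_norm// ltrD2r; case: ltP => [_|ba].
    by rewrite -EFinB -EFinM; congr EFin; field.
  have -> : a = b by apply/eqP; rewrite eq_le ab.
  by rewrite subrr mule0.
have {}cp : 0 < c by rewrite lt_def c0.
rewrite (_ : _ @^-1` _ = `](a - t) / c, (b - t) / c]%classic); last first.
  apply/seteqP; split=> x /=; rewrite !in_itv/= ltr_pdivrMr// ler_pdivlMr//;
    rewrite ![x * c]mulrC => /andP[? ?]; apply/andP; split; lra.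
rewrite lebesgue_measure_itv/= lte_fin ltr_pdivrMr// divfK//.
rewrite gtr0_norm// ltrD2r; case: ltP => [_|ba].
  by rewrite -EFinB -EFinM; congr EFin; field.
have -> : a = b by apply/eqP; rewrite eq_le ab.
by rewrite subrr mule0.
Qed.

(** Tested on []a, b]]: by the fundamental theorem of calculus the Jacobian integrates over []atan
    a, atan b]] to b - a. *)
Lemma ge0_integral_tan h :
  measurable_fun setT h -> (forall x, (0 <= h x)%E) ->
  (\int[leb]_x h x =
   \int[leb]_(x in `](- (pi / 2))%R, (pi / 2)%R[) (h (tan x) * ((cos x) ^- 2)%:E))%E.
Proof.
move=> mh h0.
have cos0 x : x \in `](- (pi / 2)), (pi / 2)[ -> cos x != 0 :> R.
  by rewrite in_itv/= => /cos_gt0_pihalf /lt0r_neq0.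
apply: ge0_change_of_variables => //.
- apply: measurable_funM; first exact: measurable_sin.
  by apply: measurableT_comp; [exact: measurable_invr|exact: measurable_cos].
- apply: measurableT_comp; first exact: measurable_invr.
  by apply: measurable_funX; exact: measurable_cos.
- by move=> x; rewrite invr_ge0 sqr_ge0.
move=> a b; rewrite le_eqVlt => /predU1P[->|ab].
  by rewrite set_itvoc0 preimage_set0 setI0 integral_set0 subrr.
have atab : atan a < atan b by exact: lt_atan.
rewrite (_ : _ `&` _ = `]atan a, atan b]%classic); last first.
  apply/seteqP; split => x /=.
    move=> [xD]; rewrite !in_itv/= => /andP[ax xb].
    by rewrite -(tanK xD) lt_atan// le_atan.
  rewrite !in_itv/= => /andP[ax xb].
  have xD : x \in `](- (pi / 2)), (pi / 2)[.
    by rewrite in_itv/= (lt_trans (atan_gtNpi2 a))// (le_lt_trans xb)// atan_ltpi2.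
  have aD y : atan y \in `](- (pi / 2)), (pi / 2)[.
    by rewrite in_itv/= atan_gtNpi2 atan_ltpi2.
  split; first by [].
  apply/andP; split; first by rewrite -(atanK a) ltr_tan ?aD.
  by rewrite -(atanK b) leNgt ltr_tan ?aD// -leNgt.
have xD x : atan a <= x <= atan b -> x \in `](- (pi / 2)), (pi / 2)[.
  move=> /andP[ax xb].
  by rewrite in_itv/= (lt_le_trans (atan_gtNpi2 a))// (le_lt_trans xb)// atan_ltpi2.
have tc x : atan a <= x <= atan b -> {for x, continuous (@tan R)}.
  by move=> ?; exact/continuous_tan/cos0/xD.
have cc x : atan a <= x <= atan b -> {for x, continuous (fun x : R => (cos x) ^- 2)}.
  move=> ?; apply: cvgV; first by rewrite expf_neq0// cos0// xD.
  by apply: (@continuous_comp _ _ _ (@cos R) (fun x => x ^+ 2));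
    [exact: continuous_cos|exact: exprn_continuous].
rewrite integral_itv_obnd_cbnd; last first.
  apply/measurable_EFinP; apply: measurable_funTS.
  apply: measurableT_comp; first exact: measurable_invr.
  by apply: measurable_funX; exact: measurable_cos.
rewrite (@continuous_FTC2 _ _ tan)//.
- by rewrite !atanK -EFinB.
- by apply: continuous_in_subspaceT => x; rewrite inE/= in_itv/=; exact: cc.
- split.
  + move=> x; rewrite in_itv/= => /andP[? ?]; apply: derivable_tan.
    by apply: cos0; apply: xD; rewrite !ltW.
  + by apply: cvg_at_right_filter; apply: tc; rewrite lexx ltW.
  + by apply: cvg_at_left_filter; apply: tc; rewrite lexx ltW.
- move=> x; rewrite in_itv/= => /andP[? ?]; rewrite derive1E.
  by apply: derive_val; apply: is_derive_tan; apply: cos0; apply: xD; rewrite !ltW.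
Qed.

(** The reflection t -> pi / 2 - t turns the tangent into the cotangent, and its range of angles
    into that of the upper half-plane. *)
Lemma ge0_integral_cot h :
  measurable_fun setT h -> (forall x, (0 <= h x)%E) ->
  (\int[leb]_x h x =
   \int[leb]_(x in `]0%R, pi[) (h (cos x / sin x)%R * ((sin x) ^- 2)%:E))%E.
Proof.
move=> mh h0; rewrite ge0_integral_tan// integral_mkcond.
rewrite (@ge0_integral_affine _ (-1) (pi / 2)) ?oppr_eq0 ?oner_eq0//; last 2 first.
- apply/(measurable_restrictT _ _).1 => //; apply: measurable_funTS.
  apply: emeasurable_funM; last first.
    apply/measurable_EFinP; apply: measurableT_comp; first exact: measurable_invr.
    by apply: measurable_funX; exact: measurable_cos.
  apply: measurableT_comp => //.
  apply: measurable_funM; first exact: measurable_sin.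
  by apply: measurableT_comp; [exact: measurable_invr|exact: measurable_cos].
- move=> x; rewrite patchE; case: ifPn => // _.
  by rewrite mule_ge0// lee_fin invr_ge0 sqr_ge0.
rewrite [RHS]integral_mkcond; apply: eq_integral => x _.
rewrite normrN1 mule1 !patchE mulN1r.
have -> : (- x + pi / 2 \in `](- (pi / 2)), (pi / 2)[%classic) = (x \in `]0, pi[%classic).
  by apply/idP/idP; rewrite !inE/= !in_itv/= => /andP[? ?]; apply/andP; split; lra.
by rewrite /tan sinDpihalf cosDpihalf cosN sinN opprK.
Qed.

End substitutions.

Section polar.
Context {R : realType}.
Local Notation leb := (@lebesgue_measure R).
Local Notation T := (measurableTypeR R).

Lemma measurable_polar_x : measurable_fun setT (fun p : T * T => p.2 * cos p.1).
Proof.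
apply: measurable_funM; first exact: measurable_snd.
exact: (measurableT_comp (@measurable_cos R) measurable_fst).
Qed.

Lemma measurable_polar_y : measurable_fun setT (fun p : T * T => p.2 * sin p.1).
Proof.
apply: measurable_funM; first exact: measurable_snd.
exact: (measurableT_comp (@measurable_sin R) measurable_fst).
Qed.

Let measurable_EFin_snd : measurable_fun setT (fun p : T * T => (p.2)%:E).
Proof. exact: measurable_EFin measurable_snd. Qed.

Let measurable_indic_snd (I : set T) : measurable I ->
  measurable_fun setT (fun p : T * T => (\1_I p.2)%:E : \bar R).
Proof.
move=> mI; apply: measurable_EFin.
exact: (measurableT_comp (measurable_indic mI) measurable_snd).
Qed.

(* Polar coordinates with [x = y cot theta], then [y = r sin theta]. *)
Lemma ge0_integral_halfplane (G : T * T -> \bar R) :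
  measurable_fun setT G -> (forall p, (0 <= G p)%E) ->
  (\int[leb]_(y in `]0%R, +oo[) \int[leb]_x G (x, y) =
   \int[leb]_(t in `]0%R, pi[) \int[leb]_(r in `]0%R, +oo[)
     (G (r * cos t, r * sin t)%R * r%:E))%E.
Proof.
move=> mG G0.
pose I : set R := `]0, +oo[%classic.
(* In the variables (s, y) with x = y s. The indicator of y > 0 makes [K] nonnegative on the whole
   plane, as Tonelli's theorem asks. *)
pose K (p : T * T) := (G (p.2 * p.1, p.2)%R * (p.2)%:E * (\1_I p.2)%:E)%E.
have K0 p : (0 <= K p)%E.
  rewrite /K indicE; case: (boolP (p.2 \in I)) => [|_]; last by rewrite mule0.
  by rewrite inE /I/= in_itv/= andbT => p0; rewrite mule1 mule_ge0// lee_fin ltW.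
have mK : measurable_fun setT K.
  apply: emeasurable_funM.
    apply: emeasurable_funM.
      apply: (measurableT_comp mG); apply/measurable_fun_pairP; split => /=.
        by apply: measurable_funM; [exact: measurable_snd|exact: measurable_fst].
      exact: measurable_snd.
    exact: measurable_EFin_snd.
  apply: measurable_indic_snd; exact: measurable_itv.
have mGx y : measurable_fun [set: T] (fun x => G (x, y)).
  by apply: measurableT_comp => //; exact: pair2_measurable.
transitivity (\int[leb]_y \int[leb]_s K (s, y))%E.
  rewrite integral_mkcond; apply: eq_integral => y _.
  rewrite patchE; case: ifPn => yI; last first.
    by rewrite integral0_eq// => s _; rewrite /K indicE (negbTE yI) mule0.
  have y0 : 0 < y by move: yI; rewrite inE /= in_itv/= andbT.
  rewrite (ge0_integral_affine 0 (lt0r_neq0 y0))//; last exact: mGx.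
  apply: eq_integral => s _.
  by rewrite /K addr0 gtr0_norm//= indicE yI mule1.
(* The slope s = x / y becomes the outer variable, so that it can be replaced by cot t. *)
rewrite -(fubini_tonelli K mK K0).
rewrite ge0_integral_cot; last 2 first.
- exact: (measurable_fun_fubini_tonelli_F K mK K0).
- by move=> x; exact: integral_ge0.
apply: eq_integral => t; rewrite inE/= in_itv/= => /sin_gt0_pi st.
rewrite [RHS]integral_mkcond.
have mKt u : measurable_fun [set: T] (fun x => K (u, x)).
  by apply: measurableT_comp => //; exact: pair1_measurable.
rewrite -ge0_integralZr//; last by rewrite lee_fin invr_ge0 sqr_ge0.
(* With y = r sin t, the factors y, 1 / sin^2 t and sin t multiply to r. *)
rewrite (ge0_integral_affine 0 (lt0r_neq0 st)); last 2 first.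
- by apply: emeasurable_funM => //; exact: mKt.
- by move=> x; rewrite mule_ge0// lee_fin invr_ge0 sqr_ge0.
apply: eq_integral => r _; rewrite patchE /K addr0/= indicE.
have -> : (sin t * r \in I) = (r \in `]0%R, +oo[%classic).
  by apply/idP/idP; rewrite !inE /I/= !in_itv/= !andbT pmulr_rgt0.
case: ifPn => _; last by rewrite mule0 !mul0e.
rewrite mule1 gtr0_norm// -!muleA; congr (G _ * _)%E.
  by congr pair; [field; rewrite gt_eqF|rewrite mulrC].
by rewrite -!EFinM; congr EFin; field; rewrite gt_eqF.
Qed.

(** The point reflection (x, y) -> (-x, -y) carries the upper half-plane to the lower one and adds
    pi to the angle; the line y = 0 and the end points of the angles are null. *)
Lemma ge0_integral_polar (G : T * T -> \bar R) :
  measurable_fun setT G -> (forall p, (0 <= G p)%E) ->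
  (\int[leb]_y \int[leb]_x G (x, y) =
   \int[leb]_(t in `[0%R, (2 * pi)%R]) \int[leb]_(r in `]0%R, +oo[)
     (G (r * cos t, r * sin t)%R * r%:E))%E.
Proof.
have pi0 := pi_gt0 R.
have itvU : `[0%R, (2 * pi)%R]%classic = `[0%R, pi] `|` `]pi, (2 * pi)%R] :> set R.
  apply/seteqP; split => [t|t []] /=; rewrite !in_itv/=.
  - by move=> /andP[? ?]; case: (leP t pi) => ?; [left|right]; apply/andP; split; lra.
  - by move=> /andP[? ?]; apply/andP; split; lra.
  - by move=> /andP[? ?]; apply/andP; split; lra.
move=> mG G0.
pose F t := (\int[leb]_(r in `]0%R, +oo[) (G (r * cos t, r * sin t)%R * r%:E))%E.
have F0 t : (0 <= F t)%E.
  apply: integral_ge0 => r; rewrite /= in_itv/= andbT => r0.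
  by rewrite mule_ge0// lee_fin ltW.
have mF : measurable_fun setT F.
  pose K (p : T * T) := (G (p.2 * cos p.1, p.2 * sin p.1)%R * (p.2)%:E
     * (\1_(`]0%R, +oo[%classic : set R) p.2)%:E)%E.
  rewrite (_ : F = fun t => (\int[leb]_r K (t, r))%E); last first.
    apply/funext => t; rewrite /F integral_mkcond; apply: eq_integral => r _.
    by rewrite patchE /K/= indicE; case: ifPn => _; rewrite ?mule1 ?mule0.
  apply: (measurable_fun_fubini_tonelli_F K).
    apply: emeasurable_funM.
      apply: emeasurable_funM.
        apply: (measurableT_comp mG); apply/measurable_fun_pairP; split => /=.
          exact: measurable_polar_x.
        exact: measurable_polar_y.
      exact: measurable_EFin_snd.
    apply: measurable_indic_snd; exact: measurable_itv.
  move=> [t r]; rewrite /K/= indicE.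
  have [|_] := boolP (r \in `]0%R, +oo[%classic); last by rewrite mule0.
  by rewrite inE /= in_itv/= andbT => r0; rewrite mule1 mule_ge0// lee_fin ltW.
pose g y := (\int[leb]_x G (x, y))%E.
have mg : measurable_fun [set: T] g by exact: (measurable_fun_fubini_tonelli_G G mG G0).
have g0 y : (0 <= g y)%E by exact: integral_ge0.
have E1 : (\int[leb]_(y in `]0%R, +oo[) g y = \int[leb]_(t in `]0%R, pi[) F t)%E.
  exact: ge0_integral_halfplane.
have mop : measurable_fun [set: T * T] (fun p : T * T => (- p.1, - p.2) : T * T).
  by apply/measurable_fun_pairP; split => /=; apply: measurable_funN;
    [exact: measurable_fst|exact: measurable_snd].
have E2 : (\int[leb]_(y in `]-oo, 0%R[) g y = \int[leb]_(t in `]pi, (2 * pi)%R[) F t)%E.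
  have := @ge0_integral_halfplane (fun p => G (- p.1, - p.2)).
  move=> /(_ (measurableT_comp mG mop) (fun p => G0 _)) E.
  transitivity (\int[leb]_(y in `]0%R, +oo[) \int[leb]_x G (- x, - y)%R)%E.
    rewrite integral_mkcond [RHS]integral_mkcond.
    rewrite (@ge0_integral_affine _ _ (-1) 0) ?oppr_eq0 ?oner_eq0//; last 2 first.
    - by apply/(measurable_restrictT _ _).1 => //; exact: measurable_funTS.
    - by move=> x; rewrite patchE; case: ifPn.
    apply: eq_integral => y _; rewrite normrN1 mule1 addr0 mulN1r !patchE.
    have -> : (- y \in `]-oo, 0%R[%classic) = (y \in `]0%R, +oo[%classic).
      by apply/idP/idP; rewrite !inE/= !in_itv/= andbT oppr_lt0.
    case: ifPn => // _; rewrite /g (@ge0_integral_affine _ _ (-1) 0) ?oppr_eq0 ?oner_eq0//.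
      by apply: eq_integral => x _; rewrite normrN1 mule1 addr0 mulN1r.
    by apply: measurableT_comp => //; exact: pair2_measurable.
  rewrite E integral_mkcond [RHS]integral_mkcond.
  rewrite [RHS](@ge0_integral_affine _ _ 1 pi) ?oner_eq0//; last 2 first.
  - by apply/(measurable_restrictT _ _).1 => //; exact: measurable_funTS.
  - by move=> x; rewrite patchE; case: ifPn.
  apply: eq_integral => t _; rewrite normr1 mule1 mul1r !patchE.
  have -> : (t + pi \in `]pi, (2 * pi)%R[%classic) = (t \in `]0%R, pi[%classic).
    by apply/idP/idP; rewrite !inE/= !in_itv/= => /andP[? ?]; apply/andP; split; lra.
  case: ifPn => // _; apply: eq_integral => r _.
  by rewrite cosDpi sinDpi !mulrN.
rewrite -/g (_ : [set: T] = `]-oo, 0%R[ `|` `[0%R, +oo[); last first.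
  apply/seteqP; split => // y _ /=; rewrite !in_itv/= andbT.
  by case: (ltP y 0); [left|right].
rewrite ge0_integral_setU//=; last 3 first.
- exact: measurable_funTS.
- by move=> x _; exact: g0.
- apply/disj_setPS => y [] /=; rewrite !in_itv/= andbT => y0 /(lt_le_trans y0).
  by rewrite ltxx.
rewrite -integral_itv_obnd_cbnd; last exact: measurable_funTS.
rewrite E1 E2 itvU.
rewrite ge0_integral_setU//=; last 3 first.
- exact: measurable_funTS.
- by move=> x _; exact: F0.
- apply/disj_setPS => y [] /=; rewrite !in_itv/= => /andP[_ y0] /andP[/(le_lt_trans y0)].
  by rewrite ltxx.
rewrite addeC; congr (_ + _)%E.
  rewrite -integral_itv_bndo_bndc; last exact: measurable_funTS.
  by rewrite -integral_itv_obnd_cbnd//; exact: measurable_funTS.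
by rewrite -integral_itv_bndo_bndc//; exact: measurable_funTS.
Qed.

End polar.

(** * Tonelli's theorem on a rectangle *)

Section tonelli_in.
Local Open Scope ereal_scope.
Context d1 d2 (T1 : measurableType d1) (T2 : measurableType d2) (R : realType).
Variable m1 : {sigma_finite_measure set T1 -> \bar R}.
Variable m2 : {sigma_finite_measure set T2 -> \bar R}.
Variables (D1 : set T1) (D2 : set T2) (f : T1 * T2 -> \bar R).
Hypotheses (mD1 : measurable D1) (mD2 : measurable D2).
Hypothesis mf : measurable_fun setT f.
Hypothesis f0 : forall x y, D1 x -> D2 y -> 0 <= f (x, y).

(** Nonnegativity of [f] is known on the rectangle only, hence the extension by zero. *)
Let g := f \_ (D1 `*` D2).

Let g0 p : 0 <= g p.
Proof.
rewrite /g patchE; case: ifPn => //; case: p => x y.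
by rewrite inE => -[/=]; exact: f0.
Qed.

Let mg : measurable_fun setT g.
Proof.
apply/(measurable_restrictT _ _).1; first exact: measurableX.
exact: measurable_funTS.
Qed.

Let gE x y : g (x, y) = if x \in D1 then if y \in D2 then f (x, y) else 0 else 0.
Proof. by rewrite /g patchE in_setX/=; case: (x \in D1); case: (y \in D2). Qed.

Let FE x : x \in D1 -> \int[m2]_(y in D2) f (x, y) = \int[m2]_y g (x, y).
Proof.
move=> xD; rewrite integral_mkcond; apply: eq_integral => y _.
by rewrite gE xD patchE.
Qed.

Lemma measurable_fun_tonelli_in :
  measurable_fun D1 (fun x => \int[m2]_(y in D2) f (x, y)).
Proof.
apply: (eq_measurable_fun (fun x => \int[m2]_y g (x, y))).
  by move=> x xD; rewrite FE.
by apply: measurable_funTS; exact: measurable_fun_fubini_tonelli_F.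
Qed.

Lemma fubini_tonelli_in :
  \int[m1]_(x in D1) \int[m2]_(y in D2) f (x, y) =
  \int[m2]_(y in D2) \int[m1]_(x in D1) f (x, y).
Proof.
transitivity (\int[m1]_x \int[m2]_y g (x, y)).
  rewrite integral_mkcond; apply: eq_integral => x _.
  rewrite patchE; case: ifPn => xD; first exact: FE.
  by rewrite integral0_eq// => y _; rewrite gE (negbTE xD).
rewrite (fubini_tonelli g mg g0) [RHS]integral_mkcond.
apply: eq_integral => y _; rewrite patchE; case: ifPn => yD.
  rewrite [RHS]integral_mkcond; apply: eq_integral => x _.
  by rewrite gE yD patchE.
by rewrite integral0_eq// => x _; rewrite gE (negbTE yD); case: ifP.
Qed.

End tonelli_in.

(** * Integrals over row vectors, polar and spherical coordinates *)

Section rV_integral.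
Context {R : realType}.
Local Notation leb := (@lebesgue_measure R).
Local Notation T := (measurableTypeR R).

Lemma ge0_integral_rVS n (G : 'rV[R]_n.+1 -> \bar R) :
  measurable_fun setT G -> (forall v, (0 <= G v)%E) ->
  (\int[lebesgue_rV n.+1]_v G v =
   \int[leb]_a \int[lebesgue_rV n]_v G (rV_cons (a, v)))%E.
Proof.
move=> mG G0.
have mGc : measurable_fun setT (G \o @rV_cons R n).
  exact: (measurableT_comp mG (@measurable_rV_cons R n)).
rewrite -(@fubini_tonelli1 _ _ _ _ _ leb (lebesgue_rV n) (G \o @rV_cons R n))//=.
rewrite -[RHS](ge0_integral_pushforward (@measurable_rV_cons R n)
  (leb \x lebesgue_rV n)%E measurableT)//.
Qed.

Lemma ge0_integral_rV0 (G : 'rV[R]_0 -> \bar R) :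
  measurable_fun setT G -> (\int[lebesgue_rV 0]_v G v = G 0%R)%E.
Proof. by move=> mG; rewrite integral_dirac//= diracT mul1e. Qed.

(** Nested in the same way as the recursion that builds [lebesgue_rV], so that iterated integrals
    appear directly. *)
Definition vec2 (a b : R) : 'rV[R]_2 := rV_cons (a : T, rV_cons (b : T, 0 : 'rV[R]_0)).
Definition vec3 (a b c : R) : 'rV[R]_3 := rV_cons (a : T, vec2 b c).

Lemma rV_consl n (a : T) (v : 'rV[R]_n) (j : 'I_1) :
  rV_cons (a, v) 0 (lshift n j) = a.
Proof. by rewrite /rV_cons row_mxEl mxE (ord1 j) eqxx mulr1n. Qed.

Lemma rV_consr n (a : T) (v : 'rV[R]_n) (j : 'I_n) :
  rV_cons (a, v) 0 (rshift 1 j) = v 0 j.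
Proof. by rewrite /rV_cons row_mxEr. Qed.

Lemma vec2E a b : vec2 a b = \row_j [:: a; b]`_j.
Proof.
apply/rowP => i; have [j ->|j ->] := @split_ordP 1 1 i.
  by rewrite /vec2 rV_consl mxE (ord1 j).
rewrite /vec2 rV_consr; have [k ->|[]//] := @split_ordP 1 0 j.
by rewrite rV_consl mxE (ord1 k).
Qed.

Lemma vec3E a b c : vec3 a b c = \row_j [:: a; b; c]`_j.
Proof.
apply/rowP => i; have [j ->|j ->] := @split_ordP 1 2 i.
  by rewrite /vec3 rV_consl mxE (ord1 j).
by rewrite /vec3 rV_consr vec2E !mxE.
Qed.

Lemma measurable_rV_cons1 n (a : T) :
  measurable_fun setT (fun v : 'rV[R]_n => rV_cons (a, v)).
Proof.
exact: (measurableT_comp (@measurable_rV_cons R n) (pair1_measurable a)).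
Qed.

Lemma measurable_vec2 d (S : measurableType d) (f g : S -> T) :
  measurable_fun setT f -> measurable_fun setT g ->
  measurable_fun setT (fun s => vec2 (f s) (g s)).
Proof.
move=> mf mg; apply: (measurableT_comp (@measurable_rV_cons R 1)).
apply/measurable_fun_pairP; split => //.
apply: (measurableT_comp (@measurable_rV_cons R 0)).
by apply/measurable_fun_pairP; split => //; exact: measurable_cst.
Qed.

Lemma measurable_vec3 d (S : measurableType d) (f g h : S -> T) :
  measurable_fun setT f -> measurable_fun setT g -> measurable_fun setT h ->
  measurable_fun setT (fun s => vec3 (f s) (g s) (h s)).
Proof.
move=> mf mg mh; apply: (measurableT_comp (@measurable_rV_cons R 2)).
by apply/measurable_fun_pairP; split => //; exact: measurable_vec2.
Qed.

Lemma ge0_integral_rV2 (G : 'rV[R]_2 -> \bar R) :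
  measurable_fun setT G -> (forall v, (0 <= G v)%E) ->
  (\int[lebesgue_rV 2]_v G v = \int[leb]_y \int[leb]_x G (vec2 x y))%E.
Proof.
move=> mG G0; rewrite ge0_integral_rVS//.
transitivity (\int[leb]_x \int[leb]_y G (vec2 x y))%E.
  apply: eq_integral => x _; rewrite ge0_integral_rVS//; last first.
    exact: (measurableT_comp mG (measurable_rV_cons1 x)).
  apply: eq_integral => y _; rewrite ge0_integral_rV0//.
  exact: (measurableT_comp mG (measurableT_comp (measurable_rV_cons1 x)
    (measurable_rV_cons1 (y : T)))).
apply: (fubini_tonelli (fun p : T * T => G (vec2 p.1 p.2))) => //.
apply: (measurableT_comp mG); apply: measurable_vec2.
  exact: measurable_fst.
exact: measurable_snd.
Qed.

Lemma ge0_integral_rV2_polar (G : 'rV[R]_2 -> \bar R) :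
  measurable_fun setT G -> (forall v, (0 <= G v)%E) ->
  (\int[lebesgue_rV 2]_v G v =
   \int[leb]_(t in `[0%R, (2 * pi)%R]) \int[leb]_(r in `]0%R, +oo[)
     (G (r *: circle_pt t) * r%:E))%E.
Proof.
move=> mG G0; rewrite ge0_integral_rV2//.
have mG2 : measurable_fun setT (fun p : T * T => G (vec2 p.1 p.2)).
  apply: (measurableT_comp mG).
  by apply: measurable_vec2; [exact: measurable_fst|exact: measurable_snd].
rewrite (ge0_integral_polar mG2 (fun p => G0 _)).
apply: eq_integral => t _; apply: eq_integral => r _; congr (G _ * _)%E.
rewrite /= vec2E; apply/rowP => i; rewrite !mxE.
by case: i => -[|[|//]].
Qed.

(** Cylindrical coordinates (s, phi, z) come first. Polar coordinates z = r cos t, s = r sin t in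
    the half-plane s > 0 follow, and the Jacobians s and r multiply to r^2 sin t. *)
Lemma ge0_integral_rV3_polar (G : 'rV[R]_3 -> \bar R) :
  measurable_fun setT G -> (forall v, (0 <= G v)%E) ->
  (\int[lebesgue_rV 3]_v G v =
   \int[leb]_(phi in `[0%R, (2 * pi)%R]) \int[leb]_(t in `[0%R, pi])
     \int[leb]_(r in `]0%R, +oo[)
     (G (r *: sphere_pt t phi) * (r ^+ 2 * sin t)%:E))%E.
Proof.
move=> mG G0; rewrite ge0_integral_rVS//.
have mG3 : measurable_fun setT (fun p : T * (T * T) => G (vec3 p.1 p.2.1 p.2.2)).
  apply: (measurableT_comp mG); apply: measurable_vec3.
  - exact: measurable_fst.
  - exact: (measurableT_comp measurable_fst measurable_snd).
  - exact: (measurableT_comp measurable_snd measurable_snd).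
have mG' (x : T) : measurable_fun setT (fun v : 'rV[R]_2 => G (rV_cons (x, v))).
  exact: (measurableT_comp mG (measurable_rV_cons1 x)).
transitivity (\int[leb]_x \int[leb]_z \int[leb]_y G (vec3 x y z))%E.
  apply: eq_integral => x _; rewrite ge0_integral_rV2//.
transitivity (\int[leb]_z \int[leb]_x \int[leb]_y G (vec3 x y z))%E.
  apply: (fubini_tonelli (fun p : T * T => \int[leb]_y G (vec3 p.1 y p.2))%E).
    apply: (measurable_fun_fubini_tonelli_F
      (fun q : (T * T) * T => G (vec3 q.1.1 q.2 q.1.2))) => //.
    apply: (measurableT_comp mG); apply: measurable_vec3.
    - exact: (measurableT_comp measurable_fst measurable_fst).
    - exact: measurable_snd.
    - exact: (measurableT_comp measurable_snd measurable_fst).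
  by move=> p; exact: integral_ge0.
transitivity (\int[leb]_z \int[leb]_(phi in `[0%R, (2 * pi)%R])
    \int[leb]_(s in `]0%R, +oo[) (G (vec3 (s * cos phi) (s * sin phi) z) * s%:E))%E.
  apply: eq_integral => z _.
  have mGz : measurable_fun setT (fun p : T * T => G (vec3 p.1 p.2 z)).
    apply: (measurableT_comp mG); apply: measurable_vec3.
    - exact: measurable_fst.
    - exact: measurable_snd.
    - exact: measurable_cst.
  rewrite -(ge0_integral_polar mGz (fun p => G0 _)).
  by rewrite (fubini_tonelli _ mGz (fun p => G0 _)).
have mH (phi : R) : measurable_fun setT
    (fun p : T * T => G (vec3 (p.2 * cos phi) (p.2 * sin phi) p.1)).
  apply: (measurableT_comp mG); apply: measurable_vec3.
  - by apply: measurable_funM => //; exact: measurable_snd.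
  - by apply: measurable_funM => //; exact: measurable_snd.
  - exact: measurable_fst.
have mEsnd d (S : measurableType d) : measurable_fun setT (fun p : S * T => (p.2)%:E).
  exact: measurable_EFin measurable_snd.
pose K (q : (T * T) * T) := (G (vec3 (q.2 * cos q.1.2) (q.2 * sin q.1.2) q.1.1) * (q.2)%:E)%E.
have mK : measurable_fun setT K.
  apply: emeasurable_funM; last exact: mEsnd.
  apply: (measurableT_comp mG); apply: measurable_vec3.
  - apply: measurable_funM; first exact: measurable_snd.
    exact: (measurableT_comp (@measurable_cos R) (measurableT_comp measurable_snd measurable_fst)).
  - apply: measurable_funM; first exact: measurable_snd.
    exact: (measurableT_comp (@measurable_sin R) (measurableT_comp measurable_snd measurable_fst)).
  - exact: (measurableT_comp measurable_fst measurable_fst).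
have s0 (s : R) : `]0%R, +oo[%classic s -> (0 <= s%:E)%E.
  by rewrite /= in_itv/= andbT lee_fin => /ltW.
have mKs : measurable_fun setT (fun p : T * T => \int[leb]_(s in `]0%R, +oo[) K (p, s))%E.
  apply: (@measurable_fun_tonelli_in _ _ _ _ _ leb setT _ K measurableT) => //.
  by move=> x y _ /s0; exact: mule_ge0.
have Ks0 (x y : T) : setT x -> `[0%R, (2 * pi)%R]%classic y ->
    (0 <= \int[leb]_(s in `]0%R, +oo[) K ((x, y), s))%E.
  by move=> _ _; apply: integral_ge0 => s /s0; exact: mule_ge0.
have E1 := @fubini_tonelli_in _ _ T T R leb leb setT _ _ measurableT
  (measurable_itv _) mKs Ks0.
transitivity (\int[leb]_(phi in `[0%R, (2 * pi)%R]) \int[leb]_z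
  \int[leb]_(s in `]0%R, +oo[) K ((z, phi), s))%E; first exact: E1.
apply: eq_integral => phi _.
pose Kp (p : T * T) := K ((p.1, phi), p.2).
have mKp : measurable_fun setT Kp by exact: (emeasurable_funM (mH phi) (mEsnd _ _)).
have Kp0 (x y : T) : setT x -> `]0%R, +oo[%classic y -> (0 <= Kp (x, y))%E.
  by move=> _ /s0; exact: mule_ge0.
have E2 := @fubini_tonelli_in _ _ T T R leb leb setT _ _ measurableT
  (measurable_itv _) mKp Kp0.
transitivity (\int[leb]_(s in `]0%R, +oo[) \int[leb]_z Kp (z, s))%E; first exact: E2.
(* The half-plane formula asks for an integrand that is nonnegative everywhere; [Num.max s 0] equals
   s where s > 0. *)
pose s' (s : R) : \bar R := (Num.max s 0)%:E.
pose L (p : T * T) := (G (vec3 (p.2 * cos phi) (p.2 * sin phi) p.1) * s' p.2)%E.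
have s'0 s : (0 <= s' s)%E by rewrite lee_fin le_max lexx orbT.
transitivity (\int[leb]_(y in `]0%R, +oo[) \int[leb]_x L (x, y))%E.
  apply: eq_integral => s; rewrite inE/= in_itv/= andbT => ss; apply: eq_integral => z _.
  have ms : Num.max s 0 = s by apply: max_l; exact: ltW.
  by rewrite /Kp /K /L /s' /= ms.
have mL : measurable_fun setT L.
  apply: emeasurable_funM; first exact: (mH phi).
  apply: measurable_EFin.
  by apply: measurable_maxr => //; exact: measurable_snd.
have L0 p : (0 <= L p)%E by rewrite mule_ge0.
rewrite (ge0_integral_halfplane mL L0).
pose L' (p : T * T) := (L (p.2 * cos p.1, p.2 * sin p.1)%R * (p.2)%:E)%E.
have mL' : measurable_fun setT L'.
  apply: emeasurable_funM; last exact: mEsnd.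
  apply: (measurableT_comp mL); apply/measurable_fun_pairP; split => /=.
    exact: measurable_polar_x.
  exact: measurable_polar_y.
have L'0 (x y : T) : `[0%R, pi]%classic x -> `]0%R, +oo[%classic y -> (0 <= L' (x, y))%E.
  by move=> _ /s0 ?; rewrite mule_ge0.
have mF := @measurable_fun_tonelli_in _ _ T T R leb _ _ L' (measurable_itv _)
  (measurable_itv _) mL' L'0.
transitivity (\int[leb]_(t in `[0%R, pi]) \int[leb]_(r in `]0%R, +oo[) L' (t, r))%E.
  pose H (t : T) := (\int[leb]_(r in `]0%R, +oo[) L' (t, r))%E.
  have mF' : measurable_fun `]0%R, pi[ H.
    apply: (measurable_funS (measurable_itv _) _ mF).
    exact: subset_itv_oo_cc.
  exact: (esym (@integral_itv_bndoo R 0 pi H true false mF')).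
apply: eq_integral => t; rewrite inE/= in_itv/= => /sin_ge0_pi st.
apply: eq_integral => r; rewrite inE/= in_itv/= andbT => /ltW r0.
have ms : Num.max (r * sin t) 0 = r * sin t by apply: max_l; exact: mulr_ge0.
rewrite /L' /L /= /s' ms -muleA -EFinM; congr (G _ * _)%E.
  rewrite vec3E; apply/rowP => i; rewrite !mxE.
  by case: i => -[|[|[|//]]] ? /=; ring.
by congr EFin; ring.
Qed.

End rV_integral.

(** * Approximate identities *)

(** Convergence to 0 for sequences that are nonnegative and may take the value [+oo]; only upper
    bounds then matter. *)
Definition vanishing (R : realType) (u : nat -> \bar R) :=
  forall e : R, 0 < e -> \forall k \near \oo, (u k <= e%:E)%E.

Lemma vanishingD (R : realType) (u v : nat -> \bar R) :
  vanishing u -> vanishing v -> vanishing (fun k => u k + v k)%E.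
Proof.
move=> u0 v0 e e0; near=> k.
rewrite [e]splitr EFinD; apply: leeD; near: k; [apply: u0|apply: v0];
  by rewrite divr_gt0.
Unshelve. all: by end_near. Qed.

Lemma vanishingZ (R : realType) (c : R) (u : nat -> \bar R) : 0 <= c ->
  vanishing u -> vanishing (fun k => c%:E * u k)%E.
Proof.
(* Dividing by [c + 1] covers the case [c = 0]. *)
move=> c0 u0 e e0; have c1 : 0 < c + 1 by rewrite ltr_wpDl.
near=> k.
have : (u k <= (e / (c + 1))%:E)%E by near: k; apply: u0; rewrite divr_gt0.
move=> /(lee_wpmul2l (_ : (0 <= c%:E)%E)); rewrite lee_fin => /(_ c0)/le_trans; apply.
rewrite -EFinM lee_fin mulrA ler_pdivrMr// mulrC ler_wpM2l//; first exact: ltW.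
by rewrite lerDl.
Unshelve. all: by end_near. Qed.

Lemma le_vanishing (R : realType) (u v : nat -> \bar R) :
  (forall k, (u k <= v k)%E) -> vanishing v -> vanishing u.
Proof.
move=> uv v0 e e0; near=> k; apply: (le_trans (uv k)).
by near: k; exact: v0.
Unshelve. all: by end_near. Qed.

Section oscillation.
Context d (X : measurableType d) (R : realType).
Variable mu : {sigma_finite_measure set X -> \bar R}.

Definition oscillation (K : X * X -> R) (f : X -> R) : \bar R :=
  (\int[mu]_x \int[mu]_y ((f x - f y) ^+ 2 * K (x, y))%:E)%E.

(** Symmetric probability kernels. Concentration near the diagonal is not asked here; it is
    expressed by [good]. *)
Definition mollifier (K : nat -> X * X -> R) :=
  [/\ forall k, measurable_fun setT (K k),
      forall k p, 0 <= K k p,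
      forall k x y, K k (x, y) = K k (y, x) &
      forall k x, (\int[mu]_y (K k (x, y))%:E = 1)%E].

Variable K : nat -> X * X -> R.
Hypothesis HK : mollifier K.

Let mK k : measurable_fun setT (K k). Proof. by case: HK. Qed.
Let K0 k p : 0 <= K k p. Proof. by case: HK. Qed.
Let KC k x y : K k (x, y) = K k (y, x). Proof. by case: HK. Qed.
Let K1 k x : (\int[mu]_y (K k (x, y))%:E = 1)%E. Proof. by case: HK. Qed.

Implicit Types (f g h : X -> R) (k : nat).

Let mEK k : measurable_fun setT (fun p => (K k p)%:E).
Proof. exact: (measurable_EFin (mK k)). Qed.

Let K1' k x : (\int[mu]_y (K k (y, x))%:E = 1)%E.
Proof. by under eq_integral do rewrite KC; exact: K1. Qed.

Let m1 (f : X -> R) : measurable_fun setT f ->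
  measurable_fun setT (fun p : X * X => f p.1).
Proof. by move=> mf; exact: (measurableT_comp mf measurable_fst). Qed.

Let m2 (f : X -> R) : measurable_fun setT f ->
  measurable_fun setT (fun p : X * X => f p.2).
Proof. by move=> mf; exact: (measurableT_comp mf measurable_snd). Qed.

Lemma measurable_oscillation_integrand k f : measurable_fun setT f ->
  measurable_fun setT (fun p : X * X => ((f p.1 - f p.2) ^+ 2 * K k p)%:E).
Proof.
move=> mf; apply: measurable_EFin.
apply: measurable_funM; last exact: mK.
apply: measurable_funX; apply: measurable_funB; [exact: m1|exact: m2].
Qed.

Lemma oscillation_ge0 k f : (0 <= oscillation (K k) f)%E.
Proof.
by apply: integral_ge0 => x _; apply: integral_ge0 => y _;
  rewrite lee_fin mulr_ge0// sqr_ge0.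
Qed.

(** Common source of the bounds for sums, multiples and intersections: a pointwise inequality
    between squared increments is integrated against the kernel. *)
Lemma oscillation_lin k f g h (c : R) : measurable_fun setT f ->
  measurable_fun setT g -> measurable_fun setT h -> 0 <= c ->
  (forall x y, (f x - f y) ^+ 2 <= c * (g x - g y) ^+ 2 + c * (h x - h y) ^+ 2) ->
  (oscillation (K k) f <=
    c%:E * oscillation (K k) g + c%:E * oscillation (K k) h)%E.
Proof.
move=> mf mg mh c0 fgh.
have mof := measurable_oscillation_integrand k mf.
have mog := measurable_oscillation_integrand k mg.
have moh := measurable_oscillation_integrand k mh.
pose sq (f : X -> R) (p : X * X) := ((f p.1 - f p.2) ^+ 2 * K k p)%:E.
have sq0 f' p : (0 <= sq f' p)%E by rewrite lee_fin mulr_ge0// sqr_ge0.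
have E f' (mo : measurable_fun setT (sq f')) :
    oscillation (K k) f' = (\int[mu \x mu]_p sq f' p)%E.
  by rewrite (fubini_tonelli1 (sq f') mo (sq0 f')).
rewrite !E// -!ge0_integralZl// -ge0_integralD//; last 4 first.
- by move=> p _; rewrite mule_ge0.
- by apply: emeasurable_funM => //; exact: measurable_cst.
- by move=> p _; rewrite mule_ge0.
- by apply: emeasurable_funM => //; exact: measurable_cst.
apply: ge0_le_integral => //.
- by apply: emeasurable_funD; apply: emeasurable_funM => //; exact: measurable_cst.
- move=> [x y] _; rewrite /sq/= -!EFinM -EFinD lee_fin ![c * (_ * K k _)]mulrA.
  by rewrite -mulrDl ler_wpM2r.
Qed.

Lemma oscillationD k f g : measurable_fun setT f -> measurable_fun setT g ->
  (oscillation (K k) (fun x => f x + g x)%R <=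
    2%:E * oscillation (K k) f + 2%:E * oscillation (K k) g)%E.
Proof.
move=> mf mg; apply: oscillation_lin => //; first exact: measurable_funD.
move=> x y; rewrite -subr_ge0.
have -> : 2 * (f x - f y) ^+ 2 + 2 * (g x - g y) ^+ 2 - (f x + g x - (f y + g y)) ^+ 2
  = ((f x - f y) - (g x - g y)) ^+ 2 by ring.
exact: sqr_ge0.
Qed.

(** (a - b)^2 <= 2 a^2 + 2 b^2, and each square integrates to the square norm of [f] because both
    marginals of the kernel are 1. The bound does not depend on [k]. *)
Lemma oscillation_le_L2 k f : measurable_fun setT f ->
  (oscillation (K k) f <= 4%:E * \int[mu]_x (f x ^+ 2)%:E)%E.
Proof.
move=> mf.
have mf2 : measurable_fun setT (fun x => (f x ^+ 2)%:E).
  by apply: measurable_EFin; exact: measurable_funX.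
pose a (p : X * X) := ((f p.1 ^+ 2)%:E * (K k p)%:E)%E.
pose b (p : X * X) := ((f p.2 ^+ 2)%:E * (K k p)%:E)%E.
have f20 x : (0 <= (f x ^+ 2)%:E)%E by rewrite lee_fin sqr_ge0.
have KE0 p : (0 <= (K k p)%:E)%E by rewrite lee_fin.
have a0 p : (0 <= a p)%E by exact: mule_ge0.
have b0 p : (0 <= b p)%E by exact: mule_ge0.
have ma : measurable_fun setT a.
  by apply: emeasurable_funM => //; exact: (measurableT_comp mf2 measurable_fst).
have mb : measurable_fun setT b.
  by apply: emeasurable_funM => //; exact: (measurableT_comp mf2 measurable_snd).
have Ea : (\int[mu \x mu]_p a p = \int[mu]_x (f x ^+ 2)%:E)%E.
  rewrite (fubini_tonelli1 a ma a0); apply: eq_integral => x _.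
  rewrite /fubini_F/a/= ge0_integralZl//; first by rewrite K1 mule1.
  exact: (measurableT_comp (mEK k) (pair1_measurable x)).
have Eb : (\int[mu \x mu]_p b p = \int[mu]_x (f x ^+ 2)%:E)%E.
  rewrite (fubini_tonelli2 b mb b0); apply: eq_integral => x _.
  rewrite /fubini_G/b/= ge0_integralZl//; first by rewrite K1' mule1.
  exact: (measurableT_comp (mEK k) (pair2_measurable x)).
have -> : (4%:E * \int[mu]_x (f x ^+ 2)%:E = \int[mu \x mu]_p (2%:E * (a p + b p)))%E.
  rewrite ge0_integralZl//; last 2 first.
  - exact: emeasurable_funD.
  - by move=> p _; rewrite adde_ge0.
  rewrite ge0_integralD// Ea Eb -[in RHS](mul1e (\int[mu]_x _)%E) -ge0_muleDl//.
  by rewrite muleA -EFinD -EFinM; congr (_%:E * _)%E; ring.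
have sq0 (p : X * X) : (0 <= ((f p.1 - f p.2) ^+ 2 * K k p)%:E)%E.
  by rewrite lee_fin mulr_ge0// sqr_ge0.
have := fubini_tonelli1 _ (measurable_oscillation_integrand k mf) sq0.
rewrite /oscillation => <-.
apply: ge0_le_integral => //.
- exact: measurable_oscillation_integrand.
- by apply: emeasurable_funM; [exact: measurable_cst|exact: emeasurable_funD].
move=> p _.
have -> : (2%:E * (a p + b p))%E = (2 * (f p.1 ^+ 2 * K k p + f p.2 ^+ 2 * K k p))%:E by [].
rewrite lee_fin -mulrDl mulrA ler_wpM2r//.
rewrite -subr_ge0.
have -> : 2 * (f p.1 ^+ 2 + f p.2 ^+ 2) - (f p.1 - f p.2) ^+ 2 = (f p.1 + f p.2) ^+ 2 by ring.
exact: sqr_ge0.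
Qed.

(* Functions reproduced in the limit by the kernels [K k]. *)
Definition good f := vanishing (fun k => oscillation (K k) f).

Lemma good_cst c : good (fun=> c).
Proof.
apply: (@le_vanishing _ _ (fun=> 0%E)).
  move=> k; rewrite /oscillation integral0_eq// => x _.
  by rewrite integral0_eq// => y _; rewrite subrr expr0n mul0r.
by move=> e e0; apply: nearW => k; rewrite lee_fin ltW.
Qed.

Lemma goodD f g : measurable_fun setT f -> measurable_fun setT g ->
  good f -> good g -> good (fun x => f x + g x).
Proof.
move=> mf mg gf gg; apply: le_vanishing; first by move=> k; exact: oscillationD.
exact: (vanishingD (vanishingZ (ler0n _ 2) gf) (vanishingZ (ler0n _ 2) gg)).
Qed.

Lemma goodZ c f : measurable_fun setT f -> good f -> good (fun x => c * f x).
Proof.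
move=> mf gf.
have c20 : 0 <= c ^+ 2 by exact: sqr_ge0.
apply: le_vanishing (vanishingZ c20 gf) => k.
have := @oscillation_lin k (fun x => c * f x) f (fun=> 0) _ (measurable_funM (measurable_cst _) mf)
  mf (measurable_cst _) c20.
have -> : oscillation (K k) (fun=> 0) = 0%E.
  rewrite /oscillation integral0_eq// => x _.
  by rewrite integral0_eq// => y _; rewrite subrr expr0n mul0r.
rewrite mule0 adde0; apply => x y.
by rewrite subrr expr0n mulr0 addr0 -exprMn mulrBr.
Qed.

Lemma good_sum (I : Type) (s : seq I) (f : I -> X -> R) :
  (forall i, measurable_fun setT (f i)) -> (forall i, good (f i)) ->
  good (fun x => \sum_(i <- s) f i x).
Proof.
move=> mf gf; elim: s => [|i s IH].
  by under eq_fun do rewrite big_nil; exact: good_cst.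
under eq_fun do rewrite big_cons.
exact: (goodD (mf i) (measurable_sum _ mf) (gf i) IH).
Qed.

(** The bound of [oscillation_le_L2] for [f - g] is uniform in [k], so [good] is closed in L^2. *)
Lemma good_closed f : measurable_fun setT f ->
  (forall e : R, 0 < e -> exists g, [/\ measurable_fun setT g, good g &
    (\int[mu]_x ((f x - g x) ^+ 2)%:E <= e%:E)%E]) -> good f.
Proof.
move=> mf H e e0.
(* The budget is e = 2 * (4 * (e / 16)) + 2 * (e / 4): each 2 comes from [oscillationD], the 4 from
   [oscillation_le_L2]. *)
have e16 : 0 < e / 16 by rewrite divr_gt0.
have e4 : 0 < e / 4 by rewrite divr_gt0.
have [g [mg gg fg]] := H _ e16.
have mfg : measurable_fun setT (fun x => f x - g x) by exact: measurable_funB.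
near=> k.
have -> : f = (fun x => (f x - g x) + g x) by apply/funext => x; rewrite subrK.
apply: (le_trans (oscillationD k mfg mg)).
have -> : e = 2 * (e / 4) + 2 * (e / 4) by field.
rewrite [leRHS]EFinD; apply: leeD; rewrite EFinM; apply: lee_wpmul2l => //.
  apply: (le_trans (oscillation_le_L2 k mfg)).
  have -> : e / 4 = 4 * (e / 16) by field.
  by rewrite EFinM; apply: lee_wpmul2l.
by near: k; exact: gg.
Unshelve. all: by end_near. Qed.

Lemma goodN f : measurable_fun setT f -> good f -> good (fun x => - f x).
Proof.
move=> mf gf; rewrite (_ : (fun x => - f x) = (fun x => -1 * f x)); first exact: goodZ.
by apply/funext => x; rewrite mulN1r.
Qed.

End oscillation.

Lemma cvg0_vanishing (R : realType) (u : nat -> \bar R) :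
  u @ \oo --> 0%E -> vanishing u.
Proof.
move=> u0 e e0.
have : nbhs (0%E : \bar R) [set x | (x < e%:E)%E].
  by apply: open_nbhs_nbhs; split => /=; [exact: open_ereal_lt_ereal|rewrite lte_fin].
by move=> /u0 [N _ H]; exists N => // k /H/= /ltW.
Qed.

(** * From a generating class of sets to square integrable functions *)

Section good_sets.
Context d (X : measurableType d) (R : realType).
Variable mu : {sigma_finite_measure set X -> \bar R}.
Variable K : nat -> X * X -> R.
Hypothesis HK : mollifier mu K.
Implicit Types (f g : X -> R) (A B : set X).
Local Notation good := (good mu K).

Let mindic A : measurable A -> measurable_fun setT (\1_A : X -> R).
Proof. exact: measurable_indic. Qed.

Lemma good_set0 : good (\1_set0 : X -> R).
Proof.
rewrite (_ : \1_set0 = fun=> 0); first exact: good_cst.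
by apply/funext => x; rewrite indicE in_set0.
Qed.

(** Constants have zero oscillation, so complements are good even when their measure is infinite. *)
Lemma good_setC A : measurable A -> good \1_A -> good \1_(~` A).
Proof.
move=> mA gA; rewrite (_ : \1_(~` A) = fun x => 1 + - \1_A x).
  exact: (goodD HK (measurable_cst _) (measurable_funN (mindic mA))
    (good_cst mu K 1) (goodN HK (mindic mA) gA)).
apply/funext => x; rewrite !indicE in_setC.
by case: (x \in A); rewrite /= ?subrr ?subr0.
Qed.

(** Two points separated by the intersection are separated by [A] or by [B]. *)
Lemma good_setI A B : measurable A -> measurable B ->
  good \1_A -> good \1_B -> good \1_(A `&` B).
Proof.
move=> mA mB gA gB.
apply: (le_vanishing _ (vanishingD (vanishingZ ler01 gA) (vanishingZ ler01 gB))) => k.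
apply: (oscillation_lin HK k (mindic (measurableI _ _ mA mB)) (mindic mA) (mindic mB) ler01).
move=> x y; rewrite !mul1r !indicE !in_setI.
by case: (x \in A); case: (x \in B); case: (y \in A); case: (y \in B) => /=; lra.
Qed.

Lemma good_setU A B : measurable A -> measurable B ->
  good \1_A -> good \1_B -> good \1_(A `|` B).
Proof.
move=> mA mB gA gB; rewrite -(setCK (A `|` B)) setCU.
have mCA := measurableC mA; have mCB := measurableC mB.
exact: (good_setC (measurableI _ _ mCA mCB)
  (good_setI mCA mCB (good_setC mA gA) (good_setC mB gB))).
Qed.

(** Since the union has finite measure, the indicators of the [B n] converge to its indicator in
    L^2, and [good_closed] applies. *)
Lemma good_bigcup_nd (B : nat -> set X) : (forall n, measurable (B n)) ->
  nondecreasing_seq B -> (forall n, good \1_(B n)) ->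
  (mu (\bigcup_n B n) < +oo)%E -> good \1_(\bigcup_n B n).
Proof.
move=> mB ndB gB fB.
set U := \bigcup_n B n in fB *.
have mU : measurable U by exact: bigcup_measurable.
apply: (good_closed HK) => [|e e0]; first exact: mindic.
have Uf : mu U \is a fin_num by rewrite ge0_fin_numE.
have : nbhs (mu U) [set x | (mu U - e%:E < x)%E].
  apply: open_nbhs_nbhs; split; first exact: open_ereal_gt_ereal.
  suff : (mu U - e%:E < mu U)%E by [].
  by rewrite lteBlDr// lteDl// lte_fin.
move=> /(nondecreasing_cvg_mu mB mU ndB)[N _ /(_ N (leqnn N))/= NU].
exists \1_(B N); split; [exact: mindic|exact: gB|].
have BU : B N `<=` U by exact: bigcup_sup.
rewrite (_ : (\int[mu]_x _)%E = mu (U `\` B N)).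
  rewrite measureD// (setIidr BU) leeBlDr//; last first.
    rewrite ge0_fin_numE// (le_lt_trans _ fB)//.
    by apply: le_measure => //; apply: mem_set; [exact: mB|exact: mU].
  by rewrite -leeBlDl//; exact: ltW.
rewrite -[U `\` B N]setIT -integral_indic//; last exact: measurableD.
apply: eq_integral => x _; congr EFin; rewrite !indicE in_setD.
have := BU x; case: (boolP (x \in B N)) => xB; case: (boolP (x \in U)) => xU //=;
  rewrite ?subrr ?subr0 ?expr0n ?expr1n//.
by move=> /(_ (set_mem xB)) /mem_set; rewrite (negbTE xU).
Qed.

(** For fixed [n], the sets whose trace on [F n] is good form a sigma-algebra; the finite measure of
    [F n] is what allows increasing unions. Letting [n] grow then recovers every set of finite
    measure. *)
Lemma good_all_sets (G : set (set X)) (F : nat -> set X) :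
  measurable `<=` <<s G >> -> G `<=` measurable ->
  (forall n, measurable (F n)) -> nondecreasing_seq F -> \bigcup_n F n = setT ->
  (forall n, mu (F n) < +oo)%E -> (forall n, good \1_(F n)) ->
  (forall n A, G A -> good \1_(A `&` F n)) ->
  forall A, measurable A -> (mu A < +oo)%E -> good \1_A.
Proof.
move=> mG Gm mF ndF UF Foo gF gG.
have H n : measurable `<=` [set A | measurable A /\ good \1_(A `&` F n)].
  apply: (subset_trans mG); apply: smallest_sub; last first.
    by move=> A GA; split; [exact: Gm|exact: gG].
  split.
  - by split => //; rewrite set0I; exact: good_set0.
  - move=> A [mA gA]; rewrite setTD; split; first exact: measurableC.
    have -> : ~` A `&` F n = ~` (A `&` F n) `&` F n.
      by rewrite setCI setIUl setICl setU0.
    have mAF := measurableI _ _ mA (mF n).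
    exact: (good_setI (measurableC mAF) (mF n) (good_setC mAF gA) (gF n)).
  - move=> A HA; split; first by apply: bigcup_measurable => k _; case: (HA k).
    pose B k := (\big[setU/set0]_(i < k) A i) `&` F n.
    have mA k : measurable (\big[setU/set0]_(i < k) A i).
      by apply: bigsetU_measurable => i _; case: (HA i).
    have mB k : measurable (B k) by exact: measurableI.
    have -> : \bigcup_k A k `&` F n = \bigcup_k B k.
      apply/seteqP; split => [x [[k _ Ak] Fx]|x [k _ [+ Fx]]].
        by exists k.+1 => //; split => //; rewrite big_ord_recr/=; right.
      by rewrite -bigcup_mkord => -[i _ Ai]; split => //; exists i.
    apply: good_bigcup_nd; first exact: mB.
    + apply/nondecreasing_seqP => k; apply/subsetPset; apply: setSI.
      by rewrite big_ord_recr/=; exact: subsetUl.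
    + elim=> [|k IH]; first by rewrite /B big_ord0 set0I; exact: good_set0.
      rewrite /B big_ord_recr/= setIUl; case: (HA k) => mAk gAk.
      exact: (good_setU (mB k) (measurableI _ _ mAk (mF n)) IH gAk).
    + apply: le_lt_trans (Foo n); apply: le_measure.
      * by apply: mem_set; exact: bigcup_measurable.
      * by apply: mem_set; exact: mF.
      * by apply: bigcup_sub => k _; exact: subIsetr.
move=> A mA Aoo.
have E : A = \bigcup_n (A `&` F n) by rewrite -setI_bigcupr UF setIT.
rewrite E; apply: good_bigcup_nd.
- by move=> n; exact: measurableI.
- by move=> m n mn; apply/subsetPset; apply: setIS; exact/subsetPset/ndF.
- by move=> n; case: (H n A mA).
- by rewrite -E.
Qed.

Import HBNNSimple.
Import finmap.

Hypothesis good_measurable : forall A, measurable A -> (mu A < +oo)%E -> good \1_A.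

(** The simple approximations of [f] are good, since by Chebyshev's inequality their nonzero level
    sets have finite measure. They converge to [f] in L^2 by dominated convergence with majorant
    f^2. *)
Let ge0_good_L2 f : measurable_fun setT f -> (forall x, 0 <= f x) ->
  (\int[mu]_x (f x ^+ 2)%:E < +oo)%E -> good f.
Proof.
move=> mf f0 f2.
have mEf : measurable_fun setT (EFin \o f) by exact/measurable_EFinP.
have Ef0 x : (0 <= (EFin \o f) x)%E by rewrite /= lee_fin.
have msq g : measurable_fun setT g -> measurable_fun setT (fun x => (g x ^+ 2)%:E).
  by move=> mg; apply: measurable_EFin; exact: measurable_funX.
pose h := nnsfun_approx measurableT mEf.
have hf n x : h n x <= f x.
  by rewrite -lee_fin /h nnsfun_approxE; apply: (le_approx n (fun x _ => Ef0 x)).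
have h0 n x : 0 <= h n x by exact: fun_ge0.
have gh n : good (h n).
  have -> : (h n : X -> R) = fun x => \sum_(i < #|` fset_set (h n @` setT)|)
     ((fset_set (h n @` setT))`_i *
      \1_(h n @^-1` [set (fset_set (h n @` setT))`_i]) x).
    by apply/funext => x; rewrite [LHS]fimfunEord.
  apply: (good_sum HK) => i.
    by apply: measurable_funM; [exact: measurable_cst|exact: mindic].
  (* The level set of the value 0 may have infinite measure, but its term in the sum is zero. *)
  set c := (_`_i); have [->|c0] := eqVneq c 0.
    rewrite (_ : (fun x => _) = fun=> 0); first exact: good_cst.
    by apply/funext => x; rewrite mul0r.
  apply: (goodZ HK); first exact: mindic.
  apply: good_measurable; first by [].
  set A := _ @^-1` _; have mA : measurable A.
    rewrite -[X in measurable X]setTI.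
    by apply: (measurable_funP (h n)); [exact: measurableT|exact: measurable_set1].
  have c2 : 0 < c ^+ 2 by rewrite exprn_even_gt0.
  have : (mu A * (c ^+ 2)%:E <= \int[mu]_x (f x ^+ 2)%:E)%E.
    rewrite muleC -(setIT A) -integral_indic// -ge0_integralZl//; last 2 first.
    - by apply: measurable_EFin; exact: mindic.
    - by rewrite lee_fin ltW.
    apply: ge0_le_integral => //.
    - by move=> x _; rewrite -EFinM lee_fin mulr_ge0// ltW.
    - apply: emeasurable_funM; first exact: measurable_cst.
      by apply: measurable_EFin; exact: mindic.
    - exact: msq.
    move=> x _; rewrite -EFinM lee_fin indicE.
    case: (boolP (x \in A)) => xA; last by rewrite mulr0 sqr_ge0.
    have <- : h n x = c := set_mem xA; rewrite mulr1.
    by rewrite ler_pXn2r// nnegrE.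
  move=> /le_lt_trans/(_ f2).
  case: (mu A) (measure_ge0 mu A) => [r _ _|_|//]; first exact: ltry.
  by rewrite gt0_mulye ?lte_fin.
apply: (good_closed HK mf) => e e0.
have mfh n : measurable_fun setT (fun x => f x - h n x) by exact: measurable_funB.
have : vanishing (fun n => \int[mu]_x ((f x - h n x) ^+ 2)%:E)%E.
  apply: cvg0_vanishing.
  have [| | | | |_ _] := @dominated_convergence _ X R mu setT measurableT
    (fun n x => ((f x - h n x) ^+ 2)%:E) (fun=> 0%E) (fun x => (f x ^+ 2)%:E).
  - by move=> n; exact: msq.
  - exact: measurable_cst.
  - apply: aeW => x _; apply: cvg_EFin; first exact: nearW.
    have hx : h n x @[n --> \oo] --> f x.
      exact: (fine_cvg (cvg_nnsfun_approx measurableT mEf (fun x _ => Ef0 x) (I : setT x))).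
    have -> : (0 : R) = (f x - f x) ^+ 2 by rewrite subrr expr0n.
    have cB : f x - h n x @[n --> \oo] --> f x - f x.
      by apply: cvgB => //; exact: cvg_cst.
    exact: (cvg_comp _ (fun y => y ^+ 2) cB (@exprn_continuous R 2 _)).
  - apply/integrableP; split; first exact: msq.
    apply: le_lt_trans f2; apply: ge0_le_integral => //.
    + by apply: measurableT_comp => //; exact: msq.
    + exact: msq.
    + by move=> x _; rewrite gee0_abs// lee_fin sqr_ge0.
  - apply: aeW => x n _; rewrite gee0_abs ?lee_fin ?sqr_ge0//.
    rewrite ler_pXn2r ?nnegrE ?subr_ge0//.
    by rewrite lerBlDr lerDl.
  - by rewrite integral0.
move=> /(_ e e0)[n _ /(_ n (leqnn n))/= fhe].
by exists (h n); split.
Qed.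

Lemma good_L2 f : measurable_fun setT f -> (\int[mu]_x (f x ^+ 2)%:E < +oo)%E ->
  good f.
Proof.
move=> mf f2.
have msq g : measurable_fun setT g -> measurable_fun setT (fun x => (g x ^+ 2)%:E).
  by move=> mg; apply: measurable_EFin; exact: measurable_funX.
have mp : measurable_fun setT (fun x => Num.max (f x) 0) by exact: measurable_maxr.
have mn : measurable_fun setT (fun x => Num.max (- f x) 0).
  by apply: measurable_maxr => //; exact: measurable_funN.
have -> : f = fun x => Num.max (f x) 0 + - Num.max (- f x) 0.
  apply/funext => x; have [fx|fx] := leP 0 (f x).
    by rewrite max_r ?oppr_le0// subr0.
  by rewrite max_l ?oppr_ge0 ?ltW// add0r opprK.
apply: (goodD HK mp (measurable_funN mn)).
  apply: (ge0_good_L2 mp); first by move=> x; rewrite le_max lexx orbT.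
  apply: le_lt_trans f2; apply: ge0_le_integral; [by []|by move=> x _; rewrite lee_fin sqr_ge0|exact: msq|exact: msq|].
  move=> x _; rewrite lee_fin; have [fx|fx] := leP 0 (f x) => //.
  by rewrite expr0n sqr_ge0.
apply: (goodN HK mn); apply: (ge0_good_L2 mn); first by move=> x; rewrite le_max lexx orbT.
apply: le_lt_trans f2; apply: ge0_le_integral; [by []|by move=> x _; rewrite lee_fin sqr_ge0|exact: msq|exact: msq|].
move=> x _; rewrite lee_fin; have [fx|fx] := leP 0 (- f x) => //.
  by rewrite sqrrN.
by rewrite expr0n sqr_ge0.
Qed.

End good_sets.

(** Stated for sets because this form passes to products; [good_L2] turns it into a statement on
    functions. *)
Definition all_good d (X : measurableType d) (R : realType)
    (mu : {sigma_finite_measure set X -> \bar R}) (K : nat -> X * X -> R) :=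
  mollifier mu K /\
  forall A, measurable A -> (mu A < +oo)%E -> good mu K \1_A.

Lemma integral_indicT d (X : measurableType d) (R : realType)
    (m : {measure set X -> \bar R}) (A : set X) : measurable A ->
  (\int[m]_x (\1_A x)%:E = m A)%E.
Proof. by move=> mA; rewrite integral_indic// setIT. Qed.

(** * Products of mollifiers *)

Section product_mollifier.
Context d1 d2 (X : measurableType d1) (Y : measurableType d2) (R : realType).
Variable mu : {sigma_finite_measure set X -> \bar R}.
Variable nu : {sigma_finite_measure set Y -> \bar R}.

Lemma ge0_integral_prod (f : X -> \bar R) (g : Y -> \bar R) :
  measurable_fun setT f -> measurable_fun setT g ->
  (forall x, (0 <= f x)%E) -> (forall y, (0 <= g y)%E) ->
  (\int[mu \x nu]_p (f p.1 * g p.2) = (\int[mu]_x f x) * (\int[nu]_y g y))%E.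
Proof.
move=> mf mg f0 g0.
have mfg : measurable_fun setT (fun p : X * Y => (f p.1 * g p.2)%E).
  apply: emeasurable_funM; first exact: (measurableT_comp mf measurable_fst).
  exact: (measurableT_comp mg measurable_snd).
rewrite (fubini_tonelli1 _ mfg (fun p => mule_ge0 (f0 _) (g0 _))).
rewrite -ge0_integralZr//; last exact: integral_ge0.
by apply: eq_integral => x _; rewrite /fubini_F/= ge0_integralZl.
Qed.

Variables (K : nat -> X * X -> R) (L : nat -> Y * Y -> R).
Hypotheses (GK : all_good mu K) (GL : all_good nu L).

(* The product space is only used through an isomorphic copy [W]. *)
Variables (d : measure_display) (W : measurableType d).
Variable om : {sigma_finite_measure set W -> \bar R}.
Variables (phi : X * Y -> W) (psi : W -> X * Y).
Hypotheses (mphi : measurable_fun setT phi) (mpsi : measurable_fun setT psi).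
Hypotheses (phiK : cancel phi psi) (psiK : cancel psi phi).
Hypothesis omE : forall H : W -> \bar R, measurable_fun setT H ->
  (forall w, (0 <= H w)%E) -> (\int[om]_w H w = \int[mu \x nu]_p H (phi p))%E.

Definition prod_kernel k (q : W * W) :=
  K k ((psi q.1).1, (psi q.2).1) * L k ((psi q.1).2, (psi q.2).2).

Let mK k : measurable_fun setT (K k). Proof. by case: GK => -[]. Qed.
Let mL k : measurable_fun setT (L k). Proof. by case: GL => -[]. Qed.
Let K0 k p : 0 <= K k p. Proof. by case: GK => -[]. Qed.
Let L0 k p : 0 <= L k p. Proof. by case: GL => -[]. Qed.
Let K1 k x : (\int[mu]_y (K k (x, y))%:E = 1)%E. Proof. by case: GK => -[]. Qed.
Let L1 k x : (\int[nu]_y (L k (x, y))%:E = 1)%E. Proof. by case: GL => -[]. Qed.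

Let mKE k x : measurable_fun setT (fun y => (K k (x, y))%:E).
Proof.
exact: (measurableT_comp (@EFin_measurable R setT)
  (measurableT_comp (mK k) (pair1_measurable x))).
Qed.

Let mLE k x : measurable_fun setT (fun y => (L k (x, y))%:E).
Proof.
exact: (measurableT_comp (@EFin_measurable R setT)
  (measurableT_comp (mL k) (pair1_measurable x))).
Qed.

Let psi11 : measurable_fun setT (fun q : W * W => ((psi q.1).1, (psi q.2).1)).
Proof.
apply/measurable_fun_pairP; split.
  exact: (measurableT_comp measurable_fst (measurableT_comp mpsi measurable_fst)).
exact: (measurableT_comp measurable_fst (measurableT_comp mpsi measurable_snd)).
Qed.

Let psi22 : measurable_fun setT (fun q : W * W => ((psi q.1).2, (psi q.2).2)).
Proof.
apply/measurable_fun_pairP; split.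
  exact: (measurableT_comp measurable_snd (measurableT_comp mpsi measurable_fst)).
exact: (measurableT_comp measurable_snd (measurableT_comp mpsi measurable_snd)).
Qed.

Lemma measurable_prod_kernel k : measurable_fun setT (prod_kernel k).
Proof.
apply: measurable_funM; first exact: (measurableT_comp (mK k) psi11).
exact: (measurableT_comp (mL k) psi22).
Qed.

Lemma prod_mollifier : mollifier om prod_kernel.
Proof.
split.
- exact: measurable_prod_kernel.
- by move=> k p; rewrite mulr_ge0.
- move=> k x y; rewrite /prod_kernel/=.
  by case: GK GL => -[_ _ -> _] _ [[_ _ -> _] _].
- move=> k w; rewrite omE.
  + under eq_integral do rewrite /prod_kernel/= phiK EFinM.
    rewrite (@ge0_integral_prod (fun u => (K k ((psi w).1, u))%:E)
      (fun v => (L k ((psi w).2, v))%:E))//.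
    * by rewrite K1 L1 mule1.
    * by move=> u; rewrite lee_fin.
    * by move=> v; rewrite lee_fin.
  + apply: measurable_EFin.
    exact: (measurableT_comp (measurable_prod_kernel k) (pair1_measurable w)).
  + by move=> w'; rewrite lee_fin mulr_ge0.
Qed.

Let integral_KL k (u : X * X -> R) (v : Y * Y -> R) :
  measurable_fun setT u -> measurable_fun setT v ->
  (forall p, 0 <= u p) -> (forall p, 0 <= v p) ->
  (\int[om]_p \int[om]_q
     (u ((psi p).1, (psi q).1) * v ((psi p).2, (psi q).2) * prod_kernel k (p, q))%:E =
   (\int[mu]_x \int[mu]_x' (u (x, x') * K k (x, x'))%:E) *
   (\int[nu]_y \int[nu]_y' (v (y, y') * L k (y, y'))%:E))%E.
Proof.
move=> mu_ mv u0 v0.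
pose a (p : X * X) := (u p * K k p)%:E; pose b (p : Y * Y) := (v p * L k p)%:E.
have ma : measurable_fun setT a.
  by apply: measurable_EFin; exact: measurable_funM.
have mb : measurable_fun setT b.
  by apply: measurable_EFin; exact: measurable_funM.
have a0 p : (0 <= a p)%E by rewrite lee_fin mulr_ge0.
have b0 p : (0 <= b p)%E by rewrite lee_fin mulr_ge0.
pose c (q : W * W) := (a ((psi q.1).1, (psi q.2).1) * b ((psi q.1).2, (psi q.2).2))%E.
have mc : measurable_fun setT c.
  apply: emeasurable_funM; first exact: (measurableT_comp ma psi11).
  exact: (measurableT_comp mb psi22).
have c0 q : (0 <= c q)%E by rewrite mule_ge0.
transitivity (\int[om]_p \int[om]_q c (p, q))%E.
  apply: eq_integral => p _; apply: eq_integral => q _.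
  by rewrite /c /a /b /prod_kernel/= -EFinM; congr EFin; ring.
rewrite omE; last 2 first.
- exact: measurable_fun_fubini_tonelli_F.
- by move=> w; exact: integral_ge0.
rewrite -(@ge0_integral_prod (fun x => \int[mu]_x' a (x, x'))%E
  (fun y => \int[nu]_y' b (y, y'))%E); last 4 first.
- exact: measurable_fun_fubini_tonelli_F.
- exact: measurable_fun_fubini_tonelli_F.
- by move=> x; exact: integral_ge0.
- by move=> y; exact: integral_ge0.
apply: eq_integral => -[x y] _; rewrite omE; last 2 first.
- exact: (measurableT_comp mc (pair1_measurable _)).
- by [].
rewrite -(@ge0_integral_prod (fun x' => a (x, x')) (fun y' => b (y, y')))//; last 2 first.
- exact: (measurableT_comp ma (pair1_measurable x)).
- exact: (measurableT_comp mb (pair1_measurable y)).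
by apply: eq_integral => -[x' y'] _; rewrite /c/= !phiK.
Qed.

Let rect (A : set X) (B : set Y) : set W := psi @^-1` (A `*` B).

Let mrect A B : measurable A -> measurable B -> measurable (rect A B).
Proof.
move=> mA mB; rewrite -[X in measurable X]setTI.
by apply: mpsi => //; exact: measurableX.
Qed.

Let om_rect A B : measurable A -> measurable B -> om (rect A B) = (mu A * nu B)%E.
Proof.
move=> mA mB; rewrite -(integral_indicT om (mrect mA mB)).
rewrite omE; last 2 first.
- apply: measurable_EFin.
  by apply: measurable_indic; exact: mrect.
- by move=> w; rewrite lee_fin.
rewrite -product_measure1E// -(integral_indicT (mu \x nu)%E (measurableX mA mB)).
apply: eq_integral => p _; rewrite !indicE.
suff -> : (phi p \in rect A B) = (p \in A `*` B) by [].
by apply/idP/idP => /set_mem H; apply: mem_set; move: H; rewrite /rect/= phiK.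
Qed.

(** If (x, y) and (x', y') are separated by A x B, then either A separates x from x' and y is in B,
    or x' is in A and B separates y from y'. Integrated, this bounds the oscillation by nu(B) times
    that of A plus mu(A) times that of B. *)
Let good_rect A B : measurable A -> measurable B ->
  (mu A < +oo)%E -> (nu B < +oo)%E -> good om prod_kernel \1_(rect A B).
Proof.
move=> mA mB Aoo Boo.
have [HK gK] := GK; have [HL gL] := GL.
have gA := gK _ mA Aoo; have gB := gL _ mB Boo.
have mA1 : measurable_fun setT (\1_A : X -> R) by exact: measurable_indic.
have mB1 : measurable_fun setT (\1_B : Y -> R) by exact: measurable_indic.
have Af : mu A \is a fin_num by rewrite ge0_fin_numE.
have Bf : nu B \is a fin_num by rewrite ge0_fin_numE.
have Ar0 : 0 <= fine (mu A) by exact/fine_ge0/measure_ge0.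
have Br0 : 0 <= fine (nu B) by exact/fine_ge0/measure_ge0.
apply: (le_vanishing _ (vanishingD (vanishingZ Br0 gA) (vanishingZ Ar0 gB))) => k.
pose u1 (p : X * X) : R := (\1_A p.1 - \1_A p.2) ^+ 2.
pose v1 (p : Y * Y) : R := \1_B p.1.
pose u2 (p : X * X) : R := \1_A p.2.
pose v2 (p : Y * Y) : R := (\1_B p.1 - \1_B p.2) ^+ 2.
have mu1 : measurable_fun setT u1.
  apply: measurable_funX; apply: measurable_funB.
    exact: (measurableT_comp mA1 measurable_fst).
  exact: (measurableT_comp mA1 measurable_snd).
have mv2 : measurable_fun setT v2.
  apply: measurable_funX; apply: measurable_funB.
    exact: (measurableT_comp mB1 measurable_fst).
  exact: (measurableT_comp mB1 measurable_snd).
have mv1 : measurable_fun setT v1 by exact: (measurableT_comp mB1 measurable_fst).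
have mu2 : measurable_fun setT u2 by exact: (measurableT_comp mA1 measurable_snd).
have u10 p : 0 <= u1 p by exact: sqr_ge0.
have v20 p : 0 <= v2 p by exact: sqr_ge0.
have v10 p : 0 <= v1 p by exact: ler0n.
have u20 p : 0 <= u2 p by exact: ler0n.
have E1 := integral_KL k mu1 mv1 u10 v10.
have E2 := integral_KL k mu2 mv2 u20 v20.
have EB : (\int[nu]_y \int[nu]_y' (v1 (y, y') * L k (y, y'))%:E = nu B)%E.
  rewrite -(integral_indicT nu mB); apply: eq_integral => y _.
  under eq_integral do rewrite /v1/= EFinM.
  rewrite ge0_integralZl//; last by move=> ? _; rewrite lee_fin.
  by rewrite L1 mule1.
have EA : (\int[mu]_x \int[mu]_x' (u2 (x, x') * K k (x, x'))%:E = mu A)%E.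
  have mAK : measurable_fun setT (fun p : X * X => (u2 p * K k p)%:E).
    by apply: measurable_EFin; exact: measurable_funM.
  have AK0 (p : X * X) : (0 <= (u2 p * K k p)%:E)%E.
    by rewrite lee_fin mulr_ge0.
  rewrite (fubini_tonelli _ mAK AK0).
  rewrite -(integral_indicT mu mA); apply: eq_integral => y _ /=.
  have KC x x' : K k (x, x') = K k (x', x) by case: HK.
  under eq_integral do rewrite KC /u2/= EFinM.
  rewrite ge0_integralZl//; last by move=> ? _; rewrite lee_fin.
  by rewrite K1 mule1.
move: E1 E2; rewrite EA EB => E1 E2.
rewrite !fineK// [X in (_ <= X + _)%E]muleC -E1 -E2.
have mg (u : X * X -> R) (v : Y * Y -> R) : measurable_fun setT u -> measurable_fun setT v ->
    measurable_fun setT (fun q : W * W => (u ((psi q.1).1, (psi q.2).1) *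
       v ((psi q.1).2, (psi q.2).2) * prod_kernel k q)%:E).
  move=> mu_ mv; apply: measurable_EFin.
  apply: measurable_funM; last exact: measurable_prod_kernel.
  apply: measurable_funM; first exact: (measurableT_comp mu_ psi11).
  exact: (measurableT_comp mv psi22).
have mg1 := mg _ _ mu1 mv1; have mg2 := mg _ _ mu2 mv2.
have P0 q : 0 <= prod_kernel k q by rewrite mulr_ge0.
have g10 (q : W * W) : (0 <= (u1 ((psi q.1).1, (psi q.2).1) *
       v1 ((psi q.1).2, (psi q.2).2) * prod_kernel k q)%:E)%E.
  by rewrite lee_fin; apply: mulr_ge0 => //; exact: mulr_ge0.
have g20 (q : W * W) : (0 <= (u2 ((psi q.1).1, (psi q.2).1) *
       v2 ((psi q.1).2, (psi q.2).2) * prod_kernel k q)%:E)%E.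
  by rewrite lee_fin; apply: mulr_ge0 => //; exact: mulr_ge0.
have mR : measurable_fun setT (\1_(rect A B) : W -> R).
  by apply: measurable_indic; exact: mrect.
have mo := measurable_oscillation_integrand prod_mollifier k mR.
have o0 (q : W * W) : (0 <= ((\1_(rect A B) q.1 - \1_(rect A B) q.2) ^+ 2 * prod_kernel k q)%:E)%E.
  by rewrite lee_fin mulr_ge0// sqr_ge0.
rewrite -(fubini_tonelli1 _ mg1 g10) -(fubini_tonelli1 _ mg2 g20).
rewrite /oscillation -(fubini_tonelli1 _ mo o0).
rewrite -ge0_integralD//; apply: ge0_le_integral => //.
  exact: emeasurable_funD.
move=> [p q] _ /=; rewrite -EFinD lee_fin -mulrDl ler_wpM2r//.
rewrite /u1 /v1 /u2 /v2/= !indicE /rect.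
have iE (w : W) : (w \in psi @^-1` (A `*` B)) = ((psi w).1 \in A) && ((psi w).2 \in B).
  apply/idP/andP => [/set_mem[? ?]|[/set_mem ? /set_mem ?]].
    by split; exact: mem_set.
  by apply: mem_set; split.
rewrite !iE; case: (_ \in A); case: (_ \in B); case: (_ \in A); case: (_ \in B) => /=;
  rewrite ?(subrr, subr0, expr0n, expr1n, mulr0, mulr1, add0r, addr0, sub0r, sqrrN)//=; lra.
Qed.

(** Rectangles generate the sigma-algebra of [W] through the isomorphism, and products of two
    exhausting sequences exhaust [W], so [good_all_sets] reduces the claim to [good_rect]. *)
Lemma prod_all_good : all_good om prod_kernel.
Proof.
split; first exact: prod_mollifier.
have /sigma_finiteP[F [TF ndF Foo]] := sigma_finiteT mu.
have /sigma_finiteP[G [TG ndG Goo]] := sigma_finiteT nu.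
have rectI A B A' B' : rect A B `&` rect A' B' = rect (A `&` A') (B `&` B').
  by rewrite /rect -preimage_setI; congr (_ @^-1` _); rewrite setXI.
pose Rs := [set C | exists A B, [/\ measurable A, measurable B & C = rect A B]].
apply: (good_all_sets prod_mollifier (G := Rs) (F := fun n => rect (F n) (G n))).
- move=> C mC; have -> : C = psi @^-1` (phi @^-1` C).
    by apply/seteqP; split => w /=; rewrite psiK.
  have : measurable (phi @^-1` C) by rewrite -[X in measurable X]setTI; exact: mphi.
  rewrite measurable_prod_measurableType.
  move: (phi @^-1` C) => D; apply: (@smallest_sub _ _ _ [set D | <<s Rs >> (psi @^-1` D)]).
    split => /=.
    + by rewrite preimage_set0; exact: sigma_algebra0.
    + by move=> E HE; rewrite setTD preimage_setC -setTD; exact: sigma_algebraCD.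
    + by move=> E HE; rewrite preimage_bigcup; exact: sigma_algebra_bigcup.
  move=> _ [A mA [B mB <-]]; apply: sub_sigma_algebra; by exists A, B.
- by move=> _ [A [B [mA mB ->]]]; exact: mrect.
- by move=> n; case: (Foo n) (Goo n) => mF _ [mG _]; exact: mrect.
- move=> m n mn; apply/subsetPset => w [wF wG]; split.
    by move: wF; apply/subsetPset/ndF.
  by move: wG; apply/subsetPset/ndG.
- apply/seteqP; split => // w _.
  have [i _ Fi] : (\bigcup_k F k) (psi w).1 by rewrite -TF.
  have [j _ Gj] : (\bigcup_k G k) (psi w).2 by rewrite -TG.
  exists (maxn i j) => //; split.
    by move: Fi; exact/subsetPset/ndF/leq_maxl.
  by move: Gj; exact/subsetPset/ndG/leq_maxr.
- move=> n; case: (Foo n) (Goo n) => mF Fo [mG Go]; rewrite om_rect//.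
  by rewrite lte_mul_pinfty// ge0_fin_numE.
- by move=> n; case: (Foo n) (Goo n) => mF Fo [mG Go]; exact: good_rect.
- move=> n _ [A [B [mA mB ->]]]; case: (Foo n) (Goo n) => mF Fo [mG Go].
  rewrite rectI; apply: good_rect; try exact: measurableI.
    apply: le_lt_trans Fo; apply: le_measure; try (by apply: mem_set => //; exact: measurableI).
    exact: subIsetr.
  apply: le_lt_trans Go; apply: le_measure; try (by apply: mem_set => //; exact: measurableI).
  exact: subIsetr.
Qed.

End product_mollifier.

(** When exactly one of x and x - h lies in []a, b]], one of the end points is within [H] of x. *)
Lemma indicator_shift_le (R : realType) (a b x h H : R) : - H <= h <= H ->
  ((a < x <= b)%R%:R - (a < x - h <= b)%R%:R) ^+ 2 <=
  (a - H <= x <= a + H)%R%:R + (b - H <= x <= b + H)%R%:R :> R.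
Proof.
move=> /andP[h1 h2].
have key : (a < x <= b) != (a < x - h <= b) ->
    (a - H <= x <= a + H) || (b - H <= x <= b + H).
  by case: (ltP a x) => ?; case: (leP x b) => ?; case: (ltP a (x - h)) => ?;
    case: (leP (x - h) b) => ? //= _; apply/orP;
    first [by left; apply/andP; split; lra|by right; apply/andP; split; lra].
have H0 : 0 <= (a - H <= x <= a + H)%R%:R + (b - H <= x <= b + H)%R%:R :> R.
  by rewrite addr_ge0.
move: key H0; case: (a < x <= b); case: (a < x - h <= b) => //= key H0;
  rewrite ?subrr ?expr0n ?subr0 ?sub0r ?sqrrN ?expr1n//=.
  by case/orP: (key isT) => ->; rewrite ?lerDl ?lerDr.
by case/orP: (key isT) => ->; rewrite ?lerDl ?lerDr.
Qed.

(** * Poisson kernels *)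

Section poisson_kernel.
Context {R : realType}.
Local Notation leb := (@lebesgue_measure R).
Local Notation T := (measurableTypeR R).

Definition poisson (e u : R) : R := e / (pi * (e ^+ 2 + u ^+ 2)).

Lemma poisson_ge0 e u : 0 <= e -> 0 <= poisson e u.
Proof.
by move=> e0; rewrite /poisson divr_ge0// mulr_ge0 ?pi_ge0// addr_ge0// sqr_ge0.
Qed.

Lemma poisson_scale e u : 0 < e -> poisson e (e * u) * e = poisson 1 u.
Proof.
move=> e0; have u1 : 0 < 1 + u ^+ 2 by rewrite ltr_pwDl// sqr_ge0.
have p0 := pi_gt0 R.
rewrite /poisson expr1n (_ : e ^+ 2 + (e * u) ^+ 2 = e ^+ 2 * (1 + u ^+ 2)); last by ring.
by move: (pi : R) p0 => P p0; field; rewrite !gt_eqF.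
Qed.

Lemma poissonN e u : poisson e (- u) = poisson e u.
Proof. by rewrite /poisson sqrrN. Qed.

Lemma measurable_poisson e : measurable_fun setT (poisson e).
Proof.
apply: measurable_funM; first exact: measurable_cst.
have H : measurable_fun setT (fun u : T => pi * (e ^+ 2 + u ^+ 2)).
  apply: measurable_funM; first exact: measurable_cst.
  by apply: measurable_funD; [exact: measurable_cst|exact: measurable_funX].
exact: (measurableT_comp (@measurable_invr R) H).
Qed.

Lemma integral_poisson1 : (\int[leb]_t (poisson 1 t)%:E = 1)%E.
Proof.
have cf : continuous (fun x : R => (oneDsqr x)^-1) by exact: continuous_oneDsqrV.
have E t : poisson 1 t = pi^-1 * (oneDsqr t)^-1.
  by rewrite /poisson expr1n mul1r invfM.
under eq_integral do rewrite E EFinM.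
rewrite ge0_integralZl//; last 2 first.
- exact: (measurable_EFin (continuous_measurable_fun cf)).
- by rewrite lee_fin invr_ge0 pi_ge0.
rewrite (ge0_symfun_integralT _ cf); last 2 first.
- by move=> x; rewrite invr_ge0 (le_trans ler01)// oneDsqr_ge1.
- by move=> x; rewrite /= /oneDsqr sqrrN.
have -> : [set x : R | 0 <= x] = `[0, +oo[%classic.
  by apply/seteqP; split => x /=; rewrite in_itv/= andbT.
rewrite integral0y_oneDsqr -!EFinM; congr EFin.
by have := pi_gt0 R; move: (pi : R) => P p0; field; rewrite gt_eqF.
Qed.

(** The substitution y = x - e s moves the parameter from the kernel to the function, where
    dominated convergence can handle it. *)
Lemma integral_poisson_affine e x (h : R -> R) : 0 < e ->
  measurable_fun setT h -> (forall y, 0 <= h y) ->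
  (\int[leb]_y (h y * poisson e (x - y))%:E =
   \int[leb]_s (h (x - e * s) * poisson 1 s)%:E)%E.
Proof.
move=> e0 mh h0; rewrite (@ge0_integral_affine _ _ (- e) x).
- apply: eq_integral => s _; rewrite normrN gtr0_norm// -EFinM; congr EFin.
  have -> : - e * s + x = x - e * s by ring.
  by rewrite -mulrA -(poisson_scale s e0); congr (h _ * (poisson _ _ * _)); ring.
- by rewrite oppr_eq0 gt_eqF.
- apply: measurable_EFin; apply: measurable_funM => //.
  apply: (measurableT_comp (measurable_poisson e)).
  by apply: measurable_funB => //; exact: measurable_cst.
- by move=> y; rewrite lee_fin mulr_ge0// poisson_ge0// ltW.
Qed.

Lemma integral_poisson e x : 0 < e -> (\int[leb]_y (poisson e (x - y))%:E = 1)%E.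
Proof.
move=> e0; rewrite -integral_poisson1.
have := @integral_poisson_affine e x (fun=> 1) e0 (measurable_cst _) (fun=> ler01).
by under eq_integral do rewrite mul1r; under [in X in _ = X -> _]eq_integral do rewrite mul1r.
Qed.

Definition eps (k : nat) : R := k.+1%:R^-1.

Lemma eps_gt0 k : 0 < eps k. Proof. by rewrite invr_gt0. Qed.

Lemma cvg_eps : eps @ \oo --> (0 : R). Proof. exact: cvg_harmonic. Qed.

Definition poissonK (k : nat) (p : T * T) : R := poisson (eps k) (p.1 - p.2).

Lemma measurable_poissonK k : measurable_fun setT (poissonK k).
Proof.
apply: (measurableT_comp (measurable_poisson (eps k))).
by apply: measurable_funB; [exact: measurable_fst|exact: measurable_snd].
Qed.

Lemma mollifier_poissonK : mollifier leb poissonK.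
Proof.
split.
- exact: measurable_poissonK.
- by move=> k p; rewrite poisson_ge0// ltW// eps_gt0.
- by move=> k x y; rewrite /poissonK/= -poissonN opprB.
- by move=> k x; exact/integral_poisson/eps_gt0.
Qed.

Section intervals.
Variables (a b : R) (ab : a <= b).
Let A : set T := `]a, b]%classic.

Let iA y : (\1_A y : R) = (a < y <= b)%R%:R.
Proof.
rewrite indicE; congr (nat_of_bool _)%:R; rewrite -[RHS](in_itv y `]a, b]).
by apply/idP/idP => [/set_mem|/mem_set].
Qed.

Let mA : measurable A. Proof. exact: measurable_itv. Qed.
Let m1A : measurable_fun setT (\1_A : T -> R). Proof. exact: measurable_indic. Qed.

(** The squared L^2 distance between the indicator of the interval and its translate by [h]. The
    oscillation is the mean of m(eps s) for the density [poisson 1]. *)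
Let m (h : R) : \bar R := (\int[leb]_x ((\1_A x - \1_A (x - h)) ^+ 2)%:E)%E.

Let mshift h : measurable_fun setT (fun x : T => \1_A (x - h) : R).
Proof.
have H : measurable_fun setT (fun x : T => x - h : T).
  by apply: measurable_funB => //; exact: measurable_cst.
exact: (measurableT_comp m1A H).
Qed.

Let mdiff h : measurable_fun setT (fun x : T => ((\1_A x - \1_A (x - h) : R) ^+ 2)%:E).
Proof.
apply: measurable_EFin; apply: measurable_funX.
exact: measurable_funB m1A (mshift h).
Qed.

Let m_ge0 h : (0 <= m h)%E.
Proof. by apply: integral_ge0 => x _; rewrite lee_fin sqr_ge0. Qed.

Let m_le_length h : (m h <= (2 * (b - a))%:E)%E.
Proof.
have mE : measurable_fun setT (fun x : T => (\1_A x : R)%:E).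
  exact: measurable_EFin m1A.
have mE' : measurable_fun setT (fun x : T => (\1_A (x - h) : R)%:E).
  exact: (measurable_EFin (mshift h)).
have i1 : (\int[leb]_x (\1_A x : R)%:E = (b - a)%:E)%E.
  rewrite integral_indicT//= lebesgue_measure_itv/= lte_fin.
  by case: ltP => // ba; have -> : a = b; [apply/eqP; rewrite eq_le ab|rewrite subrr].
have i2 : (\int[leb]_x (\1_A (x - h) : R)%:E = (b - a)%:E)%E.
  rewrite -i1 (@ge0_integral_affine _ (fun x => (\1_A x : R)%:E) 1 (- h))//.
  by apply: eq_integral => x _; rewrite normr1 mule1 mul1r.
have -> : 2 * (b - a) = (b - a) + (b - a) by ring.
have -> : (b - a + (b - a))%:E =
    (\int[leb]_x ((\1_A x : R)%:E + (\1_A (x - h) : R)%:E))%E.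
  rewrite ge0_integralD//; try (by move=> x _; rewrite lee_fin).
  by rewrite [X in (X + _)%E]i1 [X in (_ + X)%E]i2 EFinD.
apply: ge0_le_integral => //.
- by move=> x _; rewrite lee_fin sqr_ge0.
- exact: emeasurable_funD.
move=> x _; rewrite -EFinD lee_fin !iA.
by case: (a < x <= b); case: (a < x - h <= b) => /=; lra.
Qed.

(** The integrand is supported in two intervals of length 2 |h|, around [a] and around [b]. *)
Let m_le_shift h : (m h <= (4 * `|h|)%:E)%E.
Proof.
pose I c : set T := `[c - `|h|, c + `|h|]%classic.
have mI c : measurable_fun setT (fun x : T => (\1_(I c) x : R)%:E).
  apply: measurable_EFin; apply: measurable_indic.
  exact: measurable_itv.
have iI c y : (\1_(I c) y : R) = (c - `|h| <= y <= c + `|h|)%R%:R.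
  rewrite indicE; congr (nat_of_bool _)%:R; rewrite -[RHS](in_itv y `[c - `|h|, c + `|h|]).
  by apply/idP/idP => [/set_mem|/mem_set].
have LI c : (\int[leb]_x (\1_(I c) x : R)%:E = (2 * `|h|)%:E)%E.
  rewrite integral_indicT; last exact: measurable_itv.
  rewrite /= lebesgue_measure_itv/= lte_fin.
  have h0 := normr_ge0 h; case: ltP => [_|]; first by rewrite -EFinB; congr EFin; ring.
  by move=> H; have -> : `|h| = 0; [lra|rewrite mulr0].
have -> : 4 * `|h| = 2 * `|h| + 2 * `|h| by ring.
have -> : (2 * `|h| + 2 * `|h|)%:E =
    (\int[leb]_x ((\1_(I a) x : R)%:E + (\1_(I b) x : R)%:E))%E.
  rewrite ge0_integralD//; try (by move=> x _; rewrite lee_fin); try exact: mI.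
  by rewrite [X in (X + _)%E]LI [X in (_ + X)%E]LI EFinD.
apply: ge0_le_integral => //.
- by move=> x _; rewrite lee_fin sqr_ge0.
- by apply: emeasurable_funD; exact: mI.
move=> x _; rewrite -EFinD lee_fin !iA !iI.
have h1 := ler_norm h; have h2 : - `|h| <= h by rewrite lerNl -normrN ler_norm.
by apply: indicator_shift_le; rewrite h1 h2.
Qed.

Let m_meas e : measurable_fun setT (fun s : T => m (e * s)).
Proof.
pose g (p : T * T) : \bar R := ((\1_A p.1 - \1_A (p.1 - e * p.2) : R) ^+ 2)%:E.
have mg : measurable_fun setT g.
  apply: measurable_EFin; apply: measurable_funX.
  apply: measurable_funB; first exact: (measurableT_comp m1A measurable_fst).
  have H : measurable_fun setT (fun p : T * T => p.1 - e * p.2 : T).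
    apply: measurable_funB; first exact: measurable_fst.
    by apply: measurable_funM; [exact: measurable_cst|exact: measurable_snd].
  exact: (measurableT_comp m1A H).
apply: (measurable_fun_fubini_tonelli_G g mg) => p.
by rewrite lee_fin sqr_ge0.
Qed.

Let oscillation_itv k :
  oscillation leb (poissonK k) \1_A = (\int[leb]_s ((poisson 1 s)%:E * m (eps k * s)))%E.
Proof.
have e0 := eps_gt0 k.
pose g (p : T * T) : \bar R :=
  ((\1_A p.1 - \1_A (p.1 - eps k * p.2) : R) ^+ 2 * poisson 1 p.2)%:E.
have mp1 : measurable_fun setT (fun p : T * T => poisson 1 p.2).
  exact: (measurableT_comp (measurable_poisson 1) measurable_snd).
have mg : measurable_fun setT g.
  apply: measurable_EFin; apply: measurable_funM => //.
  apply: measurable_funX.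
  apply: measurable_funB; first exact: (measurableT_comp m1A measurable_fst).
  have H : measurable_fun setT (fun p : T * T => p.1 - eps k * p.2 : T).
    apply: measurable_funB; first exact: measurable_fst.
    by apply: measurable_funM; [exact: measurable_cst|exact: measurable_snd].
  exact: (measurableT_comp m1A H).
have g0 p : (0 <= g p)%E by rewrite lee_fin mulr_ge0 ?sqr_ge0// poisson_ge0.
transitivity (\int[leb]_x \int[leb]_s g (x, s))%E.
  apply: eq_integral => x _.
  apply: (@integral_poisson_affine (eps k) x (fun y => (\1_A x - \1_A y) ^+ 2) e0).
    by apply: measurable_funX; apply: measurable_funB => //; exact: measurable_cst.
  by move=> y; exact: sqr_ge0.
rewrite (fubini_tonelli g mg g0); apply: eq_integral => s _.
rewrite /g/= muleC; under eq_integral do rewrite EFinM.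
rewrite ge0_integralZr//.
- by move=> x _; rewrite lee_fin sqr_ge0.
- by rewrite lee_fin poisson_ge0.
Qed.

(** Dominated convergence: [m_le_shift] gives the pointwise limit and [m_le_length] the majorant.
    Both are needed, because |s| is not integrable against the Poisson kernel. *)
Lemma good_itv : good leb poissonK \1_A.
Proof.
apply: cvg0_vanishing.
under eq_fun do rewrite oscillation_itv.
have mpE : measurable_fun setT (fun s : T => (poisson 1 s)%:E).
  exact: (measurable_EFin (measurable_poisson 1)).
have p0 s : (0 <= (poisson 1 s)%:E)%E by rewrite lee_fin poisson_ge0.
have [| | | | |_ _] := @dominated_convergence _ T R leb setT measurableT
  (fun k s => ((poisson 1 s)%:E * m (eps k * s)))%E (fun=> 0%E)
  (fun s => ((2 * (b - a))%:E * (poisson 1 s)%:E)%E).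
- by move=> k; apply: emeasurable_funM => //; exact: m_meas.
- exact: measurable_cst.
- apply: aeW => s _.
  apply: (@squeeze_cvge _ _ _ _ (fun=> 0%E) _ (fun k => (poisson 1 s * (4 * (eps k * `|s|)))%:E)).
  + apply: nearW => k; rewrite mule_ge0//=.
    have -> : (poisson 1 s * (4 * (eps k * `|s|)))%:E =
      ((poisson 1 s)%:E * (4 * (eps k * `|s|))%:E)%E by [].
    apply: lee_wpmul2l => //.
    by apply: (le_trans (m_le_shift _)); rewrite lee_fin normrM gtr0_norm// eps_gt0.
  + exact: cvg_cst.
  + apply: cvg_EFin; first exact: nearW.
    have -> : (0 : R) = poisson 1 s * (4 * (0 * `|s|)) by rewrite mul0r !mulr0.
    apply: cvgM; first exact: cvg_cst.
    apply: cvgM; first exact: cvg_cst.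
    by apply: cvgM; [exact: cvg_eps|exact: cvg_cst].
- apply/integrableP; split.
    by apply: emeasurable_funM => //; exact: measurable_cst.
  have l0 : 0 <= 2 * (b - a) by rewrite mulr_ge0// subr_ge0.
  rewrite (eq_integral (fun s : T => (2 * (b - a))%:E * (poisson 1 s)%:E)%E); last first.
    by move=> s _; rewrite gee0_abs// mule_ge0// lee_fin.
  by rewrite ge0_integralZl// integral_poisson1 mule1 ltry.
- apply: aeW => s k _; rewrite gee0_abs ?mule_ge0// muleC.
  by apply: lee_wpmul2r => //; exact: m_le_length.
- by rewrite integral0.
Qed.

End intervals.

Lemma all_good_poissonK : all_good leb poissonK.
Proof.
split; first exact: mollifier_poissonK.
apply: (good_all_sets mollifier_poissonK (G := @ocitv R)
  (F := fun n => `](- n%:R)%R, n%:R]%classic)).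
- by [].
- by move=> B [[x y] _ <-]; exact: measurable_itv.
- by move=> n; exact: measurable_itv.
- move=> p q pq; apply/subsetPset => x /=; rewrite !in_itv/= => /andP[x1 x2].
  have : p%:R <= q%:R :> R by rewrite ler_nat.
  by move=> ?; apply/andP; split; lra.
- apply/seteqP; split => // x _; exists (Num.bound `|x|) => //=.
  have := archi_boundP (normr_ge0 x); rewrite in_itv/= => H.
  have h1 := ler_norm x; have h2 : - `|x| <= x by rewrite lerNl -normrN ler_norm.
  by apply/andP; split; lra.
- by move=> n /=; rewrite lebesgue_measure_itv/=; case: ifP => _; rewrite -?EFinB ltry.
- by move=> n; apply: good_itv; rewrite (@le_trans _ _ 0)// oppr_le0.
- move=> n _ [[x y] _ <-] /=.
  rewrite (_ : _ `&` _ = `]Num.max x (- n%:R), Num.min y n%:R]%classic); last first.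
    apply/seteqP; split => z /=; rewrite !in_itv/= gt_max le_min.
      by move=> [/andP[-> ->] /andP[-> ->]].
    by move=> /andP[/andP[-> ->] /andP[-> ->]].
  have [xy|yx] := leP (Num.max x (- n%:R)) (Num.min y n%:R); first exact: good_itv.
  by rewrite set_itv_ge ?bnd_simp -?leNgt ?ltW//; exact: good_set0.
Qed.

Definition poisson_rV n (k : nat) (p : 'rV[R]_n * 'rV[R]_n) : R :=
  \prod_(j < n) poisson (eps k) (p.1 0 j - p.2 0 j).

Lemma all_good_poisson_rV n : all_good (lebesgue_rV n) (@poisson_rV n).
Proof.
elim: n => [|n IH].
  (* In dimension 0 there is a single point, so every indicator is constant. *)
  split; last first.
    move=> A mA _.
    rewrite (_ : \1_A = fun=> \1_A 0); first exact: good_cst.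
    by apply/funext => x; rewrite (thinmx0 x).
  split.
  - move=> k; rewrite (_ : poisson_rV k = fun=> 1); first exact: measurable_cst.
    by apply/funext => x; rewrite /poisson_rV big_ord0.
  - by move=> k p; rewrite /poisson_rV big_ord0.
  - by move=> k x y; rewrite /poisson_rV !big_ord0.
  - move=> k x; rewrite ge0_integral_rV0; first by rewrite /poisson_rV big_ord0.
    rewrite (_ : (fun y => _) = fun=> 1%E); first exact: measurable_cst.
    by apply/funext => y; rewrite /poisson_rV big_ord0.
have -> : @poisson_rV n.+1 = prod_kernel poissonK (@poisson_rV n) (@rV_uncons R n).
  apply/funext => k; apply/funext => -[x y].
  rewrite /poisson_rV /prod_kernel/= big_ord_recl; congr (_ * _).
    rewrite /poissonK/= !mxE; congr (poisson _ (x _ _ - y _ _)); exact/val_inj.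
  apply: eq_bigr => j _; rewrite !mxE; congr (poisson _ (x _ _ - y _ _)); exact/val_inj.
apply: (prod_all_good all_good_poissonK IH (@measurable_rV_cons R n)
  (@measurable_rV_uncons R n) (@rV_consK R n) (@rV_unconsK R n)).
move=> H mH H0.
exact: (ge0_integral_pushforward (@measurable_rV_cons R n) (leb \x lebesgue_rV n)%E
  measurableT mH (fun w _ => H0 w)).
Qed.

End poisson_kernel.

(** * Products of integrable functions *)

Section Rintegral_prod.
Context d1 d2 (X : measurableType d1) (Y : measurableType d2) (R : realType).
Variable mu : {sigma_finite_measure set X -> \bar R}.
Variable nu : {sigma_finite_measure set Y -> \bar R}.
Variables (f : X -> R) (g : Y -> R).
Hypotheses (intf : mu.-integrable setT (EFin \o f)) (intg : nu.-integrable setT (EFin \o g)).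

Let mf : measurable_fun setT f.
Proof. by apply/measurable_EFinP; case/integrableP: intf. Qed.

Let mg : measurable_fun setT g.
Proof. by apply/measurable_EFinP; case/integrableP: intg. Qed.

Lemma integrable_prod :
  (mu \x nu)%E.-integrable setT (fun p : X * Y => (f p.1 * g p.2)%:E).
Proof.
have mfg : measurable_fun setT (fun p : X * Y => (f p.1 * g p.2)%:E).
  apply: measurable_EFin.
  apply: measurable_funM; first exact: (measurableT_comp mf measurable_fst).
  exact: (measurableT_comp mg measurable_snd).
have maf : measurable_fun setT (fun x => `|(f x)%:E|%E).
  exact: (measurableT_comp (measurableT_comp (@abse_measurable R setT) (@EFin_measurable R setT)) mf).
have mag : measurable_fun setT (fun x => `|(g x)%:E|%E).
  exact: (measurableT_comp (measurableT_comp (@abse_measurable R setT) (@EFin_measurable R setT)) mg).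
apply/integrableP; split => //.
under eq_integral do rewrite EFinM abseM.
rewrite (@ge0_integral_prod _ _ _ _ _ mu nu (fun x => `|(f x)%:E|%E) (fun x => `|(g x)%:E|%E))//.
have /integrableP[_ foo] := intf; have /integrableP[_ goo] := intg.
by rewrite lte_mul_pinfty//; [exact: integral_ge0|rewrite ge0_fin_numE//; exact: integral_ge0].
Qed.

Lemma integral_prodE :
  (\int[mu \x nu]_p (f p.1 * g p.2)%:E =
   ((\int[mu]_x f x) * (\int[nu]_y g y))%R%:E)%E.
Proof.
rewrite -(integral12_prod_meas1 integrable_prod) /fubini_F/=.
under eq_integral.
  move=> x _; under eq_integral do rewrite EFinM.
  rewrite integralZl//; over.
rewrite /= -/(nu : set Y -> \bar R).
have gf : (\int[nu]_y (g y)%:E)%E \is a fin_num by exact: integrable_fin_num.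
have ff : (\int[mu]_x (f x)%:E)%E \is a fin_num by exact: integrable_fin_num.
rewrite -(fineK gf) integralZr// -(fineK ff) -EFinM.
by rewrite /Rintegral.
Qed.

End Rintegral_prod.

(** * The exponential weight in one variable and its transform *)

Section laplace_weight.
Context {R : realType}.
Local Notation leb := (@lebesgue_measure R).
Local Notation T := (measurableTypeR R).
Variable e : R.
Hypothesis e0 : 0 < e.

Definition weight1 (t : R) : R := expR (- (e * `|t|)).

Lemma weight1_ge0 t : 0 <= weight1 t. Proof. exact: expR_ge0. Qed.

Let cw : continuous weight1.
Proof.
move=> t; rewrite /weight1.
apply: (@continuous_comp _ _ _ (fun t : R => - (e * `|t|)) expR).
  apply: cvgN; apply: cvgM; first exact: cvg_cst.
  exact: norm_continuous.
exact: continuous_expR.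
Qed.

Lemma measurable_weight1 : measurable_fun setT weight1.
Proof. exact: continuous_measurable_fun cw. Qed.

(** An explicit antiderivative. The factor [1 + cos] replaces [cos] to keep the integrand
    nonnegative, so that its improper integral is given by the limit of the antiderivative. *)
Let der (u t : R) : is_derive t 1 (fun t : R => expR (- (e * t)) *
    ((u * sin (u * t) - e * cos (u * t)) / (e ^+ 2 + u ^+ 2) - e^-1))
  (expR (- (e * t)) * (1 + cos (u * t))).
Proof.
have eu : e ^+ 2 + u ^+ 2 != 0.
  by rewrite gt_eqF// ltr_pwDl ?sqr_ge0// exprn_gt0.
have en : e != 0 by rewrite gt_eqF.
apply: is_derive_eq.
rewrite /= !(scaler0, addr0, mulr1) /GRing.scale/=.
by move: (expR _) (sin _) (cos _) => E S C; field; rewrite en eu.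
Qed.

Let bound u t : `|(u * sin (u * t) - e * cos (u * t)) / (e ^+ 2 + u ^+ 2) - e^-1| <=
  (`|u| + e) / (e ^+ 2 + u ^+ 2) + e^-1.
Proof.
have eu : 0 < e ^+ 2 + u ^+ 2 by rewrite ltr_pwDl ?sqr_ge0// exprn_gt0.
apply: (le_trans (ler_normB _ _)); apply: lerD; last by rewrite gtr0_norm// invr_gt0.
rewrite normrM [X in _ * X]gtr0_norm ?invr_gt0//; apply: ler_wpM2r.
  by rewrite invr_ge0 ltW.
apply: (le_trans (ler_normB _ _)); apply: lerD.
  by rewrite normrM ler_piMr// sin_max.
by rewrite normrM (gtr0_norm e0) ler_piMr ?(ltW e0) ?cos_max.
Qed.

Let cvg_exp : expR (- (e * t)) @[t --> +oo] --> (0 : R).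
Proof.
apply: (cvg_comp (fun t => e * t) (fun t => expR (- t)) _ (@cvgr_expR R)).
by apply: gt0_cvgMry => //; exact: cvg_id.
Qed.

Let cvgF u : expR (- (e * t)) *
    ((u * sin (u * t) - e * cos (u * t)) / (e ^+ 2 + u ^+ 2) - e^-1)
  @[t --> +oo] --> (0 : R).
Proof.
set M := (`|u| + e) / (e ^+ 2 + u ^+ 2) + e^-1.
have H (F : R -> R) : (forall t, `|F t| <= expR (- (e * t)) * M) -> F t @[t --> +oo] --> (0 : R).
  move=> HF; apply: (@squeeze_cvgr _ _ _ _ (fun t => - (expR (- (e * t)) * M)) (fun t => expR (- (e * t)) * M)).
  - by apply: nearW => t; rewrite -ler_norml.
  - rewrite -oppr0 -(mul0r M); apply: cvgN.
    by apply: cvgM; [exact: cvg_exp|exact: cvg_cst].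
  - rewrite -(mul0r M).
    by apply: cvgM; [exact: cvg_exp|exact: cvg_cst].
apply: H => t; rewrite normrM ger0_norm ?expR_ge0//.
by rewrite ler_wpM2l ?expR_ge0//; exact: bound.
Qed.
Let cder (u : R) : continuous (fun t : R => expR (- (e * t)) * (1 + cos (u * t))).
Proof.
move=> t; apply: differentiable_continuous.
by apply/derivable1_diffP; exact: ex_derive.
Qed.

Let integral_half u :
  (\int[leb]_(t in `[0%R, +oo[) (expR (- (e * t)) * (1 + cos (u * t)))%:E =
   (e^-1 + e / (e ^+ 2 + u ^+ 2))%:E)%E.
Proof.
have cF t : {for t, continuous (fun t : R => expR (- (e * t)) *
    ((u * sin (u * t) - e * cos (u * t)) / (e ^+ 2 + u ^+ 2) - e^-1))}.
  apply: differentiable_continuous; apply/derivable1_diffP.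
  by case: (der u t).
rewrite (ge0_continuous_FTC2y _ _ (cvgF u)).
- rewrite !mulr0 sin0 cos0 oppr0 expR0 -EFinB; congr EFin; ring.
- by move=> t _; rewrite mulr_ge0 ?expR_ge0//.
- by apply: continuous_subspaceT; exact: cder.
- by move=> t _; case: (der u t).
- by apply: cvg_at_right_filter; exact: cF.
- by move=> t _; rewrite derive1E; case: (der u t).
Qed.

Let integral_even u : (\int[leb]_t (weight1 t * (1 + cos (u * t)))%:E =
   (2 * (e^-1 + e / (e ^+ 2 + u ^+ 2)))%:E)%E.
Proof.
rewrite ge0_symfun_integralT.
- have -> : [set x : R | 0 <= x] = `[0, +oo[%classic.
    by apply/seteqP; split => x /=; rewrite in_itv/= andbT.
  rewrite EFinM -(integral_half u); congr (_ * _)%E; apply: eq_integral => t.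
  by rewrite inE/= in_itv/= andbT => t0; rewrite /weight1 ger0_norm.
- by move=> t; rewrite mulr_ge0 ?weight1_ge0//.
- move=> t; apply: cvgM; first exact: cw.
  apply: cvgD; first exact: cvg_cst.
  apply: (@continuous_comp _ _ _ (fun t : R => u * t) cos); last exact: continuous_cos.
  by apply: cvgM; [exact: cvg_cst|exact: cvg_id].
- by move=> t; rewrite /= /weight1 normrN mulrN cosN.
Qed.

Lemma integral_weight1 : (\int[leb]_t (weight1 t)%:E = (2 / e)%:E)%E.
Proof.
(* At u = 0 the factor [1 + cos] is the constant 2. *)
have H := integral_even 0.
have E : (\int[leb]_t (weight1 t * (1 + cos (0 * t)))%:E =
    2%:E * \int[leb]_t (weight1 t)%:E)%E.
  rewrite -ge0_integralZl//.
  - apply: eq_integral => t _; rewrite mul0r cos0 -EFinM; congr EFin; ring.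
  - exact: measurable_EFin measurable_weight1.
  - by move=> t _; rewrite lee_fin weight1_ge0.
move: H; rewrite E expr0n/= addr0.
have -> : e / e ^+ 2 = e^-1 by field; rewrite gt_eqF.
case: (\int[leb]_t _)%E => [r| |].
- by rewrite -EFinM => -[] H; congr EFin; lra.
- by rewrite gt0_muley ?lte_fin.
- by rewrite gt0_muleNy ?lte_fin.
Qed.

Lemma integrable_weight1 : leb.-integrable setT (EFin \o weight1).
Proof.
apply/integrableP; split.
  exact: measurable_EFin measurable_weight1.
under eq_integral do rewrite /= ger0_norm ?weight1_ge0//.
by rewrite integral_weight1 ltry.
Qed.

Let mcos u : measurable_fun setT (fun t : T => cos (u * t)).
Proof.
have H : measurable_fun setT (fun t : T => u * t).
  by apply: measurable_funM; [exact: measurable_cst|exact: measurable_id].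
exact: (measurableT_comp (@measurable_cos R) H).
Qed.

Let msin u : measurable_fun setT (fun t : T => sin (u * t)).
Proof.
have H : measurable_fun setT (fun t : T => u * t).
  by apply: measurable_funM; [exact: measurable_cst|exact: measurable_id].
exact: (measurableT_comp (@measurable_sin R) H).
Qed.

Lemma integrable_weight1_bounded (g : R -> R) : measurable_fun setT g ->
  (forall t, `|g t| <= 1) -> leb.-integrable setT (fun t => (weight1 t * g t)%:E).
Proof.
move=> mg g1; apply: (le_integrable measurableT _ _ integrable_weight1).
  apply: measurable_EFin.
  by apply: measurable_funM => //; exact: measurable_weight1.
move=> t _ /=; rewrite lee_fin normrM ler_piMr//.
Qed.

(** Removing the integral of the weight from [integral_even] leaves 2 e / (e^2 + u^2), which is 2 pi
    times the Poisson kernel. *)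
Lemma Rintegral_weight1_cos u :
  \int[leb]_t (weight1 t * cos (u * t)) = 2 * pi * poisson e u.
Proof.
have ic := integrable_weight1_bounded (mcos u) (fun t => cos_max _).
have iw := integrable_weight1.
have /(congr1 fine) /= := integral_even u.
rewrite (_ : fine _ = \int[leb]_t (weight1 t + weight1 t * cos (u * t))); last first.
  by congr fine; apply: eq_integral => t _; congr EFin; ring.
rewrite RintegralD//.
have -> : \int[leb]_t (weight1 t) = 2 / e by rewrite /Rintegral integral_weight1.
have eu : e ^+ 2 + u ^+ 2 != 0.
  by rewrite gt_eqF// ltr_pwDl ?sqr_ge0// exprn_gt0.
have p0 : (pi : R) != 0 by rewrite gt_eqF// pi_gt0.
rewrite /poisson; move: (pi : R) p0 => P P0.
have -> : 2 * P * (e / (P * (e ^+ 2 + u ^+ 2))) = 2 * (e / (e ^+ 2 + u ^+ 2)).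
  by field; rewrite eu P0.
rewrite mulrDr => /addrI; exact.
Qed.

(** Reflection exchanges the factors 1 + sin and 1 - sin, both nonnegative. Their integrals agree,
    so the sine part equals its opposite. *)
Lemma Rintegral_weight1_sin u : \int[leb]_t (weight1 t * sin (u * t)) = 0.
Proof.
have is_ := integrable_weight1_bounded (msin u) (fun t => sin_max _).
have iw := integrable_weight1.
have mD (s : R) : measurable_fun setT (fun t : T => (weight1 t * (1 + s * sin (u * t)))%:E).
  apply: measurable_EFin.
  apply: measurable_funM; first exact: measurable_weight1.
  apply: measurable_funD; first exact: measurable_cst.
  by apply: measurable_funM; [exact: measurable_cst|exact: msin].
have E : (\int[leb]_t (weight1 t * (1 + 1 * sin (u * t)))%:E =
    \int[leb]_t (weight1 t * (1 + -1 * sin (u * t)))%:E)%E.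
  rewrite (@ge0_integral_affine _ _ (-1) 0) ?oppr_eq0 ?oner_eq0//.
  - apply: eq_integral => t _; rewrite normrN1 mule1.
    have -> : -1 * t + 0 = - t :> R by ring.
    rewrite /weight1 normrN mulrN sinN; congr EFin; ring.
  - exact: mD.
  - by move=> t; rewrite lee_fin mulr_ge0 ?weight1_ge0//.
have /(congr1 fine) := E.
rewrite (_ : fine _ = \int[leb]_t (weight1 t + weight1 t * sin (u * t))); last first.
  by congr fine; apply: eq_integral => t _; congr EFin; ring.
rewrite (_ : fine (\int[leb]_t _)%E = \int[leb]_t (weight1 t - weight1 t * sin (u * t))); last first.
  by congr fine; apply: eq_integral => t _; congr EFin; ring.
rewrite RintegralD// RintegralB//.
by move=> /addrI /eqP; rewrite -subr_eq0 opprK -mulr2n mulrn_eq0/= => /eqP.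
Qed.

End laplace_weight.

(** * The weight in n variables and its transform *)

Section weight_rV.
Context {R : realType}.
Local Notation leb := (@lebesgue_measure R).
Local Notation T := (measurableTypeR R).

Lemma dotS n (u v : 'rV[R]_n.+1) : dot u v =
  (rV_uncons u).1 * (rV_uncons v).1 + dot (rV_uncons u).2 (rV_uncons v).2.
Proof.
rewrite /dot big_ord_recl /=; congr (_ + _).
  by rewrite !mxE; congr (u _ _ * v _ _); exact/val_inj.
by apply: eq_bigr => j _; rewrite !mxE; congr (u _ _ * v _ _); exact/val_inj.
Qed.

Lemma measurable_dot n (u : 'rV[R]_n) : measurable_fun setT (fun x : 'rV[R]_n => dot u x : T).
Proof.
apply: measurable_sum => j; apply: measurable_funM; first exact: measurable_cst.
exact: measurable_coord.
Qed.

Section product_function.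
Variables (n : nat) (f : T -> R) (g : 'rV[R]_n -> R).
Hypotheses (intf : leb.-integrable setT (EFin \o f))
  (intg : (lebesgue_rV n).-integrable setT (EFin \o g)).

Let F (v : 'rV[R]_n.+1) := f (rV_uncons v).1 * g (rV_uncons v).2.

Let mF : measurable_fun setT (EFin \o F).
Proof.
have mf : measurable_fun setT f by apply/measurable_EFinP; case/integrableP: intf.
have mg : measurable_fun setT g by apply/measurable_EFinP; case/integrableP: intg.
apply: measurable_EFin; apply: measurable_funM.
  exact: (measurableT_comp mf (measurableT_comp measurable_fst (@measurable_rV_uncons R n))).
exact: (measurableT_comp mg (measurableT_comp measurable_snd (@measurable_rV_uncons R n))).
Qed.

Let FE : (EFin \o F) \o @rV_cons R n = fun p => (f p.1 * g p.2)%:E.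
Proof. by apply/funext => p; rewrite /comp /F rV_consK. Qed.

Let intF : (leb \x lebesgue_rV n)%E.-integrable (@rV_cons R n @^-1` setT)
  ((EFin \o F) \o @rV_cons R n).
Proof. by rewrite FE preimage_setT; exact: (integrable_prod intf intg). Qed.

Lemma integrable_rVS : (lebesgue_rV n.+1).-integrable setT (EFin \o F).
Proof. exact: (integrable_pushforward (@measurable_rV_cons R n) mF intF measurableT). Qed.

Lemma Rintegral_rVS :
  \int[lebesgue_rV n.+1]_v F v = (\int[leb]_a f a) * (\int[lebesgue_rV n]_v g v).
Proof.
rewrite {1}/Rintegral (integral_pushforward (@measurable_rV_cons R n) mF intF measurableT).
by rewrite FE preimage_setT (integral_prodE intf intg).
Qed.

End product_function.

Definition weight_rV n k (x : 'rV[R]_n) : R := \prod_(j < n) weight1 (eps k) (x 0 j).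

Lemma weight_rVS n k (v : 'rV[R]_n.+1) :
  weight_rV k v = weight1 (eps k) (rV_uncons v).1 * weight_rV k (rV_uncons v).2.
Proof.
rewrite /weight_rV big_ord_recl /=; congr (_ * _).
  by rewrite !mxE; congr (weight1 _ (v _ _)); exact/val_inj.
by apply: eq_bigr => j _; rewrite !mxE; congr (weight1 _ (v _ _)); exact/val_inj.
Qed.

Lemma weight_rV_ge0 n k (x : 'rV[R]_n) : 0 <= weight_rV k x.
Proof. by apply: prodr_ge0 => j _; exact: weight1_ge0. Qed.

Lemma weight_rV_le1 n k (x : 'rV[R]_n) : weight_rV k x <= 1.
Proof.
apply: prodr_ile1 => j _; rewrite weight1_ge0 /weight1 expR_le1 oppr_le0.
by rewrite mulr_ge0 ?(ltW (eps_gt0 _)).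
Qed.

Lemma measurable_weight_rV n k : measurable_fun setT (@weight_rV n k).
Proof.
apply: measurable_prod => j _.
exact: (measurableT_comp (measurable_weight1 (eps k)) (measurable_coord j)).
Qed.

Lemma cvg_weight_rV n (x : 'rV[R]_n) : weight_rV k x @[k --> \oo] --> (1 : R).
Proof.
elim: n x => [|n IH] x.
  by rewrite /weight_rV; under eq_fun do rewrite big_ord0; exact: cvg_cst.
under eq_fun do rewrite weight_rVS.
rewrite -(mulr1 1); apply: cvgM; last exact: IH.
move: (rV_uncons x).1 => a.
rewrite /weight1 -[X in _ --> X]expR0.
apply: (@continuous_cvg _ _ _ _ _ (fun k => - (eps k * `|a|)) (expR : R -> R)).
  exact: continuous_expR.
rewrite -oppr0; apply: cvgN; rewrite -[X in _ --> X](mul0r `|a|).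
by apply: cvgM; [exact: cvg_eps|exact: cvg_cst].
Qed.

Lemma integrable_weight_rV n k : (lebesgue_rV n).-integrable setT (EFin \o @weight_rV n k).
Proof.
elim: n => [|n IH].
  apply/integrableP; split.
    exact: (measurable_EFin (@measurable_weight_rV 0 k)).
  rewrite ge0_integral_rV0//.
    by rewrite /= ltry.
  apply: (measurableT_comp (measurableT_comp (@abse_measurable R setT) (@EFin_measurable R setT)) (@measurable_weight_rV 0 k)).
have := integrable_rVS (integrable_weight1 (eps_gt0 k)) IH.
by congr (integrable _ _ _); apply/funext => v /=; rewrite weight_rVS.
Qed.

Lemma integrable_weight_rV_bounded n k (g : 'rV[R]_n -> R) : measurable_fun setT g ->
  (forall t, `|g t| <= 1) ->
  (lebesgue_rV n).-integrable setT (EFin \o (fun t => weight_rV k t * g t)).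
Proof.
move=> mg g1; apply: (le_integrable measurableT _ _ (integrable_weight_rV n k)).
  apply: measurable_EFin.
  apply: (measurable_funM (@measurable_weight_rV n k) mg).
by move=> t _ /=; rewrite lee_fin normrM ler_piMr.
Qed.

Lemma integrable_weight_rV_cos n k (u : 'rV[R]_n) :
  (lebesgue_rV n).-integrable setT (EFin \o (fun v => weight_rV k v * cos (dot u v))).
Proof.
apply: integrable_weight_rV_bounded; last by move=> t; exact: cos_max.
exact: (measurableT_comp (@measurable_cos R) (measurable_dot u)).
Qed.

Lemma integrable_weight_rV_sin n k (u : 'rV[R]_n) :
  (lebesgue_rV n).-integrable setT (EFin \o (fun v => weight_rV k v * sin (dot u v))).
Proof.
apply: integrable_weight_rV_bounded; last by move=> t; exact: sin_max.
exact: (measurableT_comp (@measurable_sin R) (measurable_dot u)).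
Qed.

(** Cosine and sine are treated together because the addition formulas mix them when the first
    coordinate is split off. *)
Lemma Rintegral_weight_rV n k (u : 'rV[R]_n) :
  \int[lebesgue_rV n]_v (weight_rV k v * cos (dot u v)) =
    (2 * pi) ^+ n * \prod_(j < n) poisson (eps k) (u 0 j) /\
  \int[lebesgue_rV n]_v (weight_rV k v * sin (dot u v)) = 0.
Proof.
elim: n u => [|n IH] u.
  rewrite !big_ord0 !mulr1 expr0; split.
    rewrite /Rintegral ge0_integral_rV0.
    - by rewrite /weight_rV /dot !big_ord0 cos0 mulr1.
    - apply: measurable_EFin.
      apply: (measurable_funM (@measurable_weight_rV 0 k)).
      exact: (measurableT_comp (@measurable_cos R) (measurable_dot u)).
  rewrite (_ : (fun v => _) = fun=> 0); first by rewrite /Rintegral integral0.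
  by apply/funext => v; rewrite /dot big_ord0 sin0 mulr0.
have e0 : 0 < (eps k : R) by exact: eps_gt0.
set a := (rV_uncons u).1; set u' := (rV_uncons u).2.
have [IHc IHs] := IH u'.
have m1 (h : R -> R) : measurable_fun setT (h : T -> R) -> measurable_fun setT (fun t : T => h (a * t)).
  move=> mh; apply: (measurableT_comp mh).
  by apply: measurable_funM; [exact: measurable_cst|exact: measurable_id].
have c1 : leb.-integrable setT (EFin \o (fun t : T => weight1 (eps k) t * cos (a * t))).
  exact: (integrable_weight1_bounded e0 (m1 _ (@measurable_cos R)) (fun t => cos_max _)).
have s1 : leb.-integrable setT (EFin \o (fun t : T => weight1 (eps k) t * sin (a * t))).
  exact: (integrable_weight1_bounded e0 (m1 _ (@measurable_sin R)) (fun t => sin_max _)).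
have c2 := integrable_weight_rV_cos k u'.
have s2 := integrable_weight_rV_sin k u'.
split.
- rewrite (_ : Rintegral _ _ _ = \int[lebesgue_rV n.+1]_v
      (weight1 (eps k) (rV_uncons v).1 * cos (a * (rV_uncons v).1) *
         (weight_rV k (rV_uncons v).2 * cos (dot u' (rV_uncons v).2)) -
       weight1 (eps k) (rV_uncons v).1 * sin (a * (rV_uncons v).1) *
         (weight_rV k (rV_uncons v).2 * sin (dot u' (rV_uncons v).2)))); last first.
    apply: eq_Rintegral => v _; rewrite weight_rVS dotS cosD; ring.
  rewrite (RintegralB measurableT (integrable_rVS c1 c2) (integrable_rVS s1 s2)).
  rewrite (Rintegral_rVS c1 c2) (Rintegral_rVS s1 s2).
  rewrite IHc IHs mulr0 subr0 Rintegral_weight1_cos// big_ord_recl exprS.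
  rewrite mulrACA; congr (_ * (poisson _ _ * _)).
    by rewrite /a /= !mxE; congr (u _ _); exact/val_inj.
  by apply: eq_bigr => j _; rewrite /u' /= !mxE; congr (poisson _ (u _ _)); exact/val_inj.
- rewrite (_ : Rintegral _ _ _ = \int[lebesgue_rV n.+1]_v
      (weight1 (eps k) (rV_uncons v).1 * sin (a * (rV_uncons v).1) *
         (weight_rV k (rV_uncons v).2 * cos (dot u' (rV_uncons v).2)) +
       weight1 (eps k) (rV_uncons v).1 * cos (a * (rV_uncons v).1) *
         (weight_rV k (rV_uncons v).2 * sin (dot u' (rV_uncons v).2)))); last first.
    apply: eq_Rintegral => v _; rewrite weight_rVS dotS sinD; ring.
  rewrite (RintegralD measurableT (integrable_rVS s1 c2) (integrable_rVS c1 s2)).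
  rewrite (Rintegral_rVS s1 c2) (Rintegral_rVS c1 s2).
  by rewrite IHs Rintegral_weight1_sin// mul0r mulr0 addr0.
Qed.

End weight_rV.

Lemma ge0_integrable d (T : measurableType d) (R : realType)
    (mu : {measure set T -> \bar R}) (f : T -> R) :
  measurable_fun setT f -> (forall x, 0 <= f x) ->
  (\int[mu]_x (f x)%:E < +oo)%E -> mu.-integrable setT (EFin \o f).
Proof.
move=> mf f0 foo; apply/integrableP; split.
  exact: measurable_EFin mf.
rewrite (eq_integral (fun x => (f x)%:E))// => x _.
by rewrite /= ger0_norm.
Qed.

(** * Plancherel's identity *)

Section Rfubini.
Context d1 d2 (X : measurableType d1) (Y : measurableType d2) (R : realType).
Variable mu : {sigma_finite_measure set X -> \bar R}.
Variable nu : {sigma_finite_measure set Y -> \bar R}.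
Variables (H : X * Y -> R) (p : X -> R) (q : Y -> R).
Hypotheses (mH : measurable_fun setT H)
  (intp : mu.-integrable setT (EFin \o p)) (intq : nu.-integrable setT (EFin \o q))
  (Hpq : forall x y, `|H (x, y)| <= p x * q y).

Let mEH : measurable_fun setT (EFin \o H).
Proof. exact: measurable_EFin mH. Qed.

Lemma integrable_dominated_prod : (mu \x nu)%E.-integrable setT (EFin \o H).
Proof.
apply: (le_integrable measurableT mEH _ (integrable_prod intp intq)).
by move=> [x y] _ /=; rewrite lee_fin (le_trans (Hpq x y))// ler_norm.
Qed.

(** The product bound makes every slice integrable, not just almost every one, so that the inner
    integrals are real numbers at each point. *)
Lemma integrable_slice1 x : nu.-integrable setT (EFin \o (fun y => H (x, y))).
Proof.
have i := integrableZl measurableT (p x) intq.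
apply: (le_integrable measurableT _ _ i).
  exact: (measurableT_comp mEH (pair1_measurable x)).
by move=> y _ /=; rewrite lee_fin (le_trans (Hpq x y))// ler_norm.
Qed.

Lemma integrable_slice2 y : mu.-integrable setT (EFin \o (fun x => H (x, y))).
Proof.
have i := integrableZl measurableT (q y) intp.
apply: (le_integrable measurableT _ _ i).
  exact: (measurableT_comp mEH (pair2_measurable y)).
by move=> x _ /=; rewrite lee_fin mulrC (le_trans (Hpq x y))// ler_norm.
Qed.

Let E1 : fubini_F nu (EFin \o H) = EFin \o (fun x => \int[nu]_y H (x, y)).
Proof.
apply/funext => x; rewrite /fubini_F /= /Rintegral fineK//.
exact: (integrable_fin_num measurableT (integrable_slice1 x)).
Qed.

Let E2 : fubini_G mu (EFin \o H) = EFin \o (fun y => \int[mu]_x H (x, y)).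
Proof.
apply/funext => y; rewrite /fubini_G /= /Rintegral fineK//.
exact: (integrable_fin_num measurableT (integrable_slice2 y)).
Qed.

Lemma integrable_Rintegral1 : mu.-integrable setT (EFin \o (fun x => \int[nu]_y H (x, y))).
Proof. by rewrite -E1; exact: (integrable_fubini_F integrable_dominated_prod). Qed.

Lemma Rintegral12 : \int[mu]_x \int[nu]_y H (x, y) = \int[(mu \x nu)%E]_z H z.
Proof.
by rewrite /Rintegral -(integral12_prod_meas1 integrable_dominated_prod) E1.
Qed.

Lemma Rintegral21 : \int[nu]_y \int[mu]_x H (x, y) = \int[(mu \x nu)%E]_z H z.
Proof.
by rewrite /Rintegral -(integral21_prod_meas1 integrable_dominated_prod) E2.
Qed.

Lemma Rfubini : \int[mu]_x \int[nu]_y H (x, y) = \int[nu]_y \int[mu]_x H (x, y).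
Proof. by rewrite Rintegral12 Rintegral21. Qed.

End Rfubini.

(** * Expansion of the oscillation *)

Section oscillation_expansion.
Context d (X : measurableType d) (R : realType).
Variable mu : {sigma_finite_measure set X -> \bar R}.
Variable K : nat -> X * X -> R.
Hypothesis HK : mollifier mu K.
Variable k : nat.
Variable f : X -> R.
Hypothesis mf : measurable_fun setT f.
Hypothesis f2 : mu.-integrable setT (EFin \o (fun x => f x ^+ 2)).

Let mK : measurable_fun setT (K k). Proof. by case: HK. Qed.
Let K0 p : 0 <= K k p. Proof. by case: HK. Qed.
Let KC x y : K k (x, y) = K k (y, x). Proof. by case: HK. Qed.
Let K1 x : (\int[mu]_y (K k (x, y))%:E = 1)%E. Proof. by case: HK. Qed.
Let mEK : measurable_fun setT (fun p => (K k p)%:E).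
Proof. exact: measurable_EFin mK. Qed.
Let mf1 : measurable_fun setT (fun p : X * X => f p.1).
Proof. exact: (measurableT_comp mf measurable_fst). Qed.
Let mf2 : measurable_fun setT (fun p : X * X => f p.2).
Proof. exact: (measurableT_comp mf measurable_snd). Qed.
Let I := (\int[mu]_x (f x ^+ 2)).

Let IE : (\int[mu]_x (f x ^+ 2)%:E = I%:E)%E.
Proof. by rewrite /I /Rintegral fineK//; exact: (integrable_fin_num measurableT f2). Qed.

Let mp (h : X * X -> R) : measurable_fun setT h ->
  measurable_fun setT (EFin \o (fun p => h p ^+ 2 * K k p)).
Proof.
move=> mh; apply: measurable_EFin.
by apply: measurable_funM => //; exact: measurable_funX.
Qed.

Let Ea : (\int[mu \x mu]_p (f p.1 ^+ 2 * K k p)%:E = I%:E)%E.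
Proof.
have H0 (p : X * X) : (0 <= (f p.1 ^+ 2 * K k p)%:E)%E by rewrite lee_fin mulr_ge0// sqr_ge0.
rewrite (fubini_tonelli1 _ (mp mf1) H0) -IE; apply: eq_integral => x _.
rewrite /fubini_F/=; under eq_integral do rewrite EFinM.
rewrite ge0_integralZl//; first by rewrite K1 mule1.
- exact: (measurableT_comp mEK (pair1_measurable x)).
- by move=> y _; rewrite lee_fin.
- by rewrite lee_fin sqr_ge0.
Qed.

Let Eb : (\int[mu \x mu]_p (f p.2 ^+ 2 * K k p)%:E = I%:E)%E.
Proof.
have H0 (p : X * X) : (0 <= (f p.2 ^+ 2 * K k p)%:E)%E by rewrite lee_fin mulr_ge0// sqr_ge0.
rewrite (fubini_tonelli2 _ (mp mf2) H0) -IE; apply: eq_integral => x _.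
rewrite /fubini_G/=; under eq_integral do rewrite EFinM KC.
rewrite ge0_integralZl//; first by rewrite K1 mule1.
- exact: (measurableT_comp mEK (pair1_measurable x)).
- by move=> y _; rewrite lee_fin.
- by rewrite lee_fin sqr_ge0.
Qed.

Let ia : (mu \x mu)%E.-integrable setT (EFin \o (fun p => f p.1 ^+ 2 * K k p)).
Proof.
apply: ge0_integrable.
- by apply: measurable_funM => //; exact: measurable_funX.
- by move=> p; rewrite mulr_ge0 ?sqr_ge0.
- by rewrite Ea ltry.
Qed.

Let ib : (mu \x mu)%E.-integrable setT (EFin \o (fun p => f p.2 ^+ 2 * K k p)).
Proof.
apply: ge0_integrable.
- by apply: measurable_funM => //; exact: measurable_funX.
- by move=> p; rewrite mulr_ge0 ?sqr_ge0.
- by rewrite Eb ltry.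
Qed.

(** From |a b| <= a^2 + b^2; the two square terms are integrable because the marginals of the kernel
    are 1. *)
Lemma integrable_kernel : (mu \x mu)%E.-integrable setT
  (EFin \o (fun p => f p.1 * f p.2 * K k p)).
Proof.
apply: (le_integrable measurableT _ _ (integrableD measurableT ia ib)).
  apply: measurable_EFin.
  by apply: measurable_funM => //; exact: measurable_funM.
move=> p _ /=; rewrite lee_fin -mulrDl [leLHS]normrM [leRHS]normrM (ger0_norm (K0 p)).
rewrite ler_wpM2r// [leRHS]ger0_norm ?addr_ge0 ?sqr_ge0//.
move: (f p.1) (f p.2) => a b.
have := sqr_ge0 (a - b); have := sqr_ge0 (a + b); have := sqr_ge0 a; have := sqr_ge0 b.
by move=> ? ? ? ?; rewrite ler_norml; nra.
Qed.

(** Expanding the square, each square term integrates to [I] and the mixed term is twice the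
    correlation. *)
Lemma oscillationE : oscillation mu (K k) f =
  (2 * (I - \int[(mu \x mu)%E]_p (f p.1 * f p.2 * K k p)))%:E.
Proof.
have sq0 (p : X * X) : (0 <= ((f p.1 - f p.2) ^+ 2 * K k p)%:E)%E.
  by rewrite lee_fin mulr_ge0// sqr_ge0.
have := fubini_tonelli1 _ (measurable_oscillation_integrand HK k mf) sq0.
rewrite /oscillation => <-.
have iK := integrable_kernel.
have i2 := integrableZl measurableT 2 iK.
have E : (\int[mu \x mu]_p ((f p.1 - f p.2) ^+ 2 * K k p)%:E =
   \int[mu \x mu]_p (((f p.1 ^+ 2 * K k p)%:E + (f p.2 ^+ 2 * K k p)%:E)
     - (2%:E * (f p.1 * f p.2 * K k p)%:E)))%E.
  by apply: eq_integral => p _; transitivity ((f p.1 ^+ 2 * K k p + f p.2 ^+ 2 * K k p - 2 * (f p.1 * f p.2 * K k p))%:E) => //; congr EFin; ring.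
rewrite E (integralB measurableT (integrableD measurableT ia ib) i2).
rewrite (integralD measurableT ia ib) Ea Eb (integralZl measurableT iK).
have iKf := integrable_fin_num measurableT iK.
rewrite -(fineK iKf) [\int[(mu \x mu)%E]_p _]/Rintegral; move: (fine _) => J.
transitivity ((I + I - 2 * J)%:E) => //; congr EFin; ring.
Qed.

End oscillation_expansion.

(** * Integrals depending on a parameter *)

Section parametric_integral.
Context d1 d2 (X : measurableType d1) (Y : measurableType d2) (R : realType).
Variable mu : {sigma_finite_measure set X -> \bar R}.
Variables (H : Y * X -> R) (q : X -> R).
Hypotheses (mH : measurable_fun setT H) (intq : mu.-integrable setT (EFin \o q))
  (Hq : forall y x, `|H (y, x)| <= q x).

Let mEH : measurable_fun setT (EFin \o H).
Proof. exact: measurable_EFin mH. Qed.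

Lemma integrable_slice y : mu.-integrable setT (EFin \o (fun x => H (y, x))).
Proof.
apply: (le_integrable measurableT _ _ intq).
  exact: (measurableT_comp mEH (pair1_measurable y)).
by move=> x _ /=; rewrite lee_fin (le_trans (Hq y x))// ler_norm.
Qed.

Lemma measurable_parametric : measurable_fun setT (fun y => \int[mu]_x H (y, x)).
Proof.
have mq : measurable_fun setT q by apply/measurable_EFinP; case/integrableP: intq.
(* Adding [q] makes the integrand nonnegative, so that measurability comes from Tonelli's theorem;
   the integral of [q] is then removed. *)
have -> : (fun y => \int[mu]_x H (y, x)) =
    (fun y => fine (\int[mu]_x (H (y, x) + q x)%:E)%E - \int[mu]_x q x).
  apply/funext => y.
  rewrite -/(\int[mu]_x (H (y, x) + q x)) RintegralD//; last exact: integrable_slice.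
  by rewrite addrK.
apply: measurable_funB; last exact: measurable_cst.
apply: (measurableT_comp (@fine_measurable R setT measurableT)).
apply: (measurable_fun_fubini_tonelli_F (fun p : Y * X => (H p + q p.2)%:E)).
  apply: measurable_EFin.
  apply: (measurable_funD mH); exact: (measurableT_comp mq measurable_snd).
move=> [y x]; rewrite lee_fin.
by have := Hq y x; rewrite ler_norml => /andP[+ _]; rewrite -lerBlDr sub0r.
Qed.

Lemma norm_parametric_le y : `|\int[mu]_x H (y, x)| <= \int[mu]_x q x.
Proof.
have i := integrable_slice y.
apply: (le_trans (le_normr_Rintegral measurableT i)).
by apply: le_Rintegral => //; exact: (integrable_abse i).
Qed.

Variable nu : {sigma_finite_measure set Y -> \bar R}.
Variable w : Y -> R.
Hypotheses (w0 : forall y, 0 <= w y) (iw : nu.-integrable setT (EFin \o w)).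

Let P x x' := \int[nu]_y (w y * (H (y, x) * H (y, x'))).
Let A y := \int[mu]_x H (y, x).
Let mw : measurable_fun setT w.
Proof. by apply/measurable_EFinP; case/integrableP: iw. Qed.

Let mH1 x : measurable_fun setT (fun y => H (y, x)).
Proof. exact: (measurableT_comp mH (pair2_measurable x)). Qed.

Let iwq x : nu.-integrable setT (EFin \o (fun y => w y * q x)).
Proof. exact: (integrableZr measurableT (q x) iw). Qed.

Let mH' x : measurable_fun setT (fun p : Y * X => w p.1 * (H (p.1, x) * H p)).
Proof.
apply: measurable_funM; first exact: (measurableT_comp mw measurable_fst).
by apply: measurable_funM => //; exact: (measurableT_comp (mH1 x) measurable_fst).
Qed.

Let bH' x y x' : `|w y * (H (y, x) * H (y, x'))| <= (w y * q x) * q x'.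
Proof.
rewrite !normrM (ger0_norm (w0 y)) -mulrA ler_wpM2l// ler_pM//.
Qed.

Let mH'' : measurable_fun setT (fun p : Y * X => w p.1 * (H p * A p.1)).
Proof.
apply: measurable_funM; first exact: (measurableT_comp mw measurable_fst).
by apply: measurable_funM => //; exact: (measurableT_comp measurable_parametric measurable_fst).
Qed.

Let Q := \int[mu]_x q x.
Let iwQ : nu.-integrable setT (EFin \o (fun y => w y * Q)).
Proof. exact: (integrableZr measurableT Q iw). Qed.

Let bH'' y x : `|w y * (H (y, x) * A y)| <= (w y * Q) * q x.
Proof.
rewrite !normrM (ger0_norm (w0 y)) -mulrA ler_wpM2l// mulrC ler_pM//.
exact: norm_parametric_le.
Qed.

Lemma integrable_weighted_correlation x :
  mu.-integrable setT (EFin \o P x).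
Proof.
have := integrable_Rintegral1 (nu := nu) (H := fun p : X * Y => w p.2 * (H (p.2, x) * H (p.2, p.1))) _ intq (iwq x).
apply.
  exact: (measurableT_comp (mH' x) (@measurable_swap _ _ _ _)).
by move=> x' y; rewrite [leRHS]mulrC; exact: bH'.
Qed.

Let E1 x : \int[mu]_x' P x x' = \int[nu]_y (w y * (H (y, x) * A y)).
Proof.
rewrite /P -(Rfubini (mH' x) (iwq x) intq (bH' x)).
apply: eq_Rintegral => y _.
rewrite /A mulrA -(RintegralZl _ measurableT (integrable_slice y)).
by apply: eq_Rintegral => x' _; rewrite /= mulrA.
Qed.

Lemma integrable_weighted_correlation1 :
  mu.-integrable setT (EFin \o (fun x => \int[mu]_x' P x x')).
Proof.
have -> : (fun x => \int[mu]_x' P x x') = (fun x => \int[nu]_y (w y * (H (y, x) * A y))).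
  by apply/funext => x; exact: E1.
have := integrable_Rintegral1 (nu := nu) (H := fun p : X * Y => w p.2 * (H (p.2, p.1) * A p.2)) _ intq iwQ.
apply.
  exact: (measurableT_comp mH'' (@measurable_swap _ _ _ _)).
by move=> x' y; rewrite [leRHS]mulrC; exact: bH''.
Qed.

Lemma integrable_weighted_square : nu.-integrable setT (EFin \o (fun y => w y * A y ^+ 2)).
Proof.
have iQ2 : nu.-integrable setT (EFin \o (fun y => w y * Q ^+ 2)).
  exact: (integrableZr measurableT (Q ^+ 2) iw).
apply: (le_integrable measurableT _ _ iQ2).
  apply: measurable_EFin.
  apply: (measurable_funM mw); apply: measurable_funX; exact: measurable_parametric.
move=> y _ /=; rewrite lee_fin [leLHS]normrM [leRHS]normrM ler_wpM2l//.
rewrite [leLHS]normrX [leRHS]normrX lerXn2r ?nnegrE//.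
by apply: (le_trans (norm_parametric_le y)); exact: ler_norm.
Qed.

(** The two factors [A y] are expanded one after the other, each with an exchange of integrals that
    the integrable weight makes legitimate. *)
Lemma Rintegral_weighted_square :
  \int[nu]_y (w y * A y ^+ 2) = \int[mu]_x \int[mu]_x' P x x'.
Proof.
transitivity (\int[nu]_y \int[mu]_x (w y * (H (y, x) * A y))).
  apply: eq_Rintegral => y _; rewrite expr2 mulrA {2}/A.
  rewrite -(RintegralZl _ measurableT (integrable_slice y)).
  by apply: eq_Rintegral => x _; rewrite -mulrA (mulrC (A y)).
rewrite (Rfubini mH'' iwQ intq bH'').
by apply: eq_Rintegral => x _; rewrite E1.
Qed.

End parametric_integral.

(** Meant for the integrand f(x) f(x') K(x, x'): an abstract kernel offers no bound by a product, so
    the integrability of the slices is assumed directly. *)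
Lemma Rintegral12_integrable d1 d2 (X : measurableType d1) (Y : measurableType d2) (R : realType)
    (mu : {sigma_finite_measure set X -> \bar R}) (nu : {sigma_finite_measure set Y -> \bar R})
    (H : X * Y -> R) :
  (mu \x nu)%E.-integrable setT (EFin \o H) ->
  (forall x, nu.-integrable setT (EFin \o (fun y => H (x, y)))) ->
  \int[mu]_x \int[nu]_y H (x, y) = \int[(mu \x nu)%E]_z H z.
Proof.
move=> iH iH1.
rewrite /Rintegral -(integral12_prod_meas1 iH); congr fine; apply: eq_integral => x _.
rewrite /fubini_F /= fineK//; exact: (integrable_fin_num measurableT (iH1 x)).
Qed.

(** * Plancherel's identity for a weight whose transform is a mollifier *)

Section plancherel.
Context d1 d2 (X : measurableType d1) (Y : measurableType d2) (R : realType).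
Variable mu : {sigma_finite_measure set X -> \bar R}.
Variable nu : {sigma_finite_measure set Y -> \bar R}.
Variables (phi : Y * X -> R) (w : nat -> Y -> R) (K : nat -> X * X -> R) (c : R).
Hypotheses (mphi : measurable_fun setT phi) (GK : all_good mu K) (c0 : 0 < c)
  (w0 : forall k y, 0 <= w k y) (w1 : forall k y, w k y <= 1)
  (iw : forall k, nu.-integrable setT (EFin \o w k))
  (cvgw : forall y, w k y @[k --> \oo] --> (1 : R))
  (wcos : forall k x x',
     \int[nu]_y (w k y * cos (phi (y, x) - phi (y, x'))) = c * K k (x, x'))
  (wsin : forall k x x',
     \int[nu]_y (w k y * sin (phi (y, x) - phi (y, x'))) = 0).

Variables f1 f2 : X -> R.
Hypotheses (if1 : mu.-integrable setT (EFin \o f1)) (if2 : mu.-integrable setT (EFin \o f2)).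
Hypotheses (sf1 : mu.-integrable setT (EFin \o (fun x => f1 x ^+ 2)))
  (sf2 : mu.-integrable setT (EFin \o (fun x => f2 x ^+ 2))).

Let HK : mollifier mu K. Proof. by case: GK. Qed.
Let mf1 : measurable_fun setT f1.
Proof. by apply/measurable_EFinP; case/integrableP: if1. Qed.
Let mf2 : measurable_fun setT f2.
Proof. by apply/measurable_EFinP; case/integrableP: if2. Qed.
Let mw k : measurable_fun setT (w k).
Proof. by apply/measurable_EFinP; case/integrableP: (iw k). Qed.

(* Real and imaginary parts of [exp (- i phi) (f1 + i f2)]. *)
Definition twist_re (p : Y * X) := cos (phi p) * f1 p.2 + sin (phi p) * f2 p.2.
Definition twist_im (p : Y * X) := cos (phi p) * f2 p.2 - sin (phi p) * f1 p.2.

Definition fourier_re y := \int[mu]_x twist_re (y, x).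
Definition fourier_im y := \int[mu]_x twist_im (y, x).

Let mc : measurable_fun setT (fun p => cos (phi p)).
Proof. exact: (measurableT_comp (@measurable_cos R) mphi). Qed.
Let ms : measurable_fun setT (fun p => sin (phi p)).
Proof. exact: (measurableT_comp (@measurable_sin R) mphi). Qed.
Let mf1' : measurable_fun setT (fun p : Y * X => f1 p.2).
Proof. exact: (measurableT_comp mf1 measurable_snd). Qed.
Let mf2' : measurable_fun setT (fun p : Y * X => f2 p.2).
Proof. exact: (measurableT_comp mf2 measurable_snd). Qed.

Lemma measurable_twist_re : measurable_fun setT twist_re.
Proof. by apply: measurable_funD; apply: measurable_funM. Qed.

Lemma measurable_twist_im : measurable_fun setT twist_im.
Proof. by apply: measurable_funB; apply: measurable_funM. Qed.

Let h x := `|f1 x| + `|f2 x|.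

Let ih : mu.-integrable setT (EFin \o h).
Proof.
exact: (integrableD measurableT (integrable_abse if1) (integrable_abse if2)).
Qed.

Let mulle (s a : R) : `|s| <= 1 -> `|s * a| <= `|a|.
Proof. by move=> s1; rewrite normrM ler_piMl. Qed.

Lemma norm_twist_re y x : `|twist_re (y, x)| <= h x.
Proof.
apply: (le_trans (ler_normD _ _)); apply: lerD; apply: mulle.
  exact: cos_max.
exact: sin_max.
Qed.

Lemma norm_twist_im y x : `|twist_im (y, x)| <= h x.
Proof.
apply: (le_trans (ler_normB _ _)); rewrite addrC; apply: lerD; apply: mulle.
  exact: sin_max.
exact: cos_max.
Qed.

Lemma measurable_fourier_re : measurable_fun setT fourier_re.
Proof. exact: (measurable_parametric measurable_twist_re ih norm_twist_re). Qed.

Lemma measurable_fourier_im : measurable_fun setT fourier_im.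
Proof. exact: (measurable_parametric measurable_twist_im ih norm_twist_im). Qed.

Let Q := \int[mu]_x h x.

Lemma norm_fourier_re y : `|fourier_re y| <= Q.
Proof. exact: (norm_parametric_le measurable_twist_re ih norm_twist_re). Qed.

Lemma norm_fourier_im y : `|fourier_im y| <= Q.
Proof. exact: (norm_parametric_le measurable_twist_im ih norm_twist_im). Qed.

Definition spectrum y := fourier_re y ^+ 2 + fourier_im y ^+ 2.

Lemma spectrum_ge0 y : 0 <= spectrum y.
Proof. by rewrite addr_ge0 ?sqr_ge0. Qed.

Lemma measurable_spectrum : measurable_fun setT spectrum.
Proof.
apply: measurable_funD; apply: measurable_funX.
  exact: measurable_fourier_re.
exact: measurable_fourier_im.
Qed.

Let energy := \int[mu]_x (f1 x ^+ 2) + \int[mu]_x (f2 x ^+ 2).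

Let cor (H : Y * X -> R) k x x' := \int[nu]_y (w k y * (H (y, x) * H (y, x'))).

Let iwb k (g : Y -> R) : measurable_fun setT g -> (forall y, `|g y| <= 1) ->
  nu.-integrable setT (EFin \o (fun y => w k y * g y)).
Proof.
move=> mg g1; apply: (le_integrable measurableT _ _ (iw k)).
  apply: measurable_EFin.
  exact: measurable_funM.
by move=> y _ /=; rewrite lee_fin normrM ler_piMr.
Qed.

Let iwh k (H : Y * X -> R) : measurable_fun setT H -> (forall y x, `|H (y, x)| <= h x) ->
  forall x x', nu.-integrable setT (EFin \o (fun y => w k y * (H (y, x) * H (y, x')))).
Proof.
move=> mH Hh x x'.
have i := integrableZr measurableT (h x * h x') (iw k).
apply: (le_integrable measurableT _ _ i).
  apply: measurable_EFin.
  apply: (measurable_funM (mw k)); apply: measurable_funM.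
    exact: (measurableT_comp mH (pair2_measurable x)).
  exact: (measurableT_comp mH (pair2_measurable x')).
move=> y _ /=; rewrite lee_fin [leLHS]normrM [leRHS]normrM ler_wpM2l//.
by rewrite [leLHS]normrM [leRHS]normrM ler_pM// (le_trans (Hh y _))// ler_norm.
Qed.

(** The left side is the weighted integral of the real part of a value times the conjugate of
    another. The phases enter through their difference only, and the antisymmetric part multiplies a
    sine, whose integral is 0. *)
Let corE k x x' : cor twist_re k x x' + cor twist_im k x x' =
  c * (f1 x * f1 x' * K k (x, x') + f2 x * f2 x' * K k (x, x')).
Proof.
rewrite /cor -(RintegralD measurableT (iwh k measurable_twist_re norm_twist_re x x')
  (iwh k measurable_twist_im norm_twist_im x x')).
have md : measurable_fun setT (fun y => phi (y, x) - phi (y, x')).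
  apply: measurable_funB.
    exact: (measurableT_comp mphi (pair2_measurable x)).
  exact: (measurableT_comp mphi (pair2_measurable x')).
have ic : nu.-integrable setT (EFin \o (fun y => w k y * cos (phi (y, x) - phi (y, x')))).
  apply: iwb; first exact: (measurableT_comp (@measurable_cos R) md).
  by move=> y; exact: cos_max.
have is_ : nu.-integrable setT (EFin \o (fun y => w k y * sin (phi (y, x) - phi (y, x')))).
  apply: iwb; first exact: (measurableT_comp (@measurable_sin R) md).
  by move=> y; exact: sin_max.
transitivity (\int[nu]_y ((f1 x * f1 x' + f2 x * f2 x') * (w k y * cos (phi (y, x) - phi (y, x'))) +
    (f2 x * f1 x' - f1 x * f2 x') * (w k y * sin (phi (y, x) - phi (y, x'))))).
  by apply: eq_Rintegral => y _; rewrite /twist_re /twist_im /= cosB sinB; ring.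
rewrite RintegralD//; last 2 first.
- exact: (integrableZl measurableT _ ic).
- exact: (integrableZl measurableT _ is_).
rewrite (RintegralZl _ measurableT ic) (RintegralZl _ measurableT is_) wcos wsin; ring.
Qed.

Lemma plancherel_weighted k :
  \int[nu]_y (w k y * spectrum y) = c * energy -
    c / 2 * (fine (oscillation mu (K k) f1) + fine (oscillation mu (K k) f2)).
Proof.
have ire := integrable_weighted_square measurable_twist_re ih norm_twist_re (iw k).
have iim := integrable_weighted_square measurable_twist_im ih norm_twist_im (iw k).
have jre := integrable_weighted_correlation1 measurable_twist_re ih norm_twist_re (w0 k) (iw k).
have jim := integrable_weighted_correlation1 measurable_twist_im ih norm_twist_im (w0 k) (iw k).
have lre := integrable_weighted_correlation measurable_twist_re ih norm_twist_re (w0 k) (iw k).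
have lim_ := integrable_weighted_correlation measurable_twist_im ih norm_twist_im (w0 k) (iw k).
have k1 := integrable_kernel HK k mf1 sf1.
have k2 := integrable_kernel HK k mf2 sf2.
have kD := integrableD measurableT k1 k2.
pose F (p : X * X) := f1 p.1 * f1 p.2 * K k p + f2 p.1 * f2 p.2 * K k p.
have iF : (mu \x mu)%E.-integrable setT (EFin \o F) by exact: kD.
have E : \int[nu]_y (w k y * spectrum y) = \int[mu]_x \int[mu]_x' (c * F (x, x')).
  transitivity (\int[nu]_y (w k y * fourier_re y ^+ 2 + w k y * fourier_im y ^+ 2)).
    by apply: eq_Rintegral => y _; rewrite /spectrum mulrDr.
  rewrite (RintegralD measurableT ire iim).
  rewrite (Rintegral_weighted_square measurable_twist_re ih norm_twist_re (w0 k) (iw k)).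
  rewrite (Rintegral_weighted_square measurable_twist_im ih norm_twist_im (w0 k) (iw k)).
  rewrite -(RintegralD measurableT jre jim); apply: eq_Rintegral => x _.
  rewrite -(RintegralD measurableT (lre x) (lim_ x)); apply: eq_Rintegral => x' _.
  exact: corE.
(* The slices inherit their integrability from the correlations, to which they are equal by
   [corE]. *)
have iFx x : mu.-integrable setT (EFin \o (fun x' => c * F (x, x'))).
  have -> : (fun x' => c * F (x, x')) = (fun x' => cor twist_re k x x' + cor twist_im k x x').
    by apply/funext => x'; rewrite corE.
  exact: (integrableD measurableT (lre x) (lim_ x)).
have icF : (mu \x mu)%E.-integrable setT (EFin \o (fun p => c * F p)).
  exact: (integrableZl measurableT c iF).
rewrite E (Rintegral12_integrable icF iFx) (RintegralZl _ measurableT iF).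
rewrite (RintegralD measurableT k1 k2).
rewrite (oscillationE HK k mf1 sf1) (oscillationE HK k mf2 sf2) /energy /=.
by field.
Qed.

Let iwS k : nu.-integrable setT (EFin \o (fun y => w k y * spectrum y)).
Proof.
have -> : (fun y => w k y * spectrum y) =
  (fun y => w k y * fourier_re y ^+ 2 + w k y * fourier_im y ^+ 2).
  by apply/funext => y; rewrite /spectrum mulrDr.
exact: (integrableD measurableT
  (integrable_weighted_square measurable_twist_re ih norm_twist_re (iw k))
  (integrable_weighted_square measurable_twist_im ih norm_twist_im (iw k))).
Qed.

Let mES : measurable_fun setT (EFin \o spectrum).
Proof. exact: measurable_EFin measurable_spectrum. Qed.

Let bessel : (\int[nu]_y (spectrum y)%:E <= (c * energy)%:E)%E.
Proof.
pose g k y := (w k y * spectrum y)%:E.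
have mg k : measurable_fun setT (g k) by case/integrableP: (iwS k).
have g0 k y : setT y -> (0 <= g k y)%E by rewrite lee_fin mulr_ge0 ?spectrum_ge0.
have := fatou nu measurableT mg g0.
have -> : (\int[nu]_y limn_einf (g^~ y) = \int[nu]_y (spectrum y)%:E)%E.
  apply: eq_integral => y _.
  have H : (g k y) @[k --> \oo] --> (spectrum y)%:E.
    apply/fine_cvgP; split; first exact: nearW.
    by rewrite -[X in _ --> X]mul1r; apply: cvgM; [exact: cvgw|exact: cvg_cst].
  by rewrite (is_cvg_limn_einfE (cvgP _ H)) (cvg_lim _ H).
move=> /le_trans; apply.
rewrite limn_einf_lim; apply: lime_le; first exact: is_cvg_einfs.
apply: nearW => k; apply: (@le_trans _ _ (\int[nu]_y g k y)%E).
  by apply: ereal_inf_lbound; exists k => /=.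
have -> : (\int[nu]_y g k y = (\int[nu]_y (w k y * spectrum y))%R%:E)%E.
  by rewrite /Rintegral fineK//; exact: (integrable_fin_num measurableT (iwS k)).
rewrite lee_fin plancherel_weighted lerBlDr lerDl mulr_ge0 ?divr_ge0 ?(ltW c0)//.
by rewrite addr_ge0// fine_ge0// oscillation_ge0.
Qed.

(** One inequality is [bessel]. For the other, w k <= 1 makes each weighted integral a lower bound,
    and some [k] makes both oscillations small. *)
Lemma plancherel : (\int[nu]_y (spectrum y)%:E = (c * energy)%:E)%E.
Proof.
apply/eqP; rewrite eq_le bessel/=.
apply/lee_addgt0Pr => e e0.
have [_ GA] := GK.
have oo (f : X -> R) : mu.-integrable setT (EFin \o (fun x => f x ^+ 2)) -> (\int[mu]_x (f x ^+ 2)%:E < +oo)%E.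
  by move=> i; rewrite -ge0_fin_numE ?integral_ge0// => [|x _]; [exact: (integrable_fin_num measurableT i)|rewrite lee_fin sqr_ge0].
have g1 := good_L2 HK GA mf1 (oo _ sf1).
have g2 := good_L2 HK GA mf2 (oo _ sf2).
(* Two oscillations of size e / c cost c / 2 * (e / c + e / c) = e. *)
have ec : 0 < e / c by exact: divr_gt0.
have [k [k1 k2]] := filter_ex (filterI (g1 _ ec) (g2 _ ec)).
have osc_le f : (oscillation mu (K k) f <= (e / c)%:E)%E -> fine (oscillation mu (K k) f) <= e / c.
  move=> H; rewrite -lee_fin fineK// ge0_fin_numE ?(oscillation_ge0 HK)//.
  exact: (le_lt_trans H (ltry _)).
apply: (@le_trans _ _ ((\int[nu]_y (w k y * spectrum y))%R%:E + e%:E)%E).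
  rewrite -EFinD lee_fin plancherel_weighted.
  have := osc_le _ k1; have := osc_le _ k2.
  move: (fine _) (fine _) => a b; rewrite !ler_pdivlMr// => a1 b1.
  by move: (energy) => E; nra.
apply: leeD2r.
have -> : ((\int[nu]_y (w k y * spectrum y))%R%:E = \int[nu]_y (w k y * spectrum y)%:E)%E.
  by rewrite /Rintegral fineK//; exact: (integrable_fin_num measurableT (iwS k)).
apply: ge0_le_integral => //.
- by move=> y _; rewrite lee_fin mulr_ge0 ?spectrum_ge0.
- by case/integrableP: (iwS k).
- by move=> y _; rewrite lee_fin ler_piMl ?spectrum_ge0.
Qed.

End plancherel.

(** * Fourier inversion *)

Section inversion.
Context d (X : measurableType d) (R : realType).
Variable mu : {sigma_finite_measure set X -> \bar R}.
Variables (phi : X * X -> R) (w : nat -> X -> R) (K : nat -> X * X -> R) (c : R).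
Hypotheses (mphi : measurable_fun setT phi) (phiC : forall x y, phi (x, y) = phi (y, x))
  (GK : all_good mu K) (c0 : 0 < c)
  (w0 : forall k y, 0 <= w k y) (w1 : forall k y, w k y <= 1)
  (iw : forall k, mu.-integrable setT (EFin \o w k))
  (cvgw : forall y, w k y @[k --> \oo] --> (1 : R))
  (wcos : forall k x x',
     \int[mu]_y (w k y * cos (phi (y, x) - phi (y, x'))) = c * K k (x, x'))
  (wsin : forall k x x',
     \int[mu]_y (w k y * sin (phi (y, x) - phi (y, x'))) = 0).

Variables f1 f2 : X -> R.
Hypotheses (if1 : mu.-integrable setT (EFin \o f1)) (if2 : mu.-integrable setT (EFin \o f2)).
Hypotheses (sf1 : mu.-integrable setT (EFin \o (fun x => f1 x ^+ 2)))
  (sf2 : mu.-integrable setT (EFin \o (fun x => f2 x ^+ 2))).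

Let mf1 : measurable_fun setT f1.
Proof. by apply/measurable_EFinP; case/integrableP: if1. Qed.
Let mf2 : measurable_fun setT f2.
Proof. by apply/measurable_EFinP; case/integrableP: if2. Qed.

Let A := fourier_re mu phi f1 f2.
Let B := fourier_im mu phi f1 f2.
Let S := spectrum mu phi f1 f2.
Let energy := \int[mu]_x (f1 x ^+ 2) + \int[mu]_x (f2 x ^+ 2).

Let mA : measurable_fun setT A. Proof. exact: measurable_fourier_re. Qed.
Let mB : measurable_fun setT B. Proof. exact: measurable_fourier_im. Qed.
Let mS : measurable_fun setT S. Proof. exact: measurable_spectrum. Qed.

Let ES : (\int[mu]_y (S y)%:E = (c * energy)%:E)%E.
Proof. exact: (plancherel mphi GK c0 w0 w1 iw cvgw wcos wsin if1 if2 sf1 sf2). Qed.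

Lemma integrable_spectrum : mu.-integrable setT (EFin \o S).
Proof.
apply: ge0_integrable => //; first exact: spectrum_ge0.
by rewrite ES ltry.
Qed.

Section cutoff.
Variable D : set X.
Hypotheses (mD : measurable D) (Doo : (mu D < +oo)%E).

Let iD : mu.-integrable setT (EFin \o (\1_D : X -> R)).
Proof.
apply: ge0_integrable; first exact: measurable_indic.
  by move=> x; rewrite indicE.
by rewrite integral_indicT.
Qed.

Let mD1 : measurable_fun setT (\1_D : X -> R).
Proof. exact: measurable_indic. Qed.

Let D1K x : \1_D x * \1_D x = \1_D x :> R.
Proof. by rewrite indicE; case: (_ \in _); rewrite ?mulr1 ?mulr0. Qed.

(** [g1] and [g2] are the parts of the conjugate of the transform cut off to [D]. The inverse
    transform is the conjugate of the forward transform of the conjugate, so [plancherel] applies to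
    it as it stands. *)
Let g1 x := \1_D x * A x.
Let g2 x := - (\1_D x * B x).

Let ibounded (g : X -> R) (M : R) : measurable_fun setT g -> (forall x, `|g x| <= M) ->
  mu.-integrable setT (EFin \o (fun x => \1_D x * g x)).
Proof.
move=> mg gM; have i := integrableZr measurableT M iD.
apply: (le_integrable measurableT _ _ i).
  by apply: measurable_EFin; exact: measurable_funM.
move=> x _ /=; rewrite lee_fin [leLHS]normrM [leRHS]normrM ler_wpM2l//.
by rewrite (le_trans (gM x))// ler_norm.
Qed.

Let M := \int[mu]_x (`|f1 x| + `|f2 x|).
Let bA x : `|A x| <= M. Proof. exact: norm_fourier_re. Qed.
Let bB x : `|B x| <= M. Proof. exact: norm_fourier_im. Qed.

Let ig1 : mu.-integrable setT (EFin \o g1). Proof. exact: ibounded bA. Qed.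
Let ig2 : mu.-integrable setT (EFin \o g2).
Proof.
have := integrableN (ibounded mB bB).
by congr (integrable _ _ _); apply/funext => x /=; rewrite EFinN.
Qed.

Let iDS : mu.-integrable setT (EFin \o (fun x => \1_D x * S x)).
Proof.
apply: (le_integrable measurableT _ _ integrable_spectrum).
  by apply: measurable_EFin; exact: measurable_funM.
move=> x _ /=; rewrite lee_fin normrM ler_piMl//.
by rewrite indicE; case: (_ \in _); rewrite ?normr1 ?normr0 ?ler01.
Qed.

Let isq (g h : X -> R) : measurable_fun setT g -> (forall x, g x ^+ 2 <= h x) ->
  mu.-integrable setT (EFin \o h) -> mu.-integrable setT (EFin \o (fun x => g x ^+ 2)).
Proof.
move=> mg gh ih; apply: (le_integrable measurableT _ _ ih).
  by apply: measurable_EFin; exact: measurable_funX.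
move=> x _ /=; rewrite lee_fin ger0_norm ?sqr_ge0// (le_trans (gh x))//.
exact: ler_norm.
Qed.

Let sg1 : mu.-integrable setT (EFin \o (fun x => g1 x ^+ 2)).
Proof.
apply: isq iDS; first exact: measurable_funM.
move=> x; rewrite /g1 exprMn expr2 D1K /S /spectrum ler_wpM2l ?lerDl ?sqr_ge0//.
Qed.

Let sg2 : mu.-integrable setT (EFin \o (fun x => g2 x ^+ 2)).
Proof.
apply: isq iDS; first by apply: measurable_funN; exact: measurable_funM.
move=> x; rewrite /g2 sqrrN exprMn expr2 D1K /S /spectrum ler_wpM2l ?lerDr ?sqr_ge0//.
Qed.

Definition inverse_re x := fourier_re mu phi g1 g2 x / c.
Definition inverse_im x := - (fourier_im mu phi g1 g2 x / c).

Lemma measurable_inverse_re : measurable_fun setT inverse_re.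
Proof. by apply: measurable_funM => //; exact: measurable_fourier_re. Qed.

Lemma measurable_inverse_im : measurable_fun setT inverse_im.
Proof.
apply: measurable_funN; apply: measurable_funM => //; exact: measurable_fourier_im.
Qed.

Let I := \int[mu]_x (\1_D x * S x).

Let ESg : (\int[mu]_y (spectrum mu phi g1 g2 y)%:E = (c * I)%:E)%E.
Proof.
rewrite (plancherel mphi GK c0 w0 w1 iw cvgw wcos wsin ig1 ig2 sg1 sg2).
rewrite -(RintegralD measurableT sg1 sg2); congr (c * _)%:E; apply: eq_Rintegral => x _.
by rewrite /g1 /g2 sqrrN !exprMn !expr2 D1K -mulrDr.
Qed.

Let iSg : mu.-integrable setT (EFin \o spectrum mu phi g1 g2).
Proof.
apply: ge0_integrable; first exact: measurable_spectrum.
  by move=> x; exact: spectrum_ge0.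
by rewrite ESg ltry.
Qed.

(** The real part of g(x) exp(- i phi(x, y)) f(y). The order of integration decides which of f and g
    is transformed. *)
Let inner (p : X * X) :=
  g1 p.1 * twist_re phi f1 f2 p - g2 p.1 * twist_im phi f1 f2 p.

Let minner : measurable_fun setT inner.
Proof.
have mg1 : measurable_fun setT (fun p : X * X => g1 p.1).
  have m : measurable_fun setT g1 by apply/measurable_EFinP; case/integrableP: ig1.
  exact: (measurableT_comp m measurable_fst).
have mg2 : measurable_fun setT (fun p : X * X => g2 p.1).
  have m : measurable_fun setT g2 by apply/measurable_EFinP; case/integrableP: ig2.
  exact: (measurableT_comp m measurable_fst).
apply: measurable_funB; apply: measurable_funM => //.
  exact: (measurable_twist_re mphi if1 if2).
exact: (measurable_twist_im mphi if1 if2).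
Qed.

Let ihg : mu.-integrable setT (EFin \o (fun x => `|g1 x| + `|g2 x|)).
Proof. exact: (integrableD measurableT (integrable_abse ig1) (integrable_abse ig2)). Qed.
Let ihf : mu.-integrable setT (EFin \o (fun x => `|f1 x| + `|f2 x|)).
Proof. exact: (integrableD measurableT (integrable_abse if1) (integrable_abse if2)). Qed.

Let binner x y : `|inner (x, y)| <= (`|g1 x| + `|g2 x|) * (`|f1 y| + `|f2 y|).
Proof.
apply: (le_trans (ler_normB _ _)); rewrite mulrDl; apply: lerD; rewrite normrM ler_wpM2l//.
  exact: norm_twist_re.
exact: norm_twist_im.
Qed.

Let innerE z : fourier_re mu phi g1 g2 z * f1 z - fourier_im mu phi g1 g2 z * f2 z =
  \int[mu]_x inner (x, z).
Proof.
have mg1 : measurable_fun setT g1 by apply/measurable_EFinP; case/integrableP: ig1.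
have mg2 : measurable_fun setT g2 by apply/measurable_EFinP; case/integrableP: ig2.
have i1 := integrable_slice (measurable_twist_re mphi ig1 ig2) ihg (norm_twist_re phi g1 g2) z.
have i2 := integrable_slice (measurable_twist_im mphi ig1 ig2) ihg (norm_twist_im phi g1 g2) z.
rewrite /fourier_re /fourier_im -(RintegralZr _ measurableT i1) -(RintegralZr _ measurableT i2).
rewrite -(RintegralB measurableT (integrableZr measurableT _ i1) (integrableZr measurableT _ i2)).
apply: eq_Rintegral => x _; rewrite /inner /twist_re /twist_im /= (phiC z x); ring.
Qed.

Let iinner : mu.-integrable setT (EFin \o (fun z =>
  fourier_re mu phi g1 g2 z * f1 z - fourier_im mu phi g1 g2 z * f2 z)).
Proof.
rewrite (_ : (fun z => _) = (fun z => \int[mu]_x inner (x, z))); last first.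
  by apply/funext => z; exact: innerE.
have := integrable_Rintegral1 (nu := mu) (H := fun p : X * X => inner (p.2, p.1)) _ ihf ihg.
apply.
  exact: (measurableT_comp minner (@measurable_swap _ _ _ _)).
by move=> x y; rewrite [leRHS]mulrC; exact: binner.
Qed.

(** Exchanging the integrals moves the transform from g to f; since g is the conjugate of the
    transform of f on [D], the product is its squared modulus there. *)
Let Einner : \int[mu]_z (fourier_re mu phi g1 g2 z * f1 z - fourier_im mu phi g1 g2 z * f2 z) = I.
Proof.
transitivity (\int[mu]_z \int[mu]_x inner (x, z)).
  by apply: eq_Rintegral => z _; exact: innerE.
rewrite -(Rfubini minner ihg ihf binner); apply: eq_Rintegral => x _.
have i1 := integrable_slice (measurable_twist_re mphi if1 if2) ihf (norm_twist_re phi f1 f2) x.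
have i2 := integrable_slice (measurable_twist_im mphi if1 if2) ihf (norm_twist_im phi f1 f2) x.
rewrite /inner /= (RintegralB measurableT (integrableZl measurableT _ i1) (integrableZl measurableT _ i2)).
rewrite (RintegralZl _ measurableT i1) (RintegralZl _ measurableT i2).
rewrite -/(fourier_re mu phi f1 f2 x) -/(fourier_im mu phi f1 f2 x) -/(A x) -/(B x).
rewrite /g1 /g2 /S /spectrum -/(A x) -/(B x); ring.
Qed.

Let err x := (inverse_re x - f1 x) ^+ 2 + (inverse_im x - f2 x) ^+ 2.

Let errE x : err x = c^-1 ^+ 2 * spectrum mu phi g1 g2 x -
  2 / c * (fourier_re mu phi g1 g2 x * f1 x - fourier_im mu phi g1 g2 x * f2 x) +
  (f1 x ^+ 2 + f2 x ^+ 2).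
Proof. by rewrite /err /inverse_re /inverse_im /spectrum; ring. Qed.

Let i1 := integrableZl measurableT (c^-1 ^+ 2) iSg.
Let i2 := integrableZl measurableT (2 / c) iinner.
Let i3 := integrableD measurableT sf1 sf2.

Lemma integrable_inversion_error : mu.-integrable setT (EFin \o err).
Proof.
have := integrableD measurableT (integrableB measurableT i1 i2) i3.
by congr (integrable _ _ _); apply/funext => x /=; rewrite errE.
Qed.

(** The square of the inverse contributes c^-2 * (c * I) by [ESg] and the cross term - 2 / c * I,
    which add up to - I / c. *)
Lemma Rintegral_inversion_error : \int[mu]_x err x = energy - I / c.
Proof.
transitivity (\int[mu]_x (c^-1 ^+ 2 * spectrum mu phi g1 g2 x -
  2 / c * (fourier_re mu phi g1 g2 x * f1 x - fourier_im mu phi g1 g2 x * f2 x) +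
  (f1 x ^+ 2 + f2 x ^+ 2))).
  by apply: eq_Rintegral => x _; exact: errE.
rewrite (RintegralD measurableT (integrableB measurableT i1 i2) i3).
rewrite (RintegralB measurableT i1 i2) (RintegralZl _ measurableT iSg).
rewrite (RintegralZl _ measurableT iinner) Einner (RintegralD measurableT sf1 sf2).
rewrite [in X in X - _ + _]/Rintegral ESg /= -/energy.
by field; rewrite gt_eqF.
Qed.

Lemma integrable_inverse_re : mu.-integrable setT (EFin \o (fun x => inverse_re x ^+ 2)).
Proof.
apply: isq i1; first exact: measurable_inverse_re.
by move=> x; rewrite /inverse_re /spectrum exprMn mulrC ler_wpM2l ?sqr_ge0// lerDl sqr_ge0.
Qed.

Lemma integrable_inverse_im : mu.-integrable setT (EFin \o (fun x => inverse_im x ^+ 2)).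
Proof.
apply: isq i1; first exact: measurable_inverse_im.
by move=> x; rewrite /inverse_im sqrrN /spectrum exprMn mulrC ler_wpM2l ?sqr_ge0// lerDr sqr_ge0.
Qed.

End cutoff.

(** Dominated convergence gives the limit of [I] along the integers. As [I] is nondecreasing and
    bounded by its limit, one good integer controls every larger real [r]. *)
Lemma cvg_inversion_error (D : R -> set X) :
  (forall r, measurable (D r)) -> (forall r, (mu (D r) < +oo)%E) ->
  {homo D : r s / r <= s >-> r `<=` s} -> (forall x, exists k : nat, D k%:R x) ->
  \int[mu]_x ((inverse_re (D r) x - f1 x) ^+ 2 + (inverse_im (D r) x - f2 x) ^+ 2)
    @[r --> +oo] --> (0 : R).
Proof.
move=> mD Doo ndD DT.
pose I r := \int[mu]_x (\1_(D r) x * S x).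
have S0 x : 0 <= S x by exact: spectrum_ge0.
have mI r : measurable_fun setT (fun x => (\1_(D r) x * S x)%:E).
  apply: measurable_EFin.
  by apply: measurable_funM => //; exact: measurable_indic.
have IE r : (\int[mu]_x (\1_(D r) x * S x)%:E = (I r)%:E)%E.
  rewrite /I /Rintegral fineK// ge0_fin_numE ?integral_ge0// => [|x _]; last by rewrite lee_fin mulr_ge0.
  apply: le_lt_trans (ltry (c * energy)); rewrite -ES; apply: ge0_le_integral => //.
  - by move=> x _; rewrite lee_fin mulr_ge0.
  - exact: measurable_EFin mS.
  - by move=> x _; rewrite lee_fin ler_piMl.
have ndI r s : r <= s -> I r <= I s.
  move=> rs; rewrite -lee_fin -!IE; apply: ge0_le_integral => //.
  - by move=> x _; rewrite lee_fin mulr_ge0.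
  - move=> x _; rewrite lee_fin ler_wpM2r// !indicE ler_nat.
    by case: (boolP (x \in D r)) => //; rewrite inE => /(ndD _ _ rs) => Dx; rewrite mem_set.
have II r : I r <= c * energy.
  rewrite -lee_fin -IE -ES; apply: ge0_le_integral => //.
  - by move=> x _; rewrite lee_fin mulr_ge0.
  - exact: measurable_EFin mS.
  - by move=> x _; rewrite lee_fin ler_piMl.
have H x : (\1_(D k%:R) x * S x)%:E @[k --> \oo] --> (S x)%:E.
  have [k Dk] := DT x.
  apply: cvg_near_cst; near=> m.
  rewrite indicE mem_set ?mul1r//; apply: (ndD k%:R) => //; rewrite ler_nat.
  by near: m; exact: nbhs_infty_ge.
have cvgI : I k%:R @[k --> \oo] --> c * energy.
  have [| | | | |_ _] := @dominated_convergence _ X R mu setT measurableT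
      (fun k x => (\1_(D k%:R) x * S x)%:E) (EFin \o S) (EFin \o S).
  - by move=> k; exact: mI.
  - exact: measurable_EFin mS.
  - by apply: aeW => x _; exact: H.
  - exact: integrable_spectrum.
  - by apply: aeW => x k _ /=; rewrite lee_fin ger0_norm ?mulr_ge0// ler_piMl.
  rewrite /= ES => /fine_cvgP[_]; apply: cvg_trans.
  by apply: near_eq_cvg; apply: nearW => k /=; rewrite IE.
apply/cvgrPdist_le => e e0.
have [k Hk] : exists k : nat, c * energy - I k%:R <= c * e.
  have /cvgrPdist_le/(_ _ (mulr_gt0 c0 e0)) := cvgI.
  by move=> /filter_ex[k]; rewrite ger0_norm ?subr_ge0// => Hk; exists k.
near=> r.
rewrite sub0r normrN Rintegral_inversion_error// -/(I r).
have -> : energy - I r / c = (c * energy - I r) / c by field; rewrite gt_eqF.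
rewrite ger0_norm ?divr_ge0 ?subr_ge0// ?(ltW c0)// ler_pdivrMr// [leRHS]mulrC.
apply: le_trans Hk; rewrite lerB// ndI//.
Unshelve. all: by end_near.
Qed.

End inversion.

(** * Fourier inversion on row vectors *)

Section fourier_rV.
Context {R : realType} (n : nat).
Local Notation leb := (@lebesgue_measure R).
Local Notation T := (measurableTypeR R).
Local Notation V := 'rV[R]_n.

Definition phase (p : V * V) : R := dot p.1 p.2.

Lemma dotC (K : comNzRingType) m (a b : 'rV[K]_m) : dot a b = dot b a.
Proof. by apply: eq_bigr => j _; rewrite mulrC. Qed.

Lemma dotBl (K : comNzRingType) m (a b v : 'rV[K]_m) : dot (a - b) v = dot a v - dot b v.
Proof. by rewrite /dot -sumrB; apply: eq_bigr => j _; rewrite !mxE mulrBl. Qed.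

Lemma measurable_phase : measurable_fun setT phase.
Proof.
apply: measurable_sum => j _; apply: measurable_funM.
  exact: (measurableT_comp (@measurable_coord R n j) measurable_fst).
exact: (measurableT_comp (@measurable_coord R n j) measurable_snd).
exact: measurableT.
Qed.

Let c : R := (2 * pi) ^+ n.
Let c0 : 0 < c. Proof. by rewrite exprn_gt0// mulr_gt0// pi_gt0. Qed.

Let wcos k (x x' : V) :
  \int[lebesgue_rV n]_y (weight_rV k y * cos (phase (y, x) - phase (y, x'))) =
  c * poisson_rV k (x, x').
Proof.
have [H _] := Rintegral_weight_rV k (x - x').
rewrite /c /poisson_rV /=; under [in RHS]eq_bigr => j _.
  have -> : x 0 j - x' 0 j = (x - x') 0 j by rewrite !mxE.
  over.
rewrite -H; apply: eq_Rintegral => y _.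
by rewrite /phase /= dotBl !(dotC y).
Qed.

Let wsin k (x x' : V) :
  \int[lebesgue_rV n]_y (weight_rV k y * sin (phase (y, x) - phase (y, x'))) = 0.
Proof.
have [_ H] := Rintegral_weight_rV k (x - x').
rewrite -[RHS]H; apply: eq_Rintegral => y _.
by rewrite /phase /= dotBl !(dotC y).
Qed.

Let phaseC x y : phase (x, y) = phase (y, x). Proof. exact: dotC. Qed.

Variables f1 f2 : V -> R.
Hypotheses (if1 : (lebesgue_rV n).-integrable setT (EFin \o f1))
  (if2 : (lebesgue_rV n).-integrable setT (EFin \o f2))
  (sf1 : (lebesgue_rV n).-integrable setT (EFin \o (fun x => f1 x ^+ 2)))
  (sf2 : (lebesgue_rV n).-integrable setT (EFin \o (fun x => f2 x ^+ 2))).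

Let T1 := inverse_re (lebesgue_rV n) phase c f1 f2.
Let T2 := inverse_im (lebesgue_rV n) phase c f1 f2.

Lemma integrable_fourier_inversion (D : set V) :
  measurable D -> (lebesgue_rV n D < +oo)%E ->
  [/\ measurable_fun setT (T1 D), measurable_fun setT (T2 D),
    (lebesgue_rV n).-integrable setT (EFin \o (fun x => T1 D x ^+ 2)),
    (lebesgue_rV n).-integrable setT (EFin \o (fun x => T2 D x ^+ 2)) &
    (lebesgue_rV n).-integrable setT
      (EFin \o (fun x => (T1 D x - f1 x) ^+ 2 + (T2 D x - f2 x) ^+ 2))].
Proof.
move=> mD Doo; split.
- exact: (measurable_inverse_re c measurable_phase if1 if2 mD Doo).
- exact: (measurable_inverse_im c measurable_phase if1 if2 mD Doo).
- exact: (integrable_inverse_re measurable_phase (all_good_poisson_rV n) c0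
    (@weight_rV_ge0 R n) (@weight_rV_le1 R n) (@integrable_weight_rV R n)
    (@cvg_weight_rV R n) wcos wsin if1 if2 sf1 sf2 mD Doo).
- exact: (integrable_inverse_im measurable_phase (all_good_poisson_rV n) c0
    (@weight_rV_ge0 R n) (@weight_rV_le1 R n) (@integrable_weight_rV R n)
    (@cvg_weight_rV R n) wcos wsin if1 if2 sf1 sf2 mD Doo).
- exact: (integrable_inversion_error measurable_phase phaseC (all_good_poisson_rV n) c0
    (@weight_rV_ge0 R n) (@weight_rV_le1 R n) (@integrable_weight_rV R n)
    (@cvg_weight_rV R n) wcos wsin if1 if2 sf1 sf2 mD Doo).
Qed.

Lemma cvg_fourier_inversion (D : R -> set V) :
  (forall r, measurable (D r)) -> (forall r, (lebesgue_rV n (D r) < +oo)%E) ->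
  {homo D : r s / r <= s >-> r `<=` s} -> (forall x, exists k : nat, D k%:R x) ->
  \int[lebesgue_rV n]_x ((T1 (D r) x - f1 x) ^+ 2 + (T2 (D r) x - f2 x) ^+ 2)
    @[r --> +oo] --> (0 : R).
Proof.
exact: (cvg_inversion_error measurable_phase phaseC (all_good_poisson_rV n) c0
    (@weight_rV_ge0 R n) (@weight_rV_le1 R n) (@integrable_weight_rV R n)
    (@cvg_weight_rV R n) wcos wsin if1 if2 sf1 sf2).
Qed.

End fourier_rV.

(** * Integration over disks *)

Section ball_rV.
Context {R : realType}.
Local Notation leb := (@lebesgue_measure R).

Let mstrip (M : R) m (j : 'I_m) : measurable [set x : 'rV[R]_m | `|x 0 j| <= M].
Proof.
have -> : [set x : 'rV[R]_m | `|x 0 j| <= M] =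
    setT `&` (fun x : 'rV[R]_m => x 0 j : measurableTypeR R) @^-1` `[- M, M]%classic.
  by rewrite setTI; apply/seteqP; split => x /=; rewrite in_itv/= ler_norml.
exact: (measurable_coord j).
Qed.

Lemma measurable_rV_box (M : R) m : measurable [set x : 'rV[R]_m | forall j, `|x 0 j| <= M].
Proof.
have -> : [set x : 'rV[R]_m | forall j, `|x 0 j| <= M] =
    \bigcap_(j in [set: 'I_m]) [set x | `|x 0 j| <= M].
  by apply/seteqP; split => x /= H j; [move=> _; exact: H|exact: H].
by apply: fin_bigcap_measurable => [|j _]; [exact: finite_finset|exact: mstrip].
Qed.

Lemma lebesgue_rV_box_lty n (M : R) :
  (lebesgue_rV n [set x : 'rV[R]_n | forall j, `|x 0 j| <= M]%R < +oo)%E.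
Proof.
elim: n => [|n IH].
  by rewrite /= diracE ltry.
have -> : lebesgue_rV n.+1 [set x : 'rV[R]_n.+1 | forall j, `|x 0 j| <= M] =
    (leb \x lebesgue_rV n)%E (`[- M, M]%classic `*` [set x : 'rV[R]_n | forall j, `|x 0 j| <= M]).
  rewrite /= /lebesgue_rV_step /pushforward; congr (_ _).
  apply/seteqP; split => -[a v] /= H.
    split; first by have := H (@lshift 1 n 0); rewrite rV_consl in_itv/= ler_norml.
    by move=> j; have := H (rshift 1 j); rewrite rV_consr.
  move=> j; have [k ->|k ->] := @split_ordP 1 n j.
    by rewrite rV_consl; case: H; rewrite in_itv/= -ler_norml.
  by rewrite rV_consr; case: H => _; exact.
rewrite product_measure1E//; last exact: measurable_rV_box.
rewrite lte_mul_pinfty ?measure_ge0//.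
  by rewrite /= lebesgue_measure_itv /=; case: ifP => _; rewrite ?ltry// -EFinB ltry.
Qed.

(** The open Euclidean ball. The condition [0 < rho] empties it for negative radii, where [rho ^+ 2]
    would be misleading, so that the family increases with [rho]. *)
Definition disk n (rho : R) : set 'rV[R]_n := [set x | 0 < rho /\ dot x x < rho ^+ 2].

Lemma measurable_disk n rho : measurable (@disk n rho).
Proof.
have [r0|r0] := ltP 0 rho; last first.
  by rewrite (_ : disk _ = set0)//; apply/seteqP; split => x // -[]; rewrite ltNge r0.
have -> : @disk n rho = setT `&` (fun x : 'rV[R]_n => dot x x) @^-1` `]-oo, rho ^+ 2[%classic.
  by rewrite setTI; apply/seteqP; split => x /=; rewrite in_itv/=; [case|].
have mdot : measurable_fun setT (fun x : 'rV[R]_n => dot x x : measurableTypeR R).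
  apply: measurable_sum => j _.
  exact: (measurable_funM (measurable_coord j) (measurable_coord j)).
exact: mdot.
Qed.

Lemma disk_lty n rho : (lebesgue_rV n (disk rho) < +oo)%E.
Proof.
apply: le_lt_trans (lebesgue_rV_box_lty n rho).
apply: le_measure; rewrite ?inE; [exact: measurable_disk|exact: measurable_rV_box|].
move=> x [r0 xr] j /=.
rewrite -ler_sqr ?nnegrE ?(ltW r0)// real_normK ?num_real//.
apply: (le_trans _ (ltW xr)); rewrite /dot (bigD1 j)//= expr2 lerDl sumr_ge0// => i _.
by rewrite -expr2 sqr_ge0.
Qed.

Lemma subset_disk n r s : r <= s -> @disk n r `<=` disk s.
Proof.
move=> rs x [r0 xr]; split; first exact: lt_le_trans rs.
by apply: (lt_le_trans xr); rewrite lerXn2r ?nnegrE ?(ltW r0)// (le_trans (ltW r0)).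
Qed.

Lemma disk_cover n (s : R) (x : 'rV[R]_n) : 0 < s -> exists k : nat, disk (k%:R / s) x.
Proof.
(* With d = |x|^2, every radius above d + 1 works, since (d + 1)^2 > d. *)
move=> s0; pose k := (Num.truncn ((dot x x + 1) * s)).+1.
have d0 : 0 <= dot x x by apply: sumr_ge0 => j _; rewrite -expr2 sqr_ge0.
have k1 : dot x x + 1 < k%:R / s.
  by rewrite ltr_pdivlMr//; exact: truncnS_gt.
exists k; split; first by apply: lt_trans k1; lra.
apply: lt_trans (_ : (dot x x + 1) ^+ 2 < _); first nra.
move: k1; move: (_ / s) => y k1; rewrite !expr2.
by nra.
Qed.

End ball_rV.

Lemma Rintegral_indicM d (T : measurableType d) (R : realType)
    (mu : {measure set T -> \bar R}) (D : set T) (h : T -> R) :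
  \int[mu]_(x in D) h x = \int[mu]_x (\1_D x * h x).
Proof.
rewrite Rintegral_mkcond; apply: eq_Rintegral => x _.
by rewrite patchE indicE; case: (x \in _); rewrite ?mul1r ?mul0r.
Qed.

(** * Bounded measurable functions *)

Section bounded_measurable.
Context d (T : measurableType d) (R : realType).

(** On sets of finite measure, real integrals over this class are finite and additive, and the class
    is stable under partial integration. *)
Definition bounded_measurable (f : T -> R) :=
  measurable_fun setT f /\ exists M, forall x, `|f x| <= M.

Lemma bounded_measurable_cst a : bounded_measurable (fun=> a).
Proof. by split; [exact: measurable_cst|exists `|a|]. Qed.

Lemma bounded_measurableD f g : bounded_measurable f -> bounded_measurable g ->
  bounded_measurable (fun x => f x + g x).
Proof.
move=> [mf [M fM]] [mg [N gN]]; split; first exact: measurable_funD.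
by exists (M + N) => x; apply: (le_trans (ler_normD _ _)); exact: lerD.
Qed.

Lemma bounded_measurableM f g : bounded_measurable f -> bounded_measurable g ->
  bounded_measurable (fun x => f x * g x).
Proof.
move=> [mf [M fM]] [mg [N gN]]; split; first exact: measurable_funM.
by exists (M * N) => x; rewrite normrM; exact: ler_pM.
Qed.

Lemma bounded_measurableN f : bounded_measurable f -> bounded_measurable (fun x => - f x).
Proof.
move=> [mf [M fM]]; split; first exact: measurable_funN.
by exists M => x; rewrite normrN.
Qed.

Variables (mu : {sigma_finite_measure set T -> \bar R}) (D : set T).
Hypotheses (mD : measurable D) (Doo : (mu D < +oo)%E).

Lemma integrable_bounded_measurable f : bounded_measurable f -> mu.-integrable D (EFin \o f).
Proof.
move=> [mf [M fM]].
have i : mu.-integrable D (EFin \o (fun=> M)).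
  apply/integrableP; split; first exact: measurable_cst.
  by rewrite integral_cst// lte_mul_pinfty.
apply: (le_integrable mD _ _ i).
  by apply: measurable_EFin; exact: measurable_funTS.
by move=> x _ /=; rewrite lee_fin (le_trans (fM x))// ler_norm.
Qed.

Lemma EFin_Rintegral f : bounded_measurable f ->
  ((\int[mu]_(x in D) f x)%R%:E = \int[mu]_(x in D) (f x)%:E)%E.
Proof.
move=> bf; rewrite /Rintegral fineK//.
exact: (integrable_fin_num mD (integrable_bounded_measurable bf)).
Qed.

Lemma Rintegral_boundedD f g : bounded_measurable f -> bounded_measurable g ->
  \int[mu]_(x in D) (f x + g x) = \int[mu]_(x in D) f x + \int[mu]_(x in D) g x.
Proof.
by move=> bf bg; rewrite RintegralD//; exact: integrable_bounded_measurable.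
Qed.

End bounded_measurable.

Lemma bounded_measurable_comp d1 d2 (S : measurableType d1) (T : measurableType d2) (R : realType)
    (p : S -> T) (f : T -> R) :
  measurable_fun setT p -> bounded_measurable f -> bounded_measurable (f \o p).
Proof.
move=> mp [mf [M fM]]; split; last by exists M => x; exact: fM.
exact: (measurableT_comp mf mp).
Qed.

Lemma bounded_measurable_parametric d1 d2 (X : measurableType d1) (Y : measurableType d2)
    (R : realType) (mu : {sigma_finite_measure set X -> \bar R}) (D : set X) (H : Y * X -> R) :
  measurable D -> (mu D < +oo)%E -> bounded_measurable H ->
  bounded_measurable (fun y => \int[mu]_(x in D) H (y, x)).
Proof.
move=> mD Doo [mH [M HM]].
have E y : \int[mu]_(x in D) H (y, x) = \int[mu]_x (\1_D x * H (y, x)).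
  exact: Rintegral_indicM.
pose q x : R := \1_D x * M.
have iq : mu.-integrable setT (EFin \o q).
  have i : mu.-integrable setT (EFin \o (\1_D : X -> R)).
    by apply: ge0_integrable => //; rewrite integral_indicT.
  exact: (integrableZr measurableT M i).
have mH' : measurable_fun setT (fun p : Y * X => \1_D p.2 * H p).
  apply: measurable_funM => //.
  exact: (measurableT_comp (measurable_indic mD) measurable_snd).
have Hq y x : `|\1_D (y, x).2 * H (y, x)| <= q x.
  by rewrite normrM ger0_norm// ler_wpM2l.
split.
  rewrite (_ : (fun y => _) = (fun y => \int[mu]_x (\1_D x * H (y, x)))); last exact/funext.
  exact: (measurable_parametric mH' iq Hq).
by exists (\int[mu]_x q x) => y; rewrite E; exact: (norm_parametric_le mH' iq Hq).
Qed.

(* Decompose [g] as the difference of the nonnegative [g + M] and [M]. *)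
Lemma eq_functional_bounded d (T : measurableType d) (R : realType) (P Q : (T -> R) -> R) :
  (forall f g, bounded_measurable f -> bounded_measurable g ->
     P (fun x => f x + g x) = P f + P g) ->
  (forall f g, bounded_measurable f -> bounded_measurable g ->
     Q (fun x => f x + g x) = Q f + Q g) ->
  (forall f, bounded_measurable f -> (forall x, 0 <= f x) -> P f = Q f) ->
  forall f, bounded_measurable f -> P f = Q f.
Proof.
move=> PD QD PQ f bf; have [_ [M fM]] := bf.
have bM := bounded_measurable_cst T `|M|.
apply: (addIr (P (fun=> `|M|))); rewrite -PD// [in RHS]PQ// -QD//.
apply: PQ; first exact: bounded_measurableD.
move=> x; have := fM x; rewrite ler_norml => /andP[+ _].
by rewrite -lerBlDr sub0r; apply: le_trans; rewrite lerN2 ler_norm.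
Qed.

(** * Balls in polar coordinates *)

Section disk_polar.
Context {R : realType}.
Local Notation leb := (@lebesgue_measure R).
Local Notation T := (measurableTypeR R).
Variables (r s : R).
Hypothesis s0 : 0 < s.

Lemma dotZZ n (a : R) (p : 'rV[R]_n) : dot (a *: p) (a *: p) = a ^+ 2 * dot p p.
Proof. by rewrite /dot mulr_sumr; apply: eq_bigr => j _; rewrite !mxE; ring. Qed.

Lemma dot_circle_pt (t : R) : dot (circle_pt t) (circle_pt t) = 1.
Proof. by rewrite /dot !big_ord_recl big_ord0 !mxE/= addr0 -!expr2 cos2Dsin2. Qed.

Lemma dot_sphere_pt (t phi : R) : dot (sphere_pt t phi) (sphere_pt t phi) = 1.
Proof.
rewrite /dot !big_ord_recl big_ord0 !mxE/= addr0.
transitivity (sin t ^+ 2 * (cos phi ^+ 2 + sin phi ^+ 2) + cos t ^+ 2); first ring.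
by rewrite cos2Dsin2 mulr1 addrC cos2Dsin2.
Qed.

Lemma measurable_scale d (S : measurableType d) n (a : S -> T) (p : S -> 'rV[R]_n) :
  measurable_fun setT a -> measurable_fun setT p ->
  measurable_fun setT (fun x => a x *: p x).
Proof.
move=> ma mp; apply: measurable_fun_rV => j.
rewrite (_ : (fun x => _) = (fun x => a x * p x 0 j)); last first.
  by apply/funext => x; rewrite mxE.
by apply: measurable_funM => //; exact: (measurableT_comp (measurable_coord j) mp).
Qed.

Let mdisk n : measurable_fun setT (\1_(disk (r / s)%R) : 'rV[R]_n -> R).
Proof. by apply: measurable_indic; exact: measurable_disk. Qed.

(** The substitution rho = omega / s turns the radius r / s into the bound omega < r. The powers of
    rho give s^m in the denominator, and the Jacobian gives one more s. *)
Lemma ge0_radial n (p : 'rV[R]_n) m (G : 'rV[R]_n -> \bar R) : dot p p = 1 ->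
  measurable_fun setT G -> (forall v, (0 <= G v)%E) ->
  (\int[leb]_(rho in `]0%R, +oo[) ((\1_(disk (r / s)%R) (rho *: p) : R)%:E * G (rho *: p) * (rho ^+ m)%:E) =
   \int[leb]_(omega in `]0%R, r[) (G ((omega / s)%R *: p) * (omega ^+ m / s ^+ m.+1)%:E))%E.
Proof.
move=> p1 mG G0.
rewrite integral_mkcond [RHS]integral_mkcond.
set h := (h in (\int[_]_x h x = _)%E).
have mh : measurable_fun setT h.
  apply/(measurable_restrictT _ _).1 => //; apply: measurable_funTS.
  have msp : measurable_fun setT (fun rho : T => rho *: p).
    by apply: measurable_scale; [exact: measurable_id|exact: measurable_cst].
  apply: emeasurable_funM; first apply: emeasurable_funM.
  - apply: measurable_EFin.
    exact: (measurableT_comp (@mdisk n) msp).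
  - exact: (measurableT_comp mG msp).
  - apply: measurable_EFin.
    by apply: measurable_funX; exact: measurable_id.
have h0 x : (0 <= h x)%E.
  rewrite /h patchE; case: ifPn => //; rewrite inE/= in_itv/= andbT => x0.
  by rewrite !mule_ge0// lee_fin ?exprn_ge0// ltW.
rewrite (@ge0_integral_affine _ h s^-1 0) ?invr_eq0 ?gt_eqF//.
apply: eq_integral => x _; rewrite /h !patchE addr0 (mulrC s^-1).
have [x0|x0] := ltP 0 x; last first.
  rewrite !memNset ?mul0e//=; rewrite in_itv/= ?andbT; first by rewrite ltNge x0.
  by apply/negP; rewrite -leNgt pmulr_lle0 ?invr_gt0.
rewrite mem_set/= ?in_itv/= ?divr_gt0//.
have -> : \1_(disk (r / s)%R) ((x / s) *: p) = (x < r)%R%:R :> R.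
  rewrite indicE; congr (nat_of_bool _)%:R; apply/idP/idP; rewrite inE /disk/= dotZZ p1 mulr1.
    case=> rs; rewrite ltr_pXn2r ?nnegrE ?(ltW rs) ?(ltW (divr_gt0 x0 s0))//.
    by rewrite ltr_pM2r ?invr_gt0.
  move=> xr; rewrite divr_gt0 ?(lt_trans x0 xr)//; split => //.
  by rewrite ltr_pXn2r ?nnegrE ?divr_ge0 ?(ltW s0) ?(ltW x0) ?(ltW (lt_trans x0 xr))// ltr_pM2r ?invr_gt0.
have [xr|xr] := boolP (x < r); last first.
  by rewrite !mul0e memNset//= in_itv/= (negbTE xr) andbF.
rewrite mul1e mem_set/= ?in_itv/= ?x0 ?xr// -muleA -EFinM; congr (_ * _%:E)%E.
rewrite gtr0_norm ?invr_gt0// expr_div_n -mulrA; congr (_ * _).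
by rewrite -invfM -exprSr.
Qed.

Lemma ge0_integral_disk2 (G : 'rV[R]_2 -> \bar R) :
  measurable_fun setT G -> (forall v, (0 <= G v)%E) ->
  (\int[lebesgue_rV 2]_v ((\1_(disk (r / s)%R) v : R)%:E * G v) =
   \int[leb]_(t in `[0%R, (2 * pi)%R]) \int[leb]_(omega in `]0%R, r[)
     (G ((omega / s)%R *: circle_pt t) * (omega ^+ 1 / s ^+ 2)%:E))%E.
Proof.
move=> mG G0; rewrite ge0_integral_rV2_polar; last 2 first.
- apply: emeasurable_funM => //; apply: measurable_EFin.
  exact: (@mdisk 2).
- by move=> v; rewrite mule_ge0// lee_fin.
apply: eq_integral => t _.
by rewrite -(ge0_radial 1 (dot_circle_pt t) mG G0).
Qed.

Lemma ge0_integral_disk3 (G : 'rV[R]_3 -> \bar R) :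
  measurable_fun setT G -> (forall v, (0 <= G v)%E) ->
  (\int[lebesgue_rV 3]_v ((\1_(disk (r / s)%R) v : R)%:E * G v) =
   \int[leb]_(phi in `[0%R, (2 * pi)%R]) \int[leb]_(t in `[0%R, pi])
     ((sin t)%:E * \int[leb]_(omega in `]0%R, r[)
     (G ((omega / s)%R *: sphere_pt t phi) * (omega ^+ 2 / s ^+ 3)%:E)))%E.
Proof.
move=> mG G0; rewrite ge0_integral_rV3_polar; last 2 first.
- apply: emeasurable_funM => //; apply: measurable_EFin.
  exact: (@mdisk 3).
- by move=> v; rewrite mule_ge0// lee_fin.
apply: eq_integral => phi _; apply: eq_integral => t.
rewrite inE/= in_itv/= => tpi.
have st : 0 <= sin t by exact: sin_ge0_pi.
rewrite -(ge0_radial 2 (dot_sphere_pt t phi) mG G0) -ge0_integralZl//.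
- by apply: eq_integral => x _; rewrite EFinM muleA muleC.
- apply: measurable_funTS.
  have msp : measurable_fun setT (fun rho : T => rho *: sphere_pt t phi).
    by apply: measurable_scale; [exact: measurable_id|exact: measurable_cst].
  apply: emeasurable_funM; first apply: emeasurable_funM.
  - apply: measurable_EFin.
    exact: (measurableT_comp (@mdisk 3) msp).
  - exact: (measurableT_comp mG msp).
  - apply: measurable_EFin.
    by apply: measurable_funX; exact: measurable_id.
- by move=> x _; rewrite !mule_ge0// lee_fin sqr_ge0.
Qed.

End disk_polar.

Section Rintegral_disk.
Context {R : realType}.
Local Notation leb := (@lebesgue_measure R).
Local Notation T := (measurableTypeR R).
Variables (r s : R).
Hypothesis s0 : 0 < s.

(** The indicator keeps the density bounded on the whole line, as [bounded_measurable] requires. *)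
Let dens m (omega : R) : R := \1_(`]0, r[%classic) omega * (omega ^+ m / s ^+ m.+1).

Let mitv (a b : R) b1 b2 : measurable ([set` Interval (BSide b1 a) (BSide b2 b)] : set T).
Proof. exact: measurable_itv. Qed.

Let itv_lty (a b : R) b1 b2 :
  (leb ([set` Interval (BSide b1 a) (BSide b2 b)] : set T) < +oo)%E.
Proof. by rewrite /= lebesgue_measure_itv /=; case: ifP => _; rewrite ?ltry// -EFinB ltry. Qed.

Let bdens m : bounded_measurable (dens m : T -> R).
Proof.
split.
  apply: measurable_funM; first exact: measurable_indic.
  apply: measurable_funM; last exact: measurable_cst.
  by apply: measurable_funX; exact: measurable_id.
exists (`|r| ^+ m / s ^+ m.+1) => x; rewrite /dens indicE.
case: (boolP (x \in _)); last by rewrite mul0r normr0 divr_ge0// exprn_ge0// ltW.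
rewrite inE/= in_itv/= => /andP[x0 xr]; rewrite mul1r ger0_norm; last first.
  by rewrite divr_ge0 ?exprn_ge0 ?ltW.
rewrite ler_wpM2r ?invr_ge0 ?exprn_ge0 ?(ltW s0)// lerXn2r ?nnegrE ?(ltW x0)//.
by rewrite (le_trans (ltW xr))// ler_norm.
Qed.

Let densE m (F : R -> R) :
  \int[leb]_(omega in `]0, r[) (F omega * (omega ^+ m / s ^+ m.+1)) =
  \int[leb]_(omega in `]0, r[) (F omega * dens m omega).
Proof. by apply: eq_Rintegral => x xr; rewrite /dens indicE xr mul1r. Qed.

Lemma measurable_circle_pt : measurable_fun setT (@circle_pt R : T -> _).
Proof.
rewrite (_ : circle_pt = fun t => vec2 (cos t) (sin t)); last first.
  by apply/funext => t; rewrite vec2E.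
by apply: measurable_vec2; [exact: measurable_cos|exact: measurable_sin].
Qed.

Lemma measurable_sphere_pt :
  measurable_fun setT (fun p : T * T => sphere_pt (p.2 : R) (p.1 : R)).
Proof.
rewrite (_ : (fun p => _) = fun p : T * T =>
    vec3 (sin p.2 * cos p.1) (sin p.2 * sin p.1) (cos p.2)); last first.
  by apply/funext => t; rewrite vec3E.
have m1 := measurableT_comp (@measurable_sin R) (@measurable_snd _ _ T T).
have m2 := measurableT_comp (@measurable_sin R) (@measurable_fst _ _ T T).
have m3 := measurableT_comp (@measurable_cos R) (@measurable_snd _ _ T T).
have m4 := measurableT_comp (@measurable_cos R) (@measurable_fst _ _ T T).
exact: (measurable_vec3 (measurable_funM m1 m4) (measurable_funM m1 m2) m3).
Qed.

Section inner.
Context d (Y : measurableType d) (n m : nat).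
Variable p : Y -> 'rV[R]_n.
Hypothesis mp : measurable_fun setT p.

(** [Y] is the space of angles: one angle for the circle, a pair for the sphere. *)
Definition inner (g : 'rV[R]_n -> R) y : R :=
  \int[leb]_(omega in `]0, r[) (g ((omega / s) *: p y) * dens m omega).

Let bH g : bounded_measurable g -> bounded_measurable
  (fun q : Y * T => g ((q.2 / s : R) *: p q.1) * dens m q.2).
Proof.
move=> bg; apply: bounded_measurableM.
  apply: (bounded_measurable_comp (p := fun q : Y * T => (q.2 / s : R) *: p q.1)) => //.
  apply: measurable_scale.
    by apply: measurable_funM; [exact: measurable_snd|exact: measurable_cst].
  exact: (measurableT_comp mp measurable_fst).
exact: (bounded_measurable_comp measurable_snd (bdens m)).
Qed.

Let bHy g y : bounded_measurable g -> bounded_measurable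
  (fun omega : T => g ((omega / s : R) *: p y) * dens m omega).
Proof.
by move=> bg; exact: (bounded_measurable_comp (pair1_measurable y) (bH bg)).
Qed.

Lemma bounded_measurable_inner g : bounded_measurable g -> bounded_measurable (inner g).
Proof.
by move=> bg; apply: (bounded_measurable_parametric (mitv _ _ _ _) (itv_lty _ _ _ _) (bH bg)).
Qed.

Lemma innerD f g : bounded_measurable f -> bounded_measurable g ->
  inner (fun x => f x + g x) = fun y => inner f y + inner g y.
Proof.
move=> bf bg; apply/funext => y; rewrite /inner.
rewrite -(Rintegral_boundedD (mitv _ _ _ _) (itv_lty _ _ _ _) (bHy y bf) (bHy y bg)).
by apply: eq_Rintegral => x _; rewrite mulrDl.
Qed.

Lemma innerE g y : bounded_measurable g ->
  ((inner g y)%:E = \int[leb]_(omega in `]0%R, r[)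
     (g ((omega / s) *: p y) * (omega ^+ m / s ^+ m.+1))%:E)%E.
Proof.
move=> bg; rewrite /inner (EFin_Rintegral (mitv _ _ _ _) (itv_lty _ _ _ _) (bHy y bg)).
by apply: eq_integral => x xr; rewrite /dens indicE xr mul1r.
Qed.

End inner.

Let disk_additive n f g : bounded_measurable f -> bounded_measurable g ->
  \int[lebesgue_rV n]_v (\1_(disk (r / s)) v * (f v + g v)) =
  \int[lebesgue_rV n]_v (\1_(disk (r / s)) v * f v) +
  \int[lebesgue_rV n]_v (\1_(disk (r / s)) v * g v).
Proof.
move=> bf bg.
rewrite -!Rintegral_indicM.
exact: (Rintegral_boundedD (@measurable_disk R n (r / s)) (disk_lty n (r / s)) bf bg).
Qed.

(** Both sides are additive in [g], so it is enough to treat nonnegative [g], for which the formula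
    with extended values holds. *)
Lemma Rintegral_disk2 g : bounded_measurable g ->
  \int[leb]_(t in `[0, 2 * pi]) \int[leb]_(omega in `]0, r[)
    (g ((omega / s) *: circle_pt t) * (omega ^+ 1 / s ^+ 2)) =
  \int[lebesgue_rV 2]_v (\1_(disk (r / s)) v * g v).
Proof.
pose P g := \int[leb]_(t in `[0, 2 * pi]) inner 1 (@circle_pt R : T -> _) g t.
pose Q (g : 'rV[R]_2 -> R) := \int[lebesgue_rV 2]_v (\1_(disk (r / s)) v * g v).
move=> bg; transitivity (P g).
  by apply: eq_Rintegral => t _; exact: densE.
move: g bg; apply: (@eq_functional_bounded _ _ _ P Q).
- move=> f g bf bg; rewrite /P innerD//; last exact: measurable_circle_pt.
  apply: (Rintegral_boundedD (mitv _ _ _ _) (itv_lty _ _ _ _)).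
    exact: (bounded_measurable_inner 1 measurable_circle_pt bf).
  exact: (bounded_measurable_inner 1 measurable_circle_pt bg).
- by move=> f g bf bg; exact: disk_additive.
- move=> f bf f0; rewrite /P /Q /Rintegral; congr fine.
  have mf : measurable_fun setT (EFin \o f).
    by case: bf => mf _; exact: measurable_EFin mf.
  have f0' v : (0 <= (EFin \o f) v)%E by rewrite lee_fin.
  have H := ge0_integral_disk2 r s0 mf f0'.
  transitivity (\int[lebesgue_rV 2]_v ((\1_(disk (r / s)%R) v : R)%:E * (EFin \o f) v))%E => //.
  rewrite H; apply: eq_integral => t _; rewrite (innerE 1 measurable_circle_pt t bf).
  by apply: eq_integral => x _.
Qed.

Lemma Rintegral_disk3 g : bounded_measurable g ->
  \int[leb]_(phi in `[0, 2 * pi]) \int[leb]_(t in `[0, pi])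
    (sin t * \int[leb]_(omega in `]0, r[)
    (g ((omega / s) *: sphere_pt t phi) * (omega ^+ 2 / s ^+ 3))) =
  \int[lebesgue_rV 3]_v (\1_(disk (r / s)) v * g v).
Proof.
pose p (q : T * T) := sphere_pt (q.2 : R) (q.1 : R).
pose A g phi := \int[leb]_(t in `[0, pi]) (sin t * inner 2 p g (phi, t)).
pose P g := \int[leb]_(phi in `[0, 2 * pi]) A g phi.
pose Q (g : 'rV[R]_3 -> R) := \int[lebesgue_rV 3]_v (\1_(disk (r / s)) v * g v).
move=> bg; transitivity (P g).
  by apply: eq_Rintegral => phi _; apply: eq_Rintegral => t _; rewrite densE.
have bS f : bounded_measurable f ->
    bounded_measurable (fun q : T * T => sin q.2 * inner 2 p f q).
  move=> bf; apply: bounded_measurableM; last exact: (bounded_measurable_inner 2 measurable_sphere_pt bf).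
  split; first exact: (measurableT_comp (@measurable_sin R) (@measurable_snd _ _ T T)).
  by exists 1 => x; exact: sin_max.
have bSy f phi : bounded_measurable f ->
    bounded_measurable (fun t : T => sin t * inner 2 p f (phi, t)).
  by move=> bf; exact: (bounded_measurable_comp (pair1_measurable phi) (bS _ bf)).
have bA f : bounded_measurable f -> bounded_measurable (A f : T -> R).
  by move=> bf; exact: (bounded_measurable_parametric (mitv _ _ _ _) (itv_lty _ _ _ _) (bS _ bf)).
move: g bg; apply: (@eq_functional_bounded _ _ _ P Q).
- move=> f g bf bg; rewrite /P.
  rewrite -(Rintegral_boundedD (mitv _ _ _ _) (itv_lty _ _ _ _) (bA _ bf) (bA _ bg)).
  apply: eq_Rintegral => phi _; rewrite /A innerD//; last exact: measurable_sphere_pt.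
  rewrite -(Rintegral_boundedD (mitv _ _ _ _) (itv_lty _ _ _ _) (bSy _ phi bf) (bSy _ phi bg)).
  by apply: eq_Rintegral => t _; rewrite mulrDr.
- by move=> f g bf bg; exact: disk_additive.
- move=> f bf f0; rewrite /P /Q /Rintegral; congr fine.
  have mf : measurable_fun setT (EFin \o f).
    by case: bf => mf _; exact: measurable_EFin mf.
  have f0' v : (0 <= (EFin \o f) v)%E by rewrite lee_fin.
  have H := ge0_integral_disk3 r s0 mf f0'.
  transitivity (\int[lebesgue_rV 3]_v ((\1_(disk (r / s)%R) v : R)%:E * (EFin \o f) v))%E => //.
  rewrite H; apply: eq_integral => phi _.
  rewrite (EFin_Rintegral (mitv _ _ _ _) (itv_lty _ _ _ _) (bSy _ phi bf)).
  apply: eq_integral => t _; rewrite EFinM (innerE 2 measurable_sphere_pt (phi, t) bf).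
  by congr (_ * _)%E; apply: eq_integral => x _.
Qed.

End Rintegral_disk.

(** * Far field patterns *)

Section support.
Context {R : realType} (n : nat).
Variable S : 'rV[R]_n -> 'rV[R[i]]_n.
Local Notation mu := (lebesgue_rV n).

(** The sigma-algebra is generated by the coordinates while the support is defined by
    neighbourhoods. Boxes with rational centres connect the two: they are measurable, countable in
    number, and form a base. *)
Let box (i : {ffun 'I_n -> rat} * nat) : set 'rV[R]_n :=
  [set y | forall j, `|y 0 j - ratr (i.1 j)| < i.2.+1%:R^-1].

Let mbox i : measurable (box i).
Proof.
rewrite (_ : box i = \bigcap_(j in [set: 'I_n])
    [set y : 'rV[R]_n | `|y 0 j - ratr (i.1 j)| < i.2.+1%:R^-1]); last first.
  by apply/seteqP; split => x /= H j; [move=> _; exact: H|exact: H].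
apply: fin_bigcap_measurable => [|j _]; first exact: finite_finset.
have -> : [set y : 'rV[R]_n | `|y 0 j - ratr (i.1 j)| < i.2.+1%:R^-1] =
    setT `&` (fun y : 'rV[R]_n => y 0 j : measurableTypeR R) @^-1`
      `]ratr (i.1 j) - i.2.+1%:R^-1, ratr (i.1 j) + i.2.+1%:R^-1[%classic.
  by rewrite setTI; apply/seteqP; split => x /=; rewrite in_itv/= ltr_distl.
exact: (measurable_coord j).
Qed.

Let nbhs_box i y : box i y -> nbhs y (box i).
Proof.
move=> Bi; apply: (@filter_forall _ _ (fun j (z : 'rV[R]_n) => `|z 0 j - ratr (i.1 j)| < i.2.+1%:R^-1) (nbhs y)) => j.
have cj : (fun z : 'rV[R]_n => z 0 j) @ y --> y 0 j by exact: coord_continuous.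
have c : (fun z : 'rV[R]_n => `|z 0 j - ratr (i.1 j)|) @ y --> `|y 0 j - ratr (i.1 j)|.
  apply: (@cvg_comp _ _ _ (fun z : 'rV[R]_n => z 0 j) (fun t : R => `|t - ratr (i.1 j)|) _ _ _ cj).
  by apply: cvg_norm; apply: cvgB; [exact: cvg_id|exact: cvg_cst].
by apply: (cvgr_lt _ c); exact: Bi.
Qed.

Let box_sub y U : nbhs y U -> exists2 i, box i y & box i `<=` U.
Proof.
move=> /nbhs_ballP[e /= e0 eU].
(* The points y and z are both within 1 / (k + 1) of the centre, so this bound has to be below e /
   2. *)
pose k := Num.truncn (2 / e).
have ke : k.+1%:R^-1 < e / 2.
  by rewrite -[ltRHS]invrK invf_div ltf_pV2 ?posrE ?divr_gt0//; exact: truncnS_gt.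
have /choice[q Hq] : forall j : 'I_n, exists q : rat, `|y 0 j - ratr q| < k.+1%:R^-1 :> R.
  move=> j; have k0 : 0 < k.+1%:R^-1 :> R by rewrite invr_gt0.
  have [|q] := @rat_in_itvoo R (y 0 j - k.+1%:R^-1) (y 0 j + k.+1%:R^-1); first by rewrite ltrD2l (lt_trans _ k0)// oppr_lt0.
  rewrite in_itv/= => qy; exists q; rewrite distrC ltr_distl; exact: qy.
exists ([ffun j => q j], k); first by move=> j; rewrite ffunE; exact: Hq.
move=> z zB; apply: eU; split => // i j; rewrite (ord1 i).
have := zB j; rewrite /= ffunE => zj; have := Hq j => yj.
rewrite /ball/=; have -> : y 0 j - z 0 j = (y 0 j - ratr (q j)) - (z 0 j - ratr (q j)) by ring.
apply: (le_lt_trans (ler_normB _ _)).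
apply: (lt_le_trans (ltrD yj zj)).
by rewrite [leRHS]splitr lerD// ltW.
Qed.

Let null_box k : set 'rV[R]_n :=
  if unpickle k is Some i then
    if `[< mu.-negligible (box i `&` [set y | S y != 0]) >] then box i else set0
  else set0.

(** A point outside the support has a neighbourhood where [S] vanishes almost everywhere, hence a
    box with that property. Countability then makes the support measurable and [S] null off it. *)
Let ess_suppC : ~` ess_supp S = \bigcup_k null_box k.
Proof.
apply/seteqP; split => x.
  rewrite /ess_supp /= => /existsNP[U /not_implyP[xU /contrapT NU]].
  have [i xi iU] := box_sub xU; exists (pickle i) => //.
  rewrite /null_box pickleK; case: ifPn => // /asboolPn[].
  by apply: negligibleS NU; exact: setSI.
move=> [k _]; rewrite /null_box; case: (unpickle k) => // i.
by case: ifPn => // /asboolP Ni xi /(_ _ (nbhs_box xi)).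
Qed.

Lemma measurable_ess_supp : measurable (ess_supp S).
Proof.
rewrite -[X in measurable X]setCK ess_suppC; apply: measurableC.
apply: bigcupT_measurable => k; rewrite /null_box.
case: (unpickle k) => [i|]; last exact: measurable0.
by case: ifPn => _; [exact: mbox|exact: measurable0].
Qed.

Lemma negligible_ess_suppC : mu.-negligible (~` ess_supp S `&` [set y | S y != 0]).
Proof.
rewrite ess_suppC setI_bigcupl; apply: negligible_bigcup => k; rewrite /null_box.
case: (unpickle k) => [i|]; last by rewrite set0I; exact: negligible_set0.
by case: ifPn => [/asboolP//|_]; rewrite set0I; exact: negligible_set0.
Qed.

End support.

Section compact_rV.
Context {R : realType} (n : nat).

Lemma compact_rV_lty (A : set 'rV[R]_n) : measurable A -> compact A ->
  (lebesgue_rV n A < +oo)%E.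
Proof.
move=> mA cA.
have bj j : exists M : R, forall x, A x -> `|x 0 j| <= M.
  have : compact ((fun x : 'rV[R]_n => x 0 j : R^o) @` A).
    by apply: continuous_compact => //; apply: continuous_subspaceT; exact: coord_continuous.
  move=> /compact_bounded[M [_ /(_ (M + 1))]] HM; exists (M + 1) => x Ax.
  by apply: HM; [rewrite ltrDl|exists x].
have [M HM] := choice bj.
apply: le_lt_trans (lebesgue_rV_box_lty n (\big[Num.max/0]_j M j)).
apply: le_measure; rewrite ?inE//; first exact: measurable_rV_box.
by move=> x Ax j /=; apply: (le_trans (HM j x Ax)); exact: le_bigmax.
Qed.

End compact_rV.

(** * Square integrable functions *)

Section Lfun2.
Context d (T : measurableType d) (R : realType).
Variable mu : {sigma_finite_measure set T -> \bar R}.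

Lemma Lfun2_measurable (f : T -> R) : f \in Lfun mu 2%:E -> measurable_fun setT f.
Proof. by move=> /sub_Lfun_mfun; rewrite inE. Qed.

Lemma Lnorm2E (f : T -> R) :
  ('N[mu]_2%:E[EFin \o f] = (\int[mu]_x (f x ^+ 2)%:E) `^ 2^-1)%E.
Proof.
rewrite unlock; congr (_ `^ _)%E; apply: eq_integral => x _ /=.
by rewrite (powR_mulrn 2)// real_normK// num_real.
Qed.

Lemma Lfun2I (f : T -> R) : measurable_fun setT f ->
  mu.-integrable setT (EFin \o (fun x => f x ^+ 2)) -> f \in Lfun mu 2%:E.
Proof.
move=> mf if2; rewrite inE; apply/andP; split; first by rewrite inE.
rewrite inE /= /finite_norm Lnorm2E poweR_lty//.
rewrite -ge0_fin_numE; first exact: (integrable_fin_num measurableT if2).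
by apply: integral_ge0 => x _; rewrite lee_fin sqr_ge0.
Qed.

(** On a set of finite measure L^2 is contained in L^1, by |f| <= 1 + f^2. *)
Lemma integrable_indicM (f : T -> R) (D : set T) : measurable D -> (mu D < +oo)%E ->
  measurable_fun setT f -> mu.-integrable setT (EFin \o (fun x => f x ^+ 2)) ->
  mu.-integrable setT (EFin \o (fun x => \1_D x * f x)) /\
  mu.-integrable setT (EFin \o (fun x => (\1_D x * f x) ^+ 2)).
Proof.
move=> mD Doo mf if2.
have iD : mu.-integrable setT (EFin \o (\1_D : T -> R)).
  by apply: ge0_integrable => //; rewrite integral_indicT.
have mDf : measurable_fun setT (fun x => \1_D x * f x).
  by apply: measurable_funM => //; exact: measurable_indic.
split.
  apply: (le_integrable measurableT _ _ (integrableD measurableT iD if2)).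
    exact: measurable_EFin mDf.
  move=> x _ /=; rewrite lee_fin indicE; have := sqr_ge0 (f x); have := sqr_ge0 (`|f x| - 1).
  rewrite sqrrB1 real_normK ?num_real//; case: (x \in D); rewrite ?mul1r ?mul0r ?normr0 => h1 h2.
    by rewrite /= mulr1n [leRHS]ger0_norm; move: h1 h2; rewrite mulr2n; lra.
  exact: normr_ge0.
apply: (le_integrable measurableT _ _ if2).
  by apply: measurable_EFin; exact: measurable_funX.
move=> x _ /=; rewrite lee_fin indicE; case: (x \in D); rewrite ?mul1r ?mul0r//.
by rewrite expr0n normr0.
Qed.

End Lfun2.

Local Open Scope complex_scope.

Section complex_parts.
Context {R : realType}.
Implicit Types x y : R[i].

Lemma Re_complexD x y : complex.Re (x + y) = complex.Re x + complex.Re y.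
Proof. by case: x y => [a b] []. Qed.

Lemma Im_complexD x y : complex.Im (x + y) = complex.Im x + complex.Im y.
Proof. by case: x y => [a b] []. Qed.

Lemma Re_complexB x y : complex.Re (x - y) = complex.Re x - complex.Re y.
Proof. by case: x y => [a b] []. Qed.

Lemma Im_complexB x y : complex.Im (x - y) = complex.Im x - complex.Im y.
Proof. by case: x y => [a b] []. Qed.

Lemma Re_complexM x y : complex.Re (x * y) =
  complex.Re x * complex.Re y - complex.Im x * complex.Im y.
Proof. by case: x y => [a b] []. Qed.

Lemma Im_complexM x y : complex.Im (x * y) =
  complex.Re x * complex.Im y + complex.Im x * complex.Re y.
Proof. by case: x y => [a b] []. Qed.

Lemma Re_sum I (r : seq I) (F : I -> R[i]) :
  complex.Re (\sum_(i <- r) F i) = \sum_(i <- r) complex.Re (F i).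
Proof. by apply: (big_morph _ Re_complexD). Qed.

Lemma Im_sum I (r : seq I) (F : I -> R[i]) :
  complex.Im (\sum_(i <- r) F i) = \sum_(i <- r) complex.Im (F i).
Proof. by apply: (big_morph _ Im_complexD). Qed.

Lemma eq_complexP x y : complex.Re x = complex.Re y -> complex.Im x = complex.Im y -> x = y.
Proof. by case: x y => [a b] [c e] /= -> ->. Qed.

End complex_parts.

Lemma Rintegral_lincomb d (T : measurableType d) (R : realType)
    (mu : {measure set T -> \bar R}) (D : set T) I (r : seq I) (v : I -> R) (f : I -> T -> R) :
  measurable D -> (forall i, mu.-integrable D (EFin \o f i)) ->
  \int[mu]_(x in D) (\sum_(i <- r) v i * f i x) = \sum_(i <- r) v i * \int[mu]_(x in D) f i x.
Proof.
move=> mD intf.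
have ivf i : mu.-integrable D (EFin \o (fun x => v i * f i x)).
  exact: (integrableZl mD (v i) (intf i)).
have isum s : mu.-integrable D (EFin \o (fun x => \sum_(i <- s) v i * f i x)).
  elim: s => [|i s IH].
    by under [fun x => _]eq_fun do rewrite big_nil; exact: integrable0.
  under [fun x => _]eq_fun do rewrite big_cons.
  exact: (integrableD mD (ivf i) IH).
elim: r => [|i s IH].
  by rewrite big_nil /Rintegral; under eq_integral do rewrite big_nil; rewrite integral0.
rewrite big_cons -IH -(RintegralZl _ mD (intf i)) -(RintegralD mD (ivf i) (isum s)).
by apply: eq_Rintegral => x _; rewrite big_cons.
Qed.

(** * Far field patterns as Fourier transforms *)

Section far_field.
Context {R : realType} (n : nat).
Variables (Omega : set 'rV[R]_n) (S : 'rV[R]_n -> 'rV[R[i]]_n).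
Local Notation mu := (lebesgue_rV n).

(** Cutting [S] off turns integrals over [Omega] into integrals over the whole space, the setting of
    the inversion theorem. *)
Definition source_re j (y : 'rV[R]_n) : R := \1_Omega y * complex.Re (S y 0 j).
Definition source_im j (y : 'rV[R]_n) : R := \1_Omega y * complex.Im (S y 0 j).

Hypotheses (ire : forall j, mu.-integrable setT (EFin \o source_re j))
  (iim : forall j, mu.-integrable setT (EFin \o source_im j)).

Definition fourier j (xi : 'rV[R]_n) : R[i] :=
  fourier_re mu (@phase R n) (source_re j) (source_im j) xi +i*
  fourier_im mu (@phase R n) (source_re j) (source_im j) xi.

Let ihf j : mu.-integrable setT (EFin \o (fun x => `|source_re j x| + `|source_im j x|)).
Proof. exact: (integrableD measurableT (integrable_abse (ire j)) (integrable_abse (iim j))). Qed.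

(** The direction [v] is arbitrary because three choices are needed: x, x^perp, and the rows of the
    projection orthogonal to x. *)
Lemma cintegral_dot (xi v : 'rV[R]_n) :
  cintegral mu Omega (fun y => expi (- dot xi y) * dot (S y) (toC v)) =
  \sum_(l < n) (v 0 l)%:C * fourier l xi.
Proof.
pose tre l y := twist_re (@phase R n) (source_re l) (source_im l) (xi, y).
pose tim l y := twist_im (@phase R n) (source_re l) (source_im l) (xi, y).
have itre l : mu.-integrable setT (EFin \o tre l).
  exact: (integrable_slice (measurable_twist_re (@measurable_phase R n) (ire l) (iim l)) (ihf l)
    (norm_twist_re (@phase R n) (source_re l) (source_im l)) xi).
have itim l : mu.-integrable setT (EFin \o tim l).
  exact: (integrable_slice (measurable_twist_im (@measurable_phase R n) (ire l) (iim l)) (ihf l)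
    (norm_twist_im (@phase R n) (source_re l) (source_im l)) xi).
apply: eq_complexP; rewrite ?Re_sum ?Im_sum /cintegral /= Rintegral_indicM.
- transitivity (\int[mu]_y (\sum_(l < n) v 0 l * tre l y)).
    apply: eq_Rintegral => y _.
    rewrite /dot mulr_sumr Re_sum mulr_sumr; apply: eq_bigr => l _.
    rewrite !Re_complexM /= !Im_complexM /toC !mxE /= cosN sinN.
    by rewrite /tre /twist_re /source_re /source_im /phase /=; ring.
  rewrite (Rintegral_lincomb _ _ measurableT itre); apply: eq_bigr => l _.
  by rewrite /= mul0r subr0.
- transitivity (\int[mu]_y (\sum_(l < n) v 0 l * tim l y)).
    apply: eq_Rintegral => y _.
    rewrite /dot mulr_sumr Im_sum mulr_sumr; apply: eq_bigr => l _.
    rewrite !Im_complexM /= !Re_complexM /toC !mxE /= cosN sinN.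
    by rewrite /tim /twist_im /source_re /source_im /phase /=; ring.
  rewrite (Rintegral_lincomb _ _ measurableT itim); apply: eq_bigr => l _.
  by rewrite /= mul0r addr0.
Qed.

End far_field.

Section elastic.
Context {R : realType}.
Variables (lambda mu : R).
Hypotheses (mu_gt0 : 0 < mu) (lame_gt0 : 0 < 2 * mu + lambda).
Let s := Num.sqrt (lambda + 2 * mu).

Let s0 : 0 < s. Proof. by rewrite sqrtr_gt0 addrC. Qed.

Lemma dotZl (K : comNzRingType) n (a : K) (x y : 'rV[K]_n) : dot (a *: x) y = a * dot x y.
Proof. by rewrite /dot mulr_sumr; apply: eq_bigr => j _; rewrite mxE mulrA. Qed.

Lemma ks_kp omega : 0 < omega -> ks mu (kp lambda mu omega / ks mu omega * omega) = omega / s.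
Proof.
move=> o0; have m0 : 0 < Num.sqrt mu by rewrite sqrtr_gt0.
by rewrite /ks /kp -/s; field; rewrite !gt_eqF.
Qed.

Section dim.
Variables (n : nat) (Omega : set 'rV[R]_n) (S : 'rV[R]_n -> 'rV[R[i]]_n).
Local Notation leb := (lebesgue_rV n).
Hypotheses (ire : forall j, leb.-integrable setT (EFin \o source_re Omega S j))
  (iim : forall j, leb.-integrable setT (EFin \o source_im Omega S j)).

Lemma up_infE x omega j : up_inf lambda mu Omega S x omega 0 j =
  (\sum_(l < n) (x 0 l)%:C * fourier Omega S l ((omega / s) *: x)) * (x 0 j)%:C.
Proof.
rewrite /up_inf !mxE -(cintegral_dot ire iim); congr (cintegral _ _ _ * _).
by apply/funext => y; rewrite dotZl.
Qed.

End dim.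

Lemma far_field2 (Omega : set 'rV[R]_2) (S : 'rV[R]_2 -> 'rV[R[i]]_2) x omega j :
  (forall j, (lebesgue_rV 2).-integrable setT (EFin \o source_re Omega S j)) ->
  (forall j, (lebesgue_rV 2).-integrable setT (EFin \o source_im Omega S j)) ->
  dot x x = 1 -> 0 < omega ->
  (up_inf lambda mu Omega S x omega +
   us_inf mu Omega S x (kp lambda mu omega / ks mu omega * omega)) 0 j =
  fourier Omega S j ((omega / s) *: x).
Proof.
move=> ire iim x1 o0; have U := up_infE ire iim x omega j.
have addE (A B : 'rV[R[i]]_2) : (A + B) 0 j = A 0 j + B 0 j by rewrite mxE.
have scaleE (a : R[i]) (A : 'rV[R[i]]_2) : (a *: A) 0 j = a * A 0 j by rewrite mxE.
rewrite addE [X in X + _ = _]U /us_inf /us_inf2 scaleE (ks_kp o0).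
rewrite (_ : cintegral _ _ _ =
    \sum_(l < 2) (perp x 0 l)%:C * fourier Omega S l ((omega / s) *: x)); last first.
  rewrite -(cintegral_dot ire iim); congr (cintegral _ _ _).
  by apply/funext => y; rewrite dotZl.
have x1' : (x 0 0)%:C * (x 0 0)%:C + (x 0 1)%:C * (x 0 1)%:C = 1 :> R[i].
  rewrite -!rmorphM -rmorphD/=; congr (_%:C); rewrite -[RHS]x1 /dot !big_ord_recl big_ord0 addr0.
  by congr (x _ _ * x _ _ + x _ _ * x _ _); exact/val_inj.
rewrite !big_ord_recl !big_ord0 !mxE /= !addr0.
have -> : lift ord0 ord0 = 1 :> 'I_2 by exact/val_inj.
have -> : ord0 = 0 :> 'I_2 by exact/val_inj.
have j2 (i : 'I_2) : i = 0 \/ i = 1.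
  by case: i => -[|[|//]] ?; [left|right]; exact/val_inj.
(* Componentwise form of F = (x . F) x + (x^perp . F) x^perp for a unit vector x. *)
have [->|->] := j2 j.
- rewrite /= rmorphN /=; move: x1'.
  move: (fourier _ _ _ _) (fourier _ _ _ _) (x 0 0)%:C (x 0 1)%:C => F0 F1 a b ab.
  by transitivity ((a * a + b * b) * F1); [ring|rewrite ab mul1r].
- rewrite /= rmorphN /=; move: x1'.
  move: (fourier _ _ _ _) (fourier _ _ _ _) (x 0 0)%:C (x 0 1)%:C => F0 F1 a b ab.
  by transitivity ((a * a + b * b) * F0); [ring|rewrite ab mul1r].
Qed.

Lemma far_field3 (Omega : set 'rV[R]_3) (S : 'rV[R]_3 -> 'rV[R[i]]_3) x omega j :
  (forall j, (lebesgue_rV 3).-integrable setT (EFin \o source_re Omega S j)) ->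
  (forall j, (lebesgue_rV 3).-integrable setT (EFin \o source_im Omega S j)) ->
  dot x x = 1 -> 0 < omega ->
  (up_inf lambda mu Omega S x omega +
   us_inf mu Omega S x (kp lambda mu omega / ks mu omega * omega)) 0 j =
  fourier Omega S j ((omega / s) *: x).
Proof.
move=> ire iim x1 o0; have U := up_infE ire iim x omega j.
rewrite mxE U.
rewrite /us_inf /us_inf3 /vintegral mxE ks_kp//.
(* Row [j] of the projection orthogonal to x: for |x| = 1 the cross product x x (S x x) equals S -
   (x . S) x, so its entry [j] is the product of S with [v]. *)
pose v : 'rV[R]_3 := delta_mx 0 j - x 0 j *: x.
have x1' : (x 0 0)%:C * (x 0 0)%:C + (x 0 1)%:C * (x 0 1)%:C + (x 0 2%R)%:C * (x 0 2%R)%:C = 1 :> R[i].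
  rewrite -!rmorphM -!rmorphD/=; congr (_%:C); rewrite -[RHS]x1 /dot !big_ord_recl big_ord0 addr0 addrA.
  by congr (x _ _ * x _ _ + x _ _ * x _ _ + x _ _ * x _ _); exact/val_inj.
have j3 (i : 'I_3) : [\/ i = 0, i = 1 | i = 2%R].
  by case: i => -[|[|[|//]]] ?; [constructor 1|constructor 2|constructor 3]; exact/val_inj.
have o1 : lift ord0 ord0 = 1 :> 'I_3 by exact/val_inj.
have o2 : lift ord0 (lift ord0 ord0) = 2%R :> 'I_3 by exact/val_inj.
have o0' : ord0 = 0 :> 'I_3 by exact/val_inj.
rewrite (_ : cintegral _ _ _ =
    \sum_(l < 3) (v 0 l)%:C * fourier Omega S l ((omega / s) *: x)); last first.
  rewrite -(cintegral_dot ire iim); congr (cintegral _ _ _).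
  apply/funext => y; rewrite dotZl mxE; congr (_ * _).
  rewrite /cross /toC /dot !mxE !big_ord_recl big_ord0 addr0 !mxE /=.
  rewrite o1 o2 o0'.
  (* The relation |x| = 1, solved for one monomial so that [ring] can use it as a rewriting rule. *)
  have x1a : (x 0 0)%:C * (x 0 0)%:C = 1 - (x 0 1)%:C * (x 0 1)%:C - (x 0 2%R)%:C * (x 0 2%R)%:C.
    by rewrite -x1'; ring.
  by case: (j3 j) => -> /=; rewrite !rmorphB !rmorphM /= ?rmorph0 ?rmorph1; move: x1a;
    move: (x 0 0)%:C (x 0 1)%:C (x 0 2%R)%:C (S y 0 0) (S y 0 1) (S y 0 2%R) => a b c0 S0 S1 S2 x1a;
    ring: x1a.
rewrite !big_ord_recl !big_ord0 !mxE /= !addr0.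
rewrite o1 o2 o0'.
by case: (j3 j) => -> /=; rewrite !rmorphB !rmorphM /= ?rmorph0 ?rmorph1; ring.
Qed.

End elastic.

(** * The truncated integral *)

Section truncated_integral.
Context {R : realType} (n : nat).
Local Notation leb := (@lebesgue_measure R).
Variables (lambda mu : R) (Omega : set 'rV[R]_n) (S : 'rV[R]_n -> 'rV[R[i]]_n).
Hypotheses (mu_gt0 : 0 < mu) (lame_gt0 : 0 < 2 * mu + lambda).
Let s := Num.sqrt (lambda + 2 * mu).
Hypotheses
  (ire : forall j, (lebesgue_rV n).-integrable setT (EFin \o source_re Omega S j))
  (iim : forall j, (lebesgue_rV n).-integrable setT (EFin \o source_im Omega S j)).

Let A j := fourier_re (lebesgue_rV n) (@phase R n) (source_re Omega S j) (source_im Omega S j).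
Let B j := fourier_im (lebesgue_rV n) (@phase R n) (source_re Omega S j) (source_im Omega S j).

(** With [synthesis_im], the parts of exp(i xi . z) times the transform of component [j], the
    integrand of the inverse transform. *)
Definition synthesis_re j (z xi : 'rV[R]_n) := cos (dot xi z) * A j xi - sin (dot xi z) * B j xi.
Definition synthesis_im j (z xi : 'rV[R]_n) := cos (dot xi z) * B j xi + sin (dot xi z) * A j xi.

Let bA j : bounded_measurable (A j).
Proof.
split; first exact: (measurable_fourier_re (@measurable_phase R n) (ire j) (iim j)).
by eexists => xi; exact: (norm_fourier_re (@measurable_phase R n) (ire j) (iim j)).
Qed.

Let bB j : bounded_measurable (B j).
Proof.
split; first exact: (measurable_fourier_im (@measurable_phase R n) (ire j) (iim j)).
by eexists => xi; exact: (norm_fourier_im (@measurable_phase R n) (ire j) (iim j)).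
Qed.

Let mdot (z : 'rV[R]_n) : measurable_fun setT (fun xi : 'rV[R]_n => dot xi z : measurableTypeR R).
Proof.
by rewrite (_ : (fun xi => _) = dot z); [exact: measurable_dot|apply/funext => xi; exact: dotC].
Qed.

Let bcos (z : 'rV[R]_n) : bounded_measurable (fun xi : 'rV[R]_n => cos (dot xi z)).
Proof.
split; first exact: (measurableT_comp (@measurable_cos R) (mdot z)).
by exists 1 => xi; exact: cos_max.
Qed.

Let bsin (z : 'rV[R]_n) : bounded_measurable (fun xi : 'rV[R]_n => sin (dot xi z)).
Proof.
split; first exact: (measurableT_comp (@measurable_sin R) (mdot z)).
by exists 1 => xi; exact: sin_max.
Qed.

Lemma bounded_synthesis_re j z : bounded_measurable (synthesis_re j z).
Proof.
apply: bounded_measurableD; first exact: bounded_measurableM.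
by apply: bounded_measurableN; exact: bounded_measurableM.
Qed.

Lemma bounded_synthesis_im j z : bounded_measurable (synthesis_im j z).
Proof. by apply: bounded_measurableD; exact: bounded_measurableM. Qed.

Let T1 j := inverse_re (lebesgue_rV n) (@phase R n) ((2 * pi) ^+ n)
  (source_re Omega S j) (source_im Omega S j).
Let T2 j := inverse_im (lebesgue_rV n) (@phase R n) ((2 * pi) ^+ n)
  (source_re Omega S j) (source_im Omega S j).

Lemma Rintegral_synthesis_re j z (D : set 'rV[R]_n) :
  ((2 * pi) ^+ n)^-1 * \int[lebesgue_rV n]_v (\1_D v * synthesis_re j z v) = T1 j D z.
Proof.
rewrite mulrC; congr (_ / _); apply: eq_Rintegral => v _.
by rewrite /twist_re /synthesis_re /phase /= (dotC z v) -/(A j v) -/(B j v); ring.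
Qed.

Lemma Rintegral_synthesis_im j z (D : set 'rV[R]_n) : measurable D -> (lebesgue_rV n D < +oo)%E ->
  ((2 * pi) ^+ n)^-1 * \int[lebesgue_rV n]_v (\1_D v * synthesis_im j z v) = T2 j D z.
Proof.
move=> mD Doo; rewrite mulrC /T2 /inverse_im -mulNr; congr (_ / _).
have i := integrable_bounded_measurable mD Doo (bounded_synthesis_im j z).
rewrite -[RHS]mulN1r.
(* [inverse_im] contains two minus signs, one for each conjugation; linearity inserts them here. *)
transitivity (- 1 * \int[lebesgue_rV n]_v (\1_D v * (- 1 * synthesis_im j z v))).
  by rewrite -!Rintegral_indicM (RintegralZl _ mD i) mulrA mulrNN mulr1 mul1r.
congr (_ * _); apply: eq_Rintegral => v _.
by rewrite /twist_im /synthesis_im /phase /= (dotC z v) -/(A j v) -/(B j v); ring.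
Qed.

Lemma powR_half (a : R) m : 0 <= a -> a `^ (m%:R / 2) = Num.sqrt a ^+ m.
Proof. by move=> a0; rewrite mulrC powRrM powR12_sqrt// powR_mulrn// sqrtr_ge0. Qed.

Hypothesis far_fieldE : forall x omega j, dot x x = 1 -> 0 < omega ->
  (up_inf lambda mu Omega S x omega +
   us_inf mu Omega S x (kp lambda mu omega / ks mu omega * omega)) 0 j =
  fourier Omega S j ((omega / s) *: x).

(** Uniform in the dimension, which enters through [far_fieldE] only; [far_field2] and [far_field3]
    supply it. *)
Lemma radial_integral r x z j : dot x x = 1 ->
  vintegral leb `]0, r[ (fun omega =>
    (expi (kp lambda mu omega * dot x z)
      * (omega ^+ n.-1 / (lambda + 2 * mu) `^ (n%:R / 2))%:C)
    *: (up_inf lambda mu Omega S x omega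
        + us_inf mu Omega S x (kp lambda mu omega / ks mu omega * omega))) 0 j =
  (\int[leb]_(omega in `]0, r[)
     (synthesis_re j z ((omega / s) *: x) * (omega ^+ n.-1 / s ^+ n))) +i*
  (\int[leb]_(omega in `]0, r[)
     (synthesis_im j z ((omega / s) *: x) * (omega ^+ n.-1 / s ^+ n))).
Proof.
move=> x1; rewrite mxE /cintegral.
have scaleE (a : R[i]) (M : 'rV[R[i]]_n) : (a *: M) 0 j = a * M 0 j by rewrite mxE.
have pE : (lambda + 2 * mu) `^ (n%:R / 2) = s ^+ n.
  by rewrite powR_half// addrC ltW.
congr (_ +i* _); apply: eq_Rintegral => omega; rewrite inE/= in_itv/= => /andP[w0 _];
  rewrite scaleE far_fieldE// pE /= /synthesis_re /synthesis_im dotZl -/(A j _) -/(B j _) /kp -/s.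
  ring.
ring.
Qed.

End truncated_integral.

Section If_trunc_components.
Context {R : realType}.
Local Notation leb := (@lebesgue_measure R).
Variables (lambda mu : R).
Hypotheses (mu_gt0 : 0 < mu) (lame_gt0 : 0 < 2 * mu + lambda).
Let s := Num.sqrt (lambda + 2 * mu).
Let s0 : 0 < s. Proof. by rewrite sqrtr_gt0 addrC. Qed.

Definition inverse n (Omega : set 'rV[R]_n) (S : 'rV[R]_n -> 'rV[R[i]]_n) j D z : R[i] :=
  inverse_re (lebesgue_rV n) (@phase R n) ((2 * pi) ^+ n)
    (source_re Omega S j) (source_im Omega S j) D z +i*
  inverse_im (lebesgue_rV n) (@phase R n) ((2 * pi) ^+ n)
    (source_re Omega S j) (source_im Omega S j) D z.

(** An equality at every [z]: the transform of the source is bounded, so polar coordinates apply to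
    the bounded integrand on the disk for each fixed [z]. *)
Lemma If_trunc2E (Omega : set 'rV[R]_2) (S : 'rV[R]_2 -> 'rV[R[i]]_2) r z j :
  (forall j, (lebesgue_rV 2).-integrable setT (EFin \o source_re Omega S j)) ->
  (forall j, (lebesgue_rV 2).-integrable setT (EFin \o source_im Omega S j)) ->
  If_trunc lambda mu Omega S r z 0 j = inverse Omega S j (disk (r / s)) z.
Proof.
move=> ire iim.
have scaleE (a : R[i]) (M : 'rV[R[i]]_2) : (a *: M) 0 j = a * M 0 j by rewrite mxE.
have vE (D : set R) (F : R -> 'rV[R[i]]_2) : vintegral leb D F 0 j = cintegral leb D (fun t => F t 0 j).
  by rewrite mxE.
rewrite /If_trunc scaleE /sphere_integral vE /cintegral.
have rad t := radial_integral lame_gt0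
  (fun x omega j => far_field2 mu_gt0 lame_gt0 j ire iim) r z j (dot_circle_pt t).
apply: eq_complexP.
- rewrite Re_complexM /= mul0r subr0 -(Rintegral_synthesis_re Omega S j z).
  congr (_ * _).
  rewrite -(Rintegral_disk2 r s0 (bounded_synthesis_re ire iim j z)).
  by apply: eq_Rintegral => t _; rewrite rad.
- rewrite Im_complexM /= mul0r addr0 -(Rintegral_synthesis_im ire iim j z (@measurable_disk R 2 (r / s)) (disk_lty 2 (r / s))).
  congr (_ * _).
  rewrite -(Rintegral_disk2 r s0 (bounded_synthesis_im ire iim j z)).
  by apply: eq_Rintegral => t _; rewrite rad.
Qed.

Lemma If_trunc3E (Omega : set 'rV[R]_3) (S : 'rV[R]_3 -> 'rV[R[i]]_3) r z j :
  (forall j, (lebesgue_rV 3).-integrable setT (EFin \o source_re Omega S j)) ->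
  (forall j, (lebesgue_rV 3).-integrable setT (EFin \o source_im Omega S j)) ->
  If_trunc lambda mu Omega S r z 0 j = inverse Omega S j (disk (r / s)) z.
Proof.
move=> ire iim.
have scaleE (a : R[i]) (M : 'rV[R[i]]_3) : (a *: M) 0 j = a * M 0 j by rewrite mxE.
have vE (D : set R) (F : R -> 'rV[R[i]]_3) : vintegral leb D F 0 j = cintegral leb D (fun t => F t 0 j).
  by rewrite mxE.
rewrite /If_trunc scaleE /sphere_integral vE /cintegral.
have rad t phi := radial_integral lame_gt0
  (fun x omega j => far_field3 mu_gt0 lame_gt0 j ire iim) r z j (dot_sphere_pt t phi).
apply: eq_complexP.
- rewrite Re_complexM /= mul0r subr0 -(Rintegral_synthesis_re Omega S j z).
  congr (_ * _).
  rewrite -(Rintegral_disk3 r s0 (bounded_synthesis_re ire iim j z)).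
  apply: eq_Rintegral => phi _; rewrite vE /cintegral /=; apply: eq_Rintegral => t _.
  by rewrite scaleE rad Re_complexM /= mul0r subr0.
- rewrite Im_complexM /= mul0r addr0 -(Rintegral_synthesis_im ire iim j z (@measurable_disk R 3 (r / s)) (disk_lty 3 (r / s))).
  congr (_ * _).
  rewrite -(Rintegral_disk3 r s0 (bounded_synthesis_im ire iim j z)).
  apply: eq_Rintegral => phi _; rewrite vE /cintegral /=; apply: eq_Rintegral => t _.
  by rewrite scaleE rad Im_complexM /= mul0r addr0.
Qed.

End If_trunc_components.

(** * Convergence in L^2 *)

Section L2_convergence.
Context {R : realType} (n : nat).
Variables (S : 'rV[R]_n -> 'rV[R[i]]_n) (s : R).
Hypotheses (s0 : 0 < s) (SL2 : in_L2 S).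
Let Omega := ess_supp S.
Hypothesis Omega_compact : compact Omega.
Local Notation leb := (lebesgue_rV n).

Let mOmega : measurable Omega. Proof. exact: measurable_ess_supp. Qed.

Let Soo : (leb Omega < +oo)%E. Proof. exact: compact_rV_lty. Qed.

Lemma integrable_source_re j : leb.-integrable setT (EFin \o source_re Omega S j) /\
  leb.-integrable setT (EFin \o (fun x => source_re Omega S j x ^+ 2)).
Proof.
have [H _] := SL2 j.
exact: (integrable_indicM mOmega Soo (Lfun2_measurable H) (Lfun2_integrable_sqr H)).
Qed.

Lemma integrable_source_im j : leb.-integrable setT (EFin \o source_im Omega S j) /\
  leb.-integrable setT (EFin \o (fun x => source_im Omega S j x ^+ 2)).
Proof.
have [_ H] := SL2 j.
exact: (integrable_indicM mOmega Soo (Lfun2_measurable H) (Lfun2_integrable_sqr H)).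
Qed.

Variable F : R -> 'rV[R]_n -> 'rV[R[i]]_n.
Hypothesis FE : forall r z j, F r z 0 j = inverse Omega S j (disk (r / s)) z.

Let D r : set 'rV[R]_n := disk (r / s).
Let mD r : measurable (D r). Proof. exact: measurable_disk. Qed.
Let Doo r : (leb (D r) < +oo)%E. Proof. exact: disk_lty. Qed.

Let inversion j r := integrable_fourier_inversion
  (integrable_source_re j).1 (integrable_source_im j).1
  (integrable_source_re j).2 (integrable_source_im j).2 (mD r) (Doo r).

Let err j r x := (complex.Re (F r x 0 j) - source_re Omega S j x) ^+ 2 +
  (complex.Im (F r x 0 j) - source_im Omega S j x) ^+ 2.

Let ierr j r : leb.-integrable setT (EFin \o err j r).
Proof.
have [_ _ _ _ i] := inversion j r; move: i.
by congr (integrable _ _ _); apply/funext => x /=; rewrite /err FE.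
Qed.

Let cvg_err j : \int[leb]_x err j r x @[r --> +oo] --> (0 : R).
Proof.
have ndD : {homo D : r s / r <= s >-> r `<=` s}.
  by move=> r t rt; apply: subset_disk; rewrite ler_pM2r ?invr_gt0.
have := cvg_fourier_inversion
  (integrable_source_re j).1 (integrable_source_im j).1
  (integrable_source_re j).2 (integrable_source_im j).2 mD Doo ndD
  (fun x => disk_cover x s0).
apply: cvg_trans; apply: near_eq_cvg; apply: nearW => r.
by apply: eq_Rintegral => x _; rewrite /err FE.
Qed.

Let in_L2_F r : in_L2 (F r).
Proof.
move=> j; have [m1 m2 i1 i2 _] := inversion j r.
split; apply: Lfun2I.
- by move: m1; congr (measurable_fun _ _); apply/funext => x; rewrite FE.
- by move: i1; congr (integrable _ _ _); apply/funext => x /=; rewrite FE.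
- by move: m2; congr (measurable_fun _ _); apply/funext => x; rewrite FE.
- by move: i2; congr (integrable _ _ _); apply/funext => x /=; rewrite FE.
Qed.

Let E r := \sum_(j < n) \int[leb]_x err j r x.

Let mF j r : measurable_fun setT (fun x => complex.Re (F r x 0 j)) /\
  measurable_fun setT (fun x => complex.Im (F r x 0 j)).
Proof. by have [H1 H2] := in_L2_F r j; split; [exact: (Lfun2_measurable H1)|exact: (Lfun2_measurable H2)]. Qed.

Let mS j : measurable_fun setT (fun x => complex.Re (S x 0 j)) /\
  measurable_fun setT (fun x => complex.Im (S x 0 j)).
Proof. by have [H1 H2] := SL2 j; split; [exact: (Lfun2_measurable H1)|exact: (Lfun2_measurable H2)]. Qed.

Let integral_vnorm r : (\int[leb]_x (vnorm (F r x - S x) ^+ 2)%:E = (E r)%:E)%E.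
Proof.
have vE x : vnorm (F r x - S x) ^+ 2 = \sum_(j < n)
    ((complex.Re (F r x 0 j) - complex.Re (S x 0 j)) ^+ 2 +
     (complex.Im (F r x 0 j) - complex.Im (S x 0 j)) ^+ 2).
  rewrite /vnorm sqr_sqrtr; last by apply: sumr_ge0 => j _; rewrite addr_ge0 ?sqr_ge0.
  by apply: eq_bigr => j _; rewrite !mxE Re_complexB Im_complexB.
have isum : leb.-integrable setT (EFin \o (fun x => \sum_(j < n) err j r x)).
  have := integrable_sum measurableT (index_enum 'I_n) (P := predT) (fun j _ => ierr j r).
  by congr (integrable _ _ _); apply/funext => x; rewrite /= sumEFin.
transitivity (\int[leb]_x (\sum_(j < n) err j r x)%R%:E)%E; last first.
  have := Rintegral_lincomb (index_enum 'I_n) (fun=> 1) measurableT (fun j => ierr j r).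
  under eq_bigr do rewrite mul1r; rewrite /E => <-.
  have -> : \int[leb]_x (\sum_(j < n) 1 * err j r x) = \int[leb]_x (\sum_(j < n) err j r x).
    by apply: eq_Rintegral => x _; apply: eq_bigr => j _; rewrite mul1r.
  by rewrite /Rintegral fineK//; exact: (integrable_fin_num measurableT isum).
(* The inversion error is measured against the source cut off to [Omega]; it differs from [S] only
   on the null set of [negligible_ess_suppC]. *)
apply: ae_eq_integral => //.
- apply: measurable_EFin.
  rewrite (_ : (fun x => vnorm (F r x - S x) ^+ 2) = (fun x => \sum_(j < n)
      ((complex.Re (F r x 0 j) - complex.Re (S x 0 j)) ^+ 2 +
       (complex.Im (F r x 0 j) - complex.Im (S x 0 j)) ^+ 2))); last exact/funext.
  apply: measurable_sum => j; have [m1 m2] := mF j r; have [m3 m4] := mS j.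
  by apply: measurable_funD; apply: measurable_funX; apply: measurable_funB.
- by case/integrableP: isum.
- apply: negligibleS (negligible_ess_suppC S) => x /= H.
  have eqE : (forall j, source_re Omega S j x = complex.Re (S x 0 j) /\
      source_im Omega S j x = complex.Im (S x 0 j)) -> False.
    move=> eqS; apply: H => _; congr EFin; rewrite vE; apply: eq_bigr => j _.
    by rewrite /err; have [-> ->] := eqS j.
  split.
    by move=> Ox; apply: eqE => j; rewrite /source_re /source_im indicE mem_set// !mul1r.
  apply/negP => /eqP S0; apply: eqE => j.
  by rewrite /source_re /source_im S0 mxE /= !mulr0.
Qed.

Let cvg_E : E r @[r --> +oo] --> (0 : R).
Proof.
rewrite /E; elim: (index_enum _) => [|j q IH].
  by under eq_fun do rewrite big_nil; exact: cvg_cst.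
under eq_fun do rewrite big_cons.
by have := cvgD (cvg_err j) IH; rewrite addr0; exact.
Qed.

Lemma L2_lim_inverse : L2_lim F S.
Proof.
split => //.
have -> : (fun r => 'N[leb]_2%:E[(fun x => (vnorm (F r x - S x))%:E)]%E) =
    (fun r => (Num.sqrt (E r))%:E).
  apply/funext => r; rewrite (Lnorm2E _ (fun x => vnorm (F r x - S x))) integral_vnorm.
  rewrite poweR_EFin powR12_sqrt//; apply: sumr_ge0 => j _.
  by apply: Rintegral_ge0 => x _; rewrite addr_ge0 ?sqr_ge0.
apply: cvg_EFin; first exact: nearW.
rewrite -(@sqrtr0 R).
apply: (@continuous_cvg _ _ _ _ _ E (@Num.sqrt R)); first exact: sqrt_continuous.
exact: cvg_E.
Qed.

End L2_convergence.

Unset Implicit Arguments.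

Theorem theorem2p1 (R : realType) (n : nat) (hn : n = 2%N \/ n = 3%N)
    (lambda mu : R) (mu_gt0 : 0 < mu) (lame_gt0 : 0 < 2 * mu + lambda)
    (S : 'rV[R]_n -> 'rV[R[i]]_n) (SL2 : in_L2 S)
    (Omega : set 'rV[R]_n) (Omega_supp : Omega = ess_supp S)
    (Omega_compact : compact Omega) :
  L2_lim (If_trunc lambda mu Omega S) S.
Proof.
subst Omega.
have s0 : 0 < Num.sqrt (lambda + 2 * mu) by rewrite sqrtr_gt0 addrC.
have ire j := (integrable_source_re SL2 Omega_compact j).1.
have iim j := (integrable_source_im SL2 Omega_compact j).1.
apply: (L2_lim_inverse s0 SL2 Omega_compact) => r z j.
case: hn => nE; subst n.
  exact: If_trunc2E.
exact: If_trunc3E.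
Qed.
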